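(* Let $k\in(0,1)$. For $u\in H_{1/4}\cup H_{3/4}$, $$G(u)=-\frac{4}{k^2(\wp(2u)-e_1)}.$$ Hence $G_2\to\infty$ on $H'_{1/4}\cup H'_{3/4}$ as $k\to0$; that is, for every $M>0$ there is $k_M>0$ such that for all $k\in(0,k_M)$, $G_2(z)>M$ for all $z\in H'_{1/4}\cup H'_{3/4}$.
   Context: For $k\in(0,1)$: $k'=\sqrt{1-k^2}$, $K(k)=\int_0^{\pi/2}\frac{d\psi}{\sqrt{1-k^2\sin^2\psi}}$, $\omega_1=2\sqrt{kk'}K(k)$, $\omega_2=2i\sqrt{kk'}K(k')$, $\omega_3=\omega_1+\omega_2$; $\wp$ is the Weierstrass function of $\mathbb{Z}\omega_1+\mathbb{Z}\omega_2$, $e_j=\wp(\omega_j/2)$. $g(u)=\wp(u)-e_3$ is the Gauss map of the auxiliary minimal surface of the charge 2 monopole with parameter $k$, and $G=\frac{4|g'|^2}{(1+|g|^2)^2}$ is the density (with respect to $dx\,dy$, $u=x+iy$) of the area measure it induces. $G_2(z)=|\omega_2|^2G(|\omega_2|z)$. $H_a=\{x+a\omega_2:0\le x<|\omega_1|\}$, and $H'_a=\{x+ia:0\le x<\tau_1\}$, where $\tau_1=\omega_1/|\omega_2|$. *)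

(* Defs.v *)
From Stdlib Require Import Reals List.
From Coquelicot Require Import Coquelicot.

Open Scope R_scope.

Definition finite_sum (f : C -> C) (L : list C) : C :=
  fold_right Cplus (RtoC 0) (map f L).

(* [s] is the limit of the net of sums of [f] over the finite subsets of [S];
   finite subsets are represented by duplicate-free lists. *)
Definition is_unordered_sum (S : C -> Prop) (f : C -> C) (s : C) : Prop :=
  forall eps : posreal, exists L0 : list C,
    (forall z, In z L0 -> S z) /\
    forall L : list C,
      NoDup L -> (forall z, In z L -> S z) -> incl L0 L ->
      Cmod (finite_sum f L - s)%C < eps.

Definition unordered_sum (S : C -> Prop) (f : C -> C) : C :=
  iota (T := C_CompleteNormedModule) (is_unordered_sum S f).

Definition lattice (w1 w2 : C) (z : C) : Prop :=
  exists m n : Z, z = (IZR m * w1 + IZR n * w2)%C.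

(* At the poles, i.e. for [u] in the lattice, the value is a junk value. *)
Definition weierstrass_p (w1 w2 : C) (u : C) : C :=
  (1 / (u * u) +
   unordered_sum (fun l => lattice w1 w2 l /\ l <> RtoC 0)
     (fun l => 1 / ((u - l) * (u - l)) - 1 / (l * l)))%C.

Definition compl_modulus (k : R) : R := sqrt (1 - k ^ 2).

Definition ellK (k : R) : R :=
  RInt (fun psi => / sqrt (1 - k ^ 2 * sin psi ^ 2)) 0 (PI / 2).

Definition omega1 (k : R) : R :=
  2 * sqrt (k * compl_modulus k) * ellK k.

Definition omega2 (k : R) : C :=
  (2 * Ci * sqrt (k * compl_modulus k) * ellK (compl_modulus k))%C.

Definition omega3 (k : R) : C := (omega1 k + omega2 k)%C.

Definition wp (k : R) : C -> C := weierstrass_p (omega1 k) (omega2 k).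

Definition e1 (k : R) : C := wp k (omega1 k / 2)%C.
Definition e2 (k : R) : C := wp k (omega2 k / 2)%C.
Definition e3 (k : R) : C := wp k (omega3 k / 2)%C.

Definition gauss_map (k : R) (u : C) : C := (wp k u - e3 k)%C.

(* Coquelicot's [C_derive] takes the limit of difference quotients along real
   increments; it is the complex derivative wherever the latter exists
   ([is_C_derive_unique]), hence off the lattice. *)
Definition area_density (k : R) (u : C) : R :=
  4 * Cmod (C_derive (gauss_map k) u) ^ 2
    / (1 + Cmod (gauss_map k u) ^ 2) ^ 2.

Definition area_density2 (k : R) (z : C) : R :=
  Cmod (omega2 k) ^ 2 * area_density k (Cmod (omega2 k) * z)%C.

Definition hseg (k a : R) (u : C) : Prop :=
  exists x : R, 0 <= x < Rabs (omega1 k) /\ u = (x + a * omega2 k)%C.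

Definition tau1 (k : R) : R := omega1 k / Cmod (omega2 k).

Definition hseg' (k a : R) (z : C) : Prop :=
  exists x : R, 0 <= x < tau1 k /\ z = (x + Ci * a)%C.

(* Main.v *)
(* Write A_i = wp - e_i. For the half period w_i/2, A_i(u) A_i(u + w_i/2) is elliptic without
   poles, hence constant by Liouville's theorem; for i = 1, 2 the constant is not zero, since
   otherwise wp would be constant along the segment from w_i/2 to its pole 0, and so the e_i are
   distinct. Summing over the four cosets of the lattice in its half expresses 4 wp(2u) by
   wp(u) and its half-period translates, hence rationally by wp(u). This is the duplication
   formula; it makes wp'^2 / (A_1 A_2 A_3) invariant under u -> 2u, so this quotient equals its
   limit 4 at 0.

   The differential equation along the real and the imaginary axis computes both half periods
   as sqrt(e_1 - e_2)^-1 K(q) and sqrt(e_1 - e_2)^-1 K(q'), with q^2 = (e_3 - e_2)/(e_1 - e_2).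
   As K is increasing, comparison with the given periods forces q = k and
   e_1 - e_2 = 1/(k k').

   On the lines in question the conjugate of u is u + w_2/2 modulo the lattice, so
   |A_2| = 1/k', and |g'|^2, |g|^2 and wp(2u) - e_1 become rational functions of A_2(u). They
   give G_2 >= 16 K(k')^2 k'^2, and K(k') >= - ln k. *)

Require Import Defs.
From Stdlib Require Import Reals Ranalysis5 List FinFun Lra Lia ZArith ClassicalEpsilon.
From Coquelicot Require Import Coquelicot.

(** * Unordered sums *)

(** Holomorphy is used only to first order, with no power series and no contour integrals: Cauchy's
    formula comes from differentiating real integrals over circles with respect to the radius. The
    singularities of A_i(u) A_i(u + w_i/2) therefore cannot be removed by a Laurent expansion.
    Instead the series of A_i at w_i/2 + u is averaged with the one at w_i/2 - u; the result is u^2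
    times a series in u^2, and this explicit double zero cancels the double pole of A_i(u).

    Translations act on the series only through differences wp(u) - wp(v): there the terms 1/l^2
    cancel and the sum runs over the whole lattice. Hence evenness is needed to get periodicity, and
    duplication first appears up to an additive constant.

    The closing algebra rests on one circle: w = A_2(u) satisfies |w| = 1/k', and the values of w at
    which A_3 and A_1 vanish, k/k' and 1/(k k'), are inverse points of it. So |A_1| is |A_3|/k, and
    the conjugate of w is 1/(k'^2 w). *)

Ltac C_ring := apply injective_projections; simpl; ring.
Ltac C_field := apply injective_projections; simpl; field.

Definition rsum {A : Type} (g : A -> R) (L : list A) : R := fold_right Rplus 0 (map g L).

(** Absolute convergence with an explicit bound, phrased through finite partial sums so that no
    enumeration of [S] has to be chosen. The same [B] later bounds the modulus of the sum and the
    remainder of termwise differentiation. *)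
Definition summable_by (S : C -> Prop) (g : C -> R) (B : R) : Prop :=
  forall L, NoDup L -> (forall z, In z L -> S z) -> rsum g L <= B.

Lemma rsum_nonneg {A} (g : A -> R) L : (forall z, In z L -> 0 <= g z) -> 0 <= rsum g L.
Proof.
  induction L as [|x L IH]; intros H; unfold rsum; simpl; [lra|].
  assert (0 <= rsum g L) by (apply IH; intros; apply H; now right).
  assert (0 <= g x) by (apply H; now left). unfold rsum in *; lra.
Qed.

Lemma rsum_le (g h : C -> R) L :
  (forall z, In z L -> g z <= h z) -> rsum g L <= rsum h L.
Proof.
  induction L as [|x L IH]; intros H; unfold rsum; simpl; [lra|].
  assert (rsum g L <= rsum h L) by (apply IH; intros; apply H; now right).
  assert (g x <= h x) by (apply H; now left). unfold rsum in *; lra.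
Qed.

Lemma rsum_app {A} (g : A -> R) L1 L2 : rsum g (L1 ++ L2) = rsum g L1 + rsum g L2.
Proof.
  induction L1 as [|x L IH]; unfold rsum in *; simpl; [lra|]. rewrite IH; lra.
Qed.

Lemma rsum_scal (g : C -> R) k L : rsum (fun z => k * g z) L = k * rsum g L.
Proof.
  induction L as [|x L IH]; unfold rsum in *; simpl; [lra|]. rewrite IH; lra.
Qed.

Lemma rsum_incl (g : C -> R) (L1 L2 : list C) :
  NoDup L1 -> incl L1 L2 -> (forall z, In z L2 -> 0 <= g z) ->
  rsum g L1 <= rsum g L2.
Proof.
  revert L2; induction L1 as [|x L1 IH]; intros L2 ND Hi Hp.
  - now apply rsum_nonneg.
  - inversion ND as [|? ? Hx ND']; subst.
    destruct (in_split x L2) as [l1 [l2 ->]]; [apply Hi; now left|].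
    assert (H : rsum g L1 <= rsum g (l1 ++ l2)).
    { apply IH; trivial.
      - intros z Hz. assert (Hz' : In z (l1 ++ x :: l2)) by (apply Hi; now right).
        apply in_app_iff in Hz'. apply in_app_iff.
        destruct Hz' as [|[->|]]; auto. contradiction.
      - intros z Hz; apply Hp. apply in_app_iff in Hz; apply in_app_iff.
        simpl; tauto. }
    rewrite rsum_app in *. unfold rsum in *; simpl; lra.
Qed.

Lemma summable_by_le (S S' : C -> Prop) (g h : C -> R) (k B : R) :
  0 <= k -> (forall z, S' z -> S z) -> (forall z, S' z -> g z <= k * h z) ->
  summable_by S h B -> summable_by S' g (k * B).
Proof.
  intros Hk HS Hg HB L ND HL.
  apply Rle_trans with (rsum (fun z => k * h z) L).
  - apply rsum_le; auto.
  - rewrite rsum_scal. apply Rmult_le_compat_l; auto.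
Qed.

Lemma finite_sum_plus f g L :
  finite_sum (fun z => (f z + g z)%C) L = (finite_sum f L + finite_sum g L)%C.
Proof.
  induction L as [|x L IH]; unfold finite_sum in *; simpl; [ring|]. rewrite IH; ring.
Qed.

Lemma finite_sum_scal f (c : C) L :
  finite_sum (fun z => (c * f z)%C) L = (c * finite_sum f L)%C.
Proof.
  induction L as [|x L IH]; unfold finite_sum in *; simpl; [ring|]. rewrite IH; ring.
Qed.

Lemma finite_sum_conj f L :
  finite_sum (fun z => Cconj (f z)) L = Cconj (finite_sum f L).
Proof.
  induction L as [|x L IH]; unfold finite_sum in *; simpl.
  - C_ring.
  - rewrite IH. symmetry; apply Cplus_conj.
Qed.

Lemma finite_sum_map f (phi : C -> C) L :
  finite_sum f (map phi L) = finite_sum (fun z => f (phi z)) L.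
Proof. unfold finite_sum. now rewrite map_map. Qed.

Lemma finite_sum_RtoC (g : C -> R) L : finite_sum (fun z => RtoC (g z)) L = RtoC (rsum g L).
Proof.
  induction L as [|x L IH]; unfold finite_sum, rsum in *; simpl; [reflexivity|].
  rewrite IH; now rewrite RtoC_plus.
Qed.

Lemma finite_sum_bound f L : Cmod (finite_sum f L) <= rsum (fun z => Cmod (f z)) L.
Proof.
  induction L as [|x L IH]; unfold finite_sum, rsum in *; simpl.
  - rewrite Cmod_0; lra.
  - eapply Rle_trans; [apply Cmod_triangle|]. lra.
Qed.

Lemma finite_sum_ext (S : C -> Prop) f g L :
  (forall z, S z -> f z = g z) -> (forall z, In z L -> S z) ->
  finite_sum f L = finite_sum g L.
Proof.
  intros H HL. unfold finite_sum. f_equal. apply map_ext_in; auto.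
Qed.

(** Finite subsets are directed: [K] and the list supplied by convergence are merged and made
    duplicate-free. Two limits can then be compared on a common finite set. *)
Lemma unordered_sum_approx S f s eps (K : list C) :
  is_unordered_sum S f s -> 0 < eps -> (forall z, In z K -> S z) ->
  exists L, NoDup L /\ (forall z, In z L -> S z) /\ incl K L /\
    Cmod (finite_sum f L - s) < eps.
Proof.
  intros H He HK. destruct (H (mkposreal eps He)) as [L0 [H0 H1]].
  exists (nodup Ceq_dec (K ++ L0)).
  assert (HS : forall z, In z (nodup Ceq_dec (K ++ L0)) -> S z).
  { intros z Hz. rewrite nodup_In, in_app_iff in Hz. destruct Hz; auto. }
  split; [apply NoDup_nodup|]. split; [exact HS|]. split.
  - intros z Hz. rewrite nodup_In, in_app_iff; auto.
  - apply H1; auto using NoDup_nodup.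
    intros z Hz. rewrite nodup_In, in_app_iff; auto.
Qed.

Lemma Cminus_neq0 (x y : C) : x <> y -> (x - y)%C <> 0%C.
Proof.
  intros H E. apply H. replace x with (x - y + y)%C by ring. rewrite E; ring.
Qed.

Lemma Cneq_of_minus (x y : C) : (x - y)%C <> 0%C -> x <> y.
Proof. intros H E. apply H. rewrite E; ring. Qed.

Lemma Ceq_of_minus (x y : C) : (x - y)%C = 0%C -> x = y.
Proof. intros E. replace x with (x - y + y)%C by ring. rewrite E; ring. Qed.

Lemma Cmod_lt_eq0 (z : C) : (forall eps, 0 < eps -> Cmod z < eps) -> z = 0%C.
Proof.
  intros H. apply Cmod_eq_0. apply Rle_antisym; [|apply Cmod_ge_0].
  destruct (Rle_lt_dec (Cmod z) 0) as [|Hp]; trivial.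
  specialize (H _ Hp); lra.
Qed.

Lemma unordered_sum_inj S f s s' :
  is_unordered_sum S f s -> is_unordered_sum S f s' -> s = s'.
Proof.
  intros H H'.
  apply Ceq_of_minus, Cmod_lt_eq0. intros eps He.
    destruct (H (mkposreal (eps / 2) ltac:(lra))) as [L0 [H0 H1]].
    destruct (unordered_sum_approx S f s' (eps / 2) L0 H' ltac:(lra) H0)
      as [L [ND [HL [Hi Ha]]]].
    specialize (H1 L ND HL Hi). simpl in H1.
    replace (s - s')%C with (- (finite_sum f L - s) + (finite_sum f L - s'))%C by ring.
  eapply Rle_lt_trans; [apply Cmod_triangle|]. rewrite Cmod_opp. lra.
Qed.

Lemma unordered_sum_eq S f s : is_unordered_sum S f s -> unordered_sum S f = s.
Proof.
  intros H. unfold unordered_sum.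
  apply (iota_unique (V := C_CompleteNormedModule)); trivial.
  intros y Hy. eapply unordered_sum_inj; eauto.
Qed.

Lemma is_unordered_sum_ext (S : C -> Prop) f g s :
  (forall z, S z -> f z = g z) -> is_unordered_sum S f s -> is_unordered_sum S g s.
Proof.
  intros E H eps. destruct (H eps) as [L0 [H0 H1]]. exists L0; split; trivial.
  intros L ND HL Hi. rewrite <- (finite_sum_ext S f g L); auto.
Qed.

Lemma is_unordered_sum_plus (S : C -> Prop) f g s t :
  is_unordered_sum S f s -> is_unordered_sum S g t ->
  is_unordered_sum S (fun z => (f z + g z)%C) (s + t)%C.
Proof.
  intros Hf Hg eps.
  assert (He : 0 < eps / 2) by (generalize (cond_pos eps); lra).
  destruct (Hf (mkposreal _ He)) as [L1 [A1 B1]].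
  destruct (Hg (mkposreal _ He)) as [L2 [A2 B2]].
  exists (L1 ++ L2); split.
  - intros z Hz; apply in_app_iff in Hz; destruct Hz; auto.
  - intros L ND HL Hi. rewrite finite_sum_plus.
    assert (I1 : incl L1 L) by (intros z Hz; apply Hi, in_app_iff; auto).
    assert (I2 : incl L2 L) by (intros z Hz; apply Hi, in_app_iff; auto).
    specialize (B1 L ND HL I1). specialize (B2 L ND HL I2). simpl in *.
    replace (finite_sum f L + finite_sum g L - (s + t))%C
      with ((finite_sum f L - s) + (finite_sum g L - t))%C by ring.
    eapply Rle_lt_trans; [apply Cmod_triangle|]. lra.
Qed.

Lemma is_unordered_sum_scal (S : C -> Prop) f s (c : C) :
  is_unordered_sum S f s -> is_unordered_sum S (fun z => (c * f z)%C) (c * s)%C.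
Proof.
  intros Hf eps.
  assert (Hc : 0 < Cmod c + 1) by (generalize (Cmod_ge_0 c); lra).
  assert (He : 0 < eps / (Cmod c + 1)).
  { apply Rdiv_lt_0_compat; trivial. apply cond_pos. }
  destruct (Hf (mkposreal _ He)) as [L1 [A1 B1]].
  exists L1; split; trivial. intros L ND HL Hi. rewrite finite_sum_scal.
  specialize (B1 L ND HL Hi). simpl in B1.
  replace (c * finite_sum f L - c * s)%C with (c * (finite_sum f L - s))%C by ring.
  rewrite Cmod_mult.
  apply Rle_lt_trans with ((Cmod c) * (eps / (Cmod c + 1))).
  - apply Rmult_le_compat_l; [apply Cmod_ge_0|lra].
  - replace (pos eps) with ((Cmod c + 1) * (eps / (Cmod c + 1))) at 2 by (field; lra).
    apply Rmult_lt_compat_r; lra.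
Qed.

Lemma is_unordered_sum_minus (S : C -> Prop) f g s t :
  is_unordered_sum S f s -> is_unordered_sum S g t ->
  is_unordered_sum S (fun z => (f z - g z)%C) (s - t)%C.
Proof.
  intros Hf Hg.
  replace (s - t)%C with (s + - (1) * t)%C by ring.
  apply (is_unordered_sum_ext S (fun z => (f z + - (1) * g z)%C)).
  - intros; ring.
  - apply is_unordered_sum_plus; trivial. now apply is_unordered_sum_scal.
Qed.

(** The inverse [psi] carries the finite list of the target sum back to [S]. Evenness, translation
    invariance, compatibility with conjugation and the passage to cosets all come from this
    lemma. *)
Lemma is_unordered_sum_reindex (S S' : C -> Prop) (phi psi : C -> C) f s :
  (forall z, S z -> S' (phi z)) -> (forall z, S' z -> S (psi z)) ->
  (forall z, psi (phi z) = z) -> (forall z, phi (psi z) = z) ->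
  is_unordered_sum S' f s -> is_unordered_sum S (fun z => f (phi z)) s.
Proof.
  intros HS HS' E1 E2 H eps. destruct (H eps) as [L0 [A B]].
  exists (map psi L0); split.
  - intros z Hz. apply in_map_iff in Hz. destruct Hz as [w [<- Hw]]. auto.
  - intros L ND HL Hi. rewrite <- finite_sum_map. apply B.
    + apply FinFun.Injective_map_NoDup; trivial.
      intros x y Hxy. rewrite <- (E1 x), <- (E1 y). now f_equal.
    + intros z Hz. apply in_map_iff in Hz. destruct Hz as [w [<- Hw]]. auto.
    + intros z Hz. apply in_map_iff. exists (psi z). split; trivial.
      apply Hi. now apply in_map.
Qed.

Lemma is_unordered_sum_conj (S : C -> Prop) f s :
  is_unordered_sum S f s -> is_unordered_sum S (fun z => Cconj (f z)) (Cconj s).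
Proof.
  intros H eps. destruct (H eps) as [L0 [A B]]. exists L0; split; trivial.
  intros L ND HL Hi. rewrite finite_sum_conj, <- Cminus_conj, Cmod_conj. auto.
Qed.

Lemma partition_finite_sum (P : C -> Prop) f L :
  NoDup L ->
  exists L1 L2, NoDup L1 /\ NoDup L2 /\
    (forall z, In z L1 <-> In z L /\ P z) /\ (forall z, In z L2 <-> In z L /\ ~ P z) /\
    finite_sum f L = (finite_sum f L1 + finite_sum f L2)%C.
Proof.
  intros ND.
  pose (b := fun z => if excluded_middle_informative (P z) then true else false).
  exists (filter b L), (filter (fun z => negb (b z)) L).
  split; [now apply NoDup_filter|]. split; [now apply NoDup_filter|].
  assert (Hb : forall z, b z = true <-> P z).
  { intros z; unfold b; destruct (excluded_middle_informative (P z)); split; easy. }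
  split; [intros z; rewrite filter_In, Hb; tauto|].
  split.
  { intros z; rewrite filter_In. rewrite Bool.negb_true_iff, <- Hb.
    destruct (b z); intuition congruence. }
  clear ND. induction L as [|x L IH]; unfold finite_sum in *; simpl; [ring|].
  rewrite IH. destruct (b x); simpl; ring.
Qed.

(** Used to restore the term at the origin to the sum over nonzero lattice points, and to glue the
    four cosets of the duplication formula. *)
Lemma is_unordered_sum_union (S S' : C -> Prop) f s s' :
  (forall z, S z -> S' z -> False) ->
  is_unordered_sum S f s -> is_unordered_sum S' f s' ->
  is_unordered_sum (fun z => S z \/ S' z) f (s + s')%C.
Proof.
  intros D H H' eps.
  assert (He : 0 < eps / 2) by (generalize (cond_pos eps); lra).
  destruct (H (mkposreal _ He)) as [L1 [A1 B1]].
  destruct (H' (mkposreal _ He)) as [L2 [A2 B2]].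
  exists (L1 ++ L2); split.
  - intros z Hz; apply in_app_iff in Hz; destruct Hz; auto.
  - intros L ND HL Hi.
    destruct (partition_finite_sum S f L ND) as [M1 [M2 [N1 [N2 [E1 [E2 E]]]]]].
    assert (C1 : Cmod (finite_sum f M1 - s) < eps / 2).
    { apply B1; trivial.
      - intros z Hz; now apply E1.
      - intros z Hz. apply E1. split; auto. apply Hi, in_app_iff; auto. }
    assert (C2 : Cmod (finite_sum f M2 - s') < eps / 2).
    { apply B2; trivial.
      - intros z Hz; apply E2 in Hz. destruct Hz as [Hz Hn].
        destruct (HL z Hz); [contradiction|trivial].
      - intros z Hz. apply E2. split; [apply Hi, in_app_iff; auto|].
        intros Hs. apply (D z); auto. }
    rewrite E.
    replace (finite_sum f M1 + finite_sum f M2 - (s + s'))%C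
      with ((finite_sum f M1 - s) + (finite_sum f M2 - s'))%C by ring.
    eapply Rle_lt_trans; [apply Cmod_triangle|]. lra.
Qed.

Lemma is_unordered_sum_singleton (p : C) f : is_unordered_sum (fun z => z = p) f (f p).
Proof.
  intros eps. exists (p :: nil). split.
  - simpl; intuition.
  - intros L ND HL Hi.
    assert (E : L = p :: nil).
    { destruct L as [|x [|y L]].
      - destruct (Hi p); now left.
      - f_equal. apply HL; now left.
      - inversion ND as [|? ? Hx _]; subst. exfalso; apply Hx.
        rewrite (HL x), (HL y); simpl; auto. }
    rewrite E. unfold finite_sum; simpl.
    replace (f p + 0 - f p)%C with (RtoC 0) by ring. rewrite Cmod_0. apply cond_pos.
Qed.

Lemma is_unordered_sum_bound (S : C -> Prop) f s B :
  summable_by S (fun z => Cmod (f z)) B -> is_unordered_sum S f s -> Cmod s <= B.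
Proof.
  intros HB H. apply Rnot_lt_le; intros Hlt.
  destruct (unordered_sum_approx S f s (Cmod s - B) nil H ltac:(lra))
    as [L [ND [HL [_ Ha]]]]; [easy|].
  assert (Cmod (finite_sum f L) <= B).
  { eapply Rle_trans; [apply finite_sum_bound|]. now apply HB. }
  assert (Cmod s <= Cmod (finite_sum f L) + Cmod (finite_sum f L - s)).
  { replace s with (finite_sum f L + - (finite_sum f L - s))%C at 1 by ring.
    eapply Rle_trans; [apply Cmod_triangle|]. rewrite Cmod_opp. lra. }
  lra.
Qed.

(** The value is the supremum of the finite sums: a list that comes within [eps] of it still does so
    after enlargement, because the terms are nonnegative. *)
Lemma nonneg_unordered_sum (S : C -> Prop) (g : C -> R) B :
  (forall z, 0 <= g z) -> summable_by S g B ->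
  exists s : R, is_unordered_sum S (fun z => RtoC (g z)) (RtoC s).
Proof.
  intros Hg HB.
  pose (E := fun x => exists L, NoDup L /\ (forall z, In z L -> S z) /\ x = rsum g L).
  destruct (completeness E) as [s [Hub Hlub]].
  - exists B. intros x [L [ND [HL ->]]]. now apply HB.
  - exists 0. exists nil. split; [constructor|]. split; [easy|reflexivity].
  - exists s. intros eps. generalize (cond_pos eps); intros He.
    destruct (classic (exists L, NoDup L /\ (forall z, In z L -> S z) /\ s - eps < rsum g L))
      as [[L0 [ND0 [HL0 H0]]]|Hn].
    + exists L0; split; trivial. intros L ND HL Hi.
      rewrite finite_sum_RtoC, <- RtoC_minus, Cmod_R.
      assert (rsum g L0 <= rsum g L) by (apply rsum_incl; auto).
      assert (rsum g L <= s) by (apply Hub; exists L; auto).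
      rewrite Rabs_left1; lra.
    + exfalso. assert (s <= s - eps); [|lra].
      apply Hlub. intros x [L [ND [HL ->]]].
      apply Rnot_lt_le. intros Hlt. apply Hn. exists L; auto.
Qed.

(** Write [g] as [(h + g) - h]; both parts are nonnegative, with finite sums at most [2 * B] and
    [B]. *)
Lemma real_unordered_sum (S : C -> Prop) (g h : C -> R) B :
  (forall z, Rabs (g z) <= h z) -> summable_by S h B ->
  exists s : R, is_unordered_sum S (fun z => RtoC (g z)) (RtoC s).
Proof.
  intros Hg HB.
  assert (Hp : forall z, 0 <= h z + g z).
  { intros z; generalize (Hg z); unfold Rabs; destruct (Rcase_abs (g z)); lra. }
  assert (Hh : forall z, 0 <= h z).
  { intros z; generalize (Hg z) (Rabs_pos (g z)); lra. }
  destruct (nonneg_unordered_sum S (fun z => h z + g z) (2 * B)) as [s Hs]; trivial.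
  { apply summable_by_le with S h; trivial; [lra|].
    intros z _; generalize (Hg z); unfold Rabs; destruct (Rcase_abs (g z)); lra. }
  destruct (nonneg_unordered_sum S h B) as [t Ht]; trivial.
  exists (s - t). rewrite RtoC_minus.
  eapply is_unordered_sum_ext; [|apply is_unordered_sum_minus; eassumption].
  intros z _; simpl. rewrite <- RtoC_minus. f_equal; ring.
Qed.

Lemma unordered_sum_exists (S : C -> Prop) f B :
  summable_by S (fun z => Cmod (f z)) B -> exists s, is_unordered_sum S f s.
Proof.
  intros HB.
  destruct (real_unordered_sum S (fun z => Re (f z)) _ B (fun z => re_le_Cmod (f z)) HB)
    as [s Hs].
  assert (Him : forall z, Rabs (Im (f z)) <= Cmod (f z)).
  { intros z. eapply Rle_trans; [apply Rmax_r|apply Rmax_Cmod]. }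
  destruct (real_unordered_sum S (fun z => Im (f z)) _ B Him HB) as [t Ht].
  exists (s + Ci * t)%C.
  eapply is_unordered_sum_ext;
    [|apply is_unordered_sum_plus;
      [exact Hs|apply (is_unordered_sum_scal _ (fun z => RtoC (Im (f z))) _ Ci), Ht]].
  intros z _. simpl. apply injective_projections; simpl; unfold Re, Im; ring.
Qed.

(** * Holomorphic functions with a locally uniform quadratic remainder *)

(* A quadratic remainder with a locally uniform constant passes to sums over the lattice
   term by term, and it already forces [f'] to be continuous. *)
Definition hol_on (f f' : C -> C) (p : C) (r M : R) : Prop :=
  forall u v, Cmod (u - p) < r -> Cmod (v - p) < r ->
    Cmod (f v - f u - f' u * (v - u)) <= M * Cmod (v - u) ^ 2.

Definition hol_at (f : C -> C) (p : C) : Prop :=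
  exists f' r M, 0 < r /\ hol_on f f' p r M.

(** The five local estimates that the product and chain rules consume, packed with a single constant
    and a single radius. *)
Definition hol_near (f f' : C -> C) (p : C) (r B : R) : Prop :=
  forall u v, Cmod (u - p) < r -> Cmod (v - p) < r ->
    Cmod (f u) <= B /\ Cmod (f' u) <= B /\ Cmod (f v - f u) <= B * Cmod (v - u) /\
    Cmod (f' v - f' u) <= B * Cmod (v - u) /\
    Cmod (f v - f u - f' u * (v - u)) <= B * Cmod (v - u) ^ 2.

Lemma Cmod_sym (u v : C) : Cmod (u - v) = Cmod (v - u).
Proof. replace (u - v)%C with (- (v - u))%C by ring. apply Cmod_opp. Qed.

Lemma Cmod_minus_le (u v : C) : Cmod u - Cmod v <= Cmod (u - v).
Proof.
  assert (Cmod u <= Cmod v + Cmod (u - v)); [|lra].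
  replace u with (v + (u - v))%C at 1 by ring. apply Cmod_triangle.
Qed.

Lemma Cmod_dist_triangle (u v w : C) : Cmod (u - w) <= Cmod (u - v) + Cmod (v - w).
Proof. replace (u - w)%C with ((u - v) + (v - w))%C by ring. apply Cmod_triangle. Qed.

Lemma Cmod_minus_triangle (u v : C) : Cmod (u - v) <= Cmod u + Cmod v.
Proof.
  replace (u - v)%C with (u + - v)%C by ring.
  eapply Rle_trans; [apply Cmod_triangle|]. rewrite Cmod_opp; lra.
Qed.

Lemma Cmod_center (p : C) : Cmod (p - p) = 0.
Proof. replace (p - p)%C with (RtoC 0) by ring. apply Cmod_0. Qed.

(* Exchanging [u] and [v] in the quadratic estimate shows that [f'] is Lipschitz. *)
Lemma hol_on_deriv_lip f f' p r M u v :
  hol_on f f' p r M -> Cmod (u - p) < r -> Cmod (v - p) < r ->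
  Cmod (f' v - f' u) <= 2 * M * Cmod (v - u).
Proof.
  intros H Hu Hv.
  generalize (H u v Hu Hv) (H v u Hv Hu). rewrite (Cmod_sym u v). intros H1 H2.
  destruct (Ceq_dec u v) as [->|Hne].
  { rewrite !Cmod_center; lra. }
  assert (Hd : 0 < Cmod (v - u)).
  { apply Cmod_gt_0. intros E. apply Hne.
    replace u with (v - (v - u))%C by ring. rewrite E; ring. }
  apply Rmult_le_reg_r with (Cmod (v - u)); trivial.
  rewrite <- Cmod_mult.
  replace ((f' v - f' u) * (v - u))%C
    with ((f v - f u - f' u * (v - u)) + (f u - f v - f' v * (u - v)))%C by ring.
  eapply Rle_trans; [apply Cmod_triangle|]. lra.
Qed.

(** The remainder estimate alone implies the other bounds: [f'] is Lipschitz, hence bounded on the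
    disc, hence [f] is Lipschitz and bounded there. *)
Lemma hol_at_near f p : hol_at f p ->
  exists f' r B, 0 < r /\ 0 <= B /\ hol_near f f' p r B.
Proof.
  intros [f' [r [M [Hr H]]]].
  assert (Hp : Cmod (p - p) < r) by (rewrite Cmod_center; trivial).
  pose (M1 := Rabs M).
  assert (HM : M <= M1) by apply Rle_abs.
  assert (HM0 : 0 <= M1) by apply Rabs_pos.
  generalize (Cmod_ge_0 (f' p)) (Cmod_ge_0 (f p)); intros P1 P2.
  assert (Q0 : 0 <= M1 * r) by (apply Rmult_le_pos; lra).
  (* [B1] bounds [f'], [B2] is a Lipschitz constant of [f] (two points of the disc are less than
     [2 * r] apart), and [B] dominates the constants of all five estimates. *)
  pose (B1 := Cmod (f' p) + 2 * M1 * r).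
  pose (B2 := B1 + M1 * (2 * r)).
  pose (B := Cmod (f p) + B2 * r + B2 + 2 * M1 + B1).
  assert (HB1 : 0 <= B1) by (unfold B1; nra).
  assert (HB2 : 0 <= B2) by (unfold B2; nra).
  assert (HB2r : 0 <= B2 * r) by (apply Rmult_le_pos; lra).
  assert (L' : forall u v, Cmod (u - p) < r -> Cmod (v - p) < r ->
    Cmod (f' v - f' u) <= 2 * M1 * Cmod (v - u)).
  { intros u v Hu Hv. eapply Rle_trans; [eapply hol_on_deriv_lip; eauto|].
    apply Rmult_le_compat_r; [apply Cmod_ge_0|lra]. }
  assert (D' : forall u, Cmod (u - p) < r -> Cmod (f' u) <= B1).
  { intros u Hu. generalize (L' p u Hp Hu). intros HL.
    generalize (Cmod_minus_le (f' u) (f' p)); intros HT.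
    assert (2 * M1 * Cmod (u - p) <= 2 * M1 * r) by (apply Rmult_le_compat_l; lra).
    unfold B1; lra. }
  assert (E' : forall u v, Cmod (u - p) < r -> Cmod (v - p) < r ->
    Cmod (f v - f u - f' u * (v - u)) <= M1 * Cmod (v - u) ^ 2).
  { intros u v Hu Hv. eapply Rle_trans; [apply H; trivial|].
    apply Rmult_le_compat_r; [apply pow2_ge_0|lra]. }
  assert (L : forall u v, Cmod (u - p) < r -> Cmod (v - p) < r ->
    Cmod (f v - f u) <= B2 * Cmod (v - u)).
  { intros u v Hu Hv.
    replace (f v - f u)%C with ((f v - f u - f' u * (v - u)) + f' u * (v - u))%C by ring.
    eapply Rle_trans; [apply Cmod_triangle|]. rewrite Cmod_mult.
    generalize (E' u v Hu Hv) (D' u Hu) (Cmod_ge_0 (v - u)); intros HE HD HC.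
    assert (Hvu : Cmod (v - u) <= 2 * r).
    { generalize (Cmod_dist_triangle v p u). rewrite (Cmod_sym p u). lra. }
    assert (Cmod (f' u) * Cmod (v - u) <= B1 * Cmod (v - u))
      by (apply Rmult_le_compat_r; trivial).
    assert (M1 * Cmod (v - u) ^ 2 <= M1 * (2 * r) * Cmod (v - u)).
    { simpl. rewrite Rmult_1_r, <- Rmult_assoc.
      apply Rmult_le_compat_r; trivial. now apply Rmult_le_compat_l. }
    unfold B2. lra. }
  exists f', r, B. split; trivial. split; [unfold B; nra|].
  intros u v Hu Hv. generalize (Cmod_ge_0 (v - u)); intros HC.
  repeat split.
  - generalize (L p u Hp Hu) (Cmod_minus_le (f u) (f p)); intros HL HT.
    assert (B2 * Cmod (u - p) <= B2 * r) by (apply Rmult_le_compat_l; lra).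
    unfold B; lra.
  - generalize (D' u Hu). unfold B; lra.
  - eapply Rle_trans; [apply L; trivial|]. apply Rmult_le_compat_r; trivial. unfold B; lra.
  - eapply Rle_trans; [apply L'; trivial|]. apply Rmult_le_compat_r; trivial. unfold B; lra.
  - eapply Rle_trans; [apply E'; trivial|].
    apply Rmult_le_compat_r; [apply pow2_ge_0|]. unfold B; lra.
Qed.

Lemma hol_near_shrink f f' p r B r' B' :
  r' <= r -> B <= B' -> hol_near f f' p r B -> hol_near f f' p r' B'.
Proof.
  intros Hr HB H u v Hu Hv. destruct (H u v) as [H1 [H2 [H3 [H4 H5]]]]; try lra.
  generalize (Cmod_ge_0 (v - u)) (pow2_ge_0 (Cmod (v - u))); intros HC HC2.
  repeat split; try lra; (eapply Rle_trans; [eassumption|]);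
    now apply Rmult_le_compat_r.
Qed.

Ltac split_min :=
  repeat match goal with
  | H : _ < Rmin _ _ |- _ => apply Rmin_Rgt_l in H; destruct H
  | H : Rmin _ _ > _ |- _ => apply Rmin_Rgt_l in H; destruct H
  end; lra.

Lemma hol_at_near2 f g p : hol_at f p -> hol_at g p ->
  exists f' g' r B, 0 < r /\ 0 <= B /\ hol_near f f' p r B /\ hol_near g g' p r B.
Proof.
  intros Hf Hg.
  destruct (hol_at_near f p Hf) as [f' [r1 [B1 [P1 [Q1 N1]]]]].
  destruct (hol_at_near g p Hg) as [g' [r2 [B2 [P2 [Q2 N2]]]]].
  exists f', g', (Rmin r1 r2), (Rmax B1 B2).
  split; [now apply Rmin_glb_lt|].
  split; [eapply Rle_trans; [exact Q1|apply Rmax_l]|].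
  split.
  - eapply hol_near_shrink; [apply Rmin_l|apply Rmax_l|exact N1].
  - eapply hol_near_shrink; [apply Rmin_r|apply Rmax_r|exact N2].
Qed.

(** Links the quantitative notion to the complex derivative, and thereby to [C_derive], in which the
    area density is stated. *)
Lemma hol_on_is_derive f f' p r M u :
  hol_on f f' p r M -> Cmod (u - p) < r ->
  is_derive (K := C_AbsRing) (V := C_NormedModule) f u (f' u).
Proof.
  intros H Hu. split; [apply is_linear_scal_l|].
  intros x Hx. replace x with u
    by exact (is_filter_lim_locally_unique (V := AbsRing_NormedModule C_AbsRing) u x Hx).
  clear x Hx. intros eps.
  assert (Hd : 0 < Rmin (r - Cmod (u - p)) (eps / (Rabs M + 1))).
  { apply Rmin_glb_lt; [lra|]. apply Rdiv_lt_0_compat; [apply cond_pos|].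
    generalize (Rabs_pos M); lra. }
  exists (mkposreal _ Hd). intros v Hv.
  change (Cmod (v - u) < Rmin (r - Cmod (u - p)) (eps / (Rabs M + 1))) in Hv.
  assert (V1 : Cmod (v - u) < r - Cmod (u - p))
    by split_min.
  assert (V2 : Cmod (v - u) < eps / (Rabs M + 1))
    by split_min.
  change (Cmod ((f v - f u) - (v - u) * f' u) <= eps * Cmod (v - u)).
  assert (Hvp : Cmod (v - p) < r) by (generalize (Cmod_dist_triangle v u p); lra).
  replace ((f v - f u) - (v - u) * f' u)%C with (f v - f u - f' u * (v - u))%C by ring.
  eapply Rle_trans; [apply H; trivial|].
  replace (M * Cmod (v - u) ^ 2) with (M * Cmod (v - u) * Cmod (v - u)) by ring.
  apply Rmult_le_compat_r; [apply Cmod_ge_0|].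
  generalize (Rabs_pos M) (Rle_abs M) (Cmod_ge_0 (v - u)); intros A1 A2 A3.
  apply Rle_trans with (Rabs M * Cmod (v - u)); [now apply Rmult_le_compat_r|].
  apply Rle_trans with ((Rabs M + 1) * (eps / (Rabs M + 1))); [|right; field; lra].
  apply Rmult_le_compat; lra.
Qed.

Lemma hol_on_C_derive f f' p r M u :
  hol_on f f' p r M -> Cmod (u - p) < r -> C_derive f u = f' u.
Proof.
  intros H Hu. apply is_C_derive_unique. eapply hol_on_is_derive; eauto.
Qed.

Lemma hol_near_C_derive f f' p r B : 0 < r -> hol_near f f' p r B -> C_derive f p = f' p.
Proof.
  intros Hr H. apply hol_on_C_derive with p r B; [|rewrite Cmod_center; trivial].
  intros u v Hu Hv. now apply H.
Qed.

Lemma hol_at_deriv_intro h h' p r M d :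
  0 < r -> hol_on h h' p r M -> h' p = d -> hol_at h p /\ C_derive h p = d.
Proof.
  intros Hr H <-. split; [now exists h', r, M|].
  apply hol_on_C_derive with p r M; trivial. rewrite Cmod_center; trivial.
Qed.

Lemma hol_at_const_deriv (c p : C) : hol_at (fun _ => c) p /\ C_derive (fun _ => c) p = 0%C.
Proof.
  apply (hol_at_deriv_intro _ (fun _ => RtoC 0) p 1 0); [lra| |trivial]. intros u v _ _.
  replace (c - c - 0 * (v - u))%C with (RtoC 0) by ring. rewrite Cmod_0; lra.
Qed.

Lemma hol_at_const (c p : C) : hol_at (fun _ => c) p.
Proof. apply hol_at_const_deriv. Qed.

Lemma hol_at_id_deriv (p : C) : hol_at (fun u => u) p /\ C_derive (fun u => u) p = 1%C.
Proof.
  apply (hol_at_deriv_intro _ (fun _ => RtoC 1) p 1 0); [lra| |trivial]. intros u v _ _.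
  replace (v - u - 1 * (v - u))%C with (RtoC 0) by ring. rewrite Cmod_0; lra.
Qed.

Lemma hol_at_id (p : C) : hol_at (fun u => u) p.
Proof. apply hol_at_id_deriv. Qed.

Lemma hol_at_plus_deriv f g p : hol_at f p -> hol_at g p ->
  hol_at (fun u => (f u + g u)%C) p /\
  C_derive (fun u => (f u + g u)%C) p = (C_derive f p + C_derive g p)%C.
Proof.
  intros Hf Hg. destruct (hol_at_near2 f g p Hf Hg) as [f' [g' [r [B [Hr [HB [F G]]]]]]].
  apply (hol_at_deriv_intro _ (fun u => (f' u + g' u)%C) p r (B + B)); trivial.
  2: { now rewrite (hol_near_C_derive f f' p r B), (hol_near_C_derive g g' p r B). }
  intros u v Hu Hv.
  destruct (F u v Hu Hv) as [_ [_ [_ [_ F5]]]]. destruct (G u v Hu Hv) as [_ [_ [_ [_ G5]]]].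
  replace (f v + g v - (f u + g u) - (f' u + g' u) * (v - u))%C
    with ((f v - f u - f' u * (v - u)) + (g v - g u - g' u * (v - u)))%C by ring.
  eapply Rle_trans; [apply Cmod_triangle|]. lra.
Qed.

Lemma hol_at_plus f g p :
  hol_at f p -> hol_at g p -> hol_at (fun u => (f u + g u)%C) p.
Proof. intros Hf Hg. now apply hol_at_plus_deriv. Qed.

Lemma hol_at_mult_deriv f g p : hol_at f p -> hol_at g p ->
  hol_at (fun u => (f u * g u)%C) p /\
  C_derive (fun u => (f u * g u)%C) p = (C_derive f p * g p + f p * C_derive g p)%C.
Proof.
  intros Hf Hg. destruct (hol_at_near2 f g p Hf Hg) as [f' [g' [r [B [Hr [HB [F G]]]]]]].
  apply (hol_at_deriv_intro _ (fun u => (f' u * g u + f u * g' u)%C) p r (B * B + B * B + B * B));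
    trivial.
  2: { now rewrite (hol_near_C_derive f f' p r B), (hol_near_C_derive g g' p r B). }
  intros u v Hu Hv.
  destruct (F u v Hu Hv) as [F1 [_ [F3 [_ F5]]]].
  destruct (G u v Hu Hv) as [G1 [_ [G3 [_ G5]]]].
  replace (f v * g v - f u * g u - (f' u * g u + f u * g' u) * (v - u))%C
    with (f u * (g v - g u - g' u * (v - u)) + g u * (f v - f u - f' u * (v - u))
          + (f v - f u) * (g v - g u))%C by ring.
  set (d := Cmod (v - u)) in *.
  assert (Hd : 0 <= d) by apply Cmod_ge_0.
  assert (Hd2 : 0 <= d ^ 2) by apply pow2_ge_0.
  eapply Rle_trans; [apply Cmod_triangle|].
  assert (H1 : Cmod (f u * (g v - g u - g' u * (v - u))) <= B * (B * d ^ 2)).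
  { rewrite Cmod_mult. apply Rmult_le_compat; trivial; apply Cmod_ge_0. }
  assert (H2 : Cmod (g u * (f v - f u - f' u * (v - u))) <= B * (B * d ^ 2)).
  { rewrite Cmod_mult. apply Rmult_le_compat; trivial; apply Cmod_ge_0. }
  assert (H3 : Cmod ((f v - f u) * (g v - g u)) <= (B * d) * (B * d)).
  { rewrite Cmod_mult. apply Rmult_le_compat; trivial; apply Cmod_ge_0. }
  eapply Rle_trans; [apply Rplus_le_compat_r, Cmod_triangle|].
  replace ((B * B + B * B + B * B) * d ^ 2)
    with (B * (B * d ^ 2) + B * (B * d ^ 2) + (B * d) * (B * d)) by ring.
  lra.
Qed.

Lemma hol_at_mult f g p :
  hol_at f p -> hol_at g p -> hol_at (fun u => (f u * g u)%C) p.
Proof. intros Hf Hg. now apply hol_at_mult_deriv. Qed.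

Lemma hol_at_comp_deriv f g p : hol_at g p -> hol_at f (g p) ->
  hol_at (fun u => f (g u)) p /\
  C_derive (fun u => f (g u)) p = (C_derive f (g p) * C_derive g p)%C.
Proof.
  intros Hg Hf.
  destruct (hol_at_near g p Hg) as [g' [r1 [B1 [P1 [Q1 N1]]]]].
  destruct (hol_at_near f (g p) Hf) as [f' [r2 [B2 [P2 [Q2 N2]]]]].
  (* On this radius [g], which is [B1]-Lipschitz, stays within [r2] of [g p]; the [+ 1] guards
     against [B1 = 0]. *)
  pose (r := Rmin r1 (r2 / (B1 + 1))).
  assert (Hr2 : 0 < r2 / (B1 + 1)) by (apply Rdiv_lt_0_compat; lra).
  apply (hol_at_deriv_intro _ (fun u => (f' (g u) * g' u)%C) p r (B2 * (B1 * B1) + B2 * B1));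
    [now apply Rmin_glb_lt| |].
  2: { now rewrite (hol_near_C_derive f f' (g p) r2 B2), (hol_near_C_derive g g' p r1 B1). }
  assert (Hp : Cmod (p - p) < r1) by (rewrite Cmod_center; trivial).
  assert (K : forall u, Cmod (u - p) < r -> Cmod (u - p) < r1 /\ Cmod (g u - g p) < r2).
  { intros u Hu. assert (Hu1 : Cmod (u - p) < r1).
    { eapply Rlt_le_trans; [exact Hu|apply Rmin_l]. }
    split; trivial. destruct (N1 p u Hp Hu1) as [_ [_ [H _]]].
    assert (Hu2 : Cmod (u - p) < r2 / (B1 + 1)).
    { eapply Rlt_le_trans; [exact Hu|apply Rmin_r]. }
    assert ((B1 + 1) * Cmod (u - p) < (B1 + 1) * (r2 / (B1 + 1)))
      by (apply Rmult_lt_compat_l; lra).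
    replace ((B1 + 1) * (r2 / (B1 + 1))) with r2 in H0 by (field; lra).
    generalize (Cmod_ge_0 (u - p)); intros; nra. }
  intros u v Hu Hv.
  destruct (K u Hu) as [U1 U2]. destruct (K v Hv) as [V1 V2].
  destruct (N1 u v U1 V1) as [_ [G2 [G3 [_ G5]]]].
  destruct (N2 (g u) (g v) U2 V2) as [_ [F2 [_ [_ F5]]]].
  replace (f (g v) - f (g u) - f' (g u) * g' u * (v - u))%C
    with ((f (g v) - f (g u) - f' (g u) * (g v - g u))
          + f' (g u) * (g v - g u - g' u * (v - u)))%C by ring.
  eapply Rle_trans; [apply Cmod_triangle|]. rewrite Cmod_mult.
  set (d := Cmod (v - u)) in *.
  assert (Hd : 0 <= d) by apply Cmod_ge_0.
  assert (H1 : Cmod (g v - g u) ^ 2 <= (B1 * d) ^ 2).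
  { apply pow_incr. split; [apply Cmod_ge_0|trivial]. }
  assert (H2 : B2 * Cmod (g v - g u) ^ 2 <= B2 * (B1 * d) ^ 2)
    by (apply Rmult_le_compat_l; trivial).
  assert (H3 : Cmod (f' (g u)) * Cmod (g v - g u - g' u * (v - u)) <= B2 * (B1 * d ^ 2)).
  { apply Rmult_le_compat; trivial; apply Cmod_ge_0. }
  replace ((B2 * (B1 * B1) + B2 * B1) * d ^ 2)
    with (B2 * (B1 * d) ^ 2 + B2 * (B1 * d ^ 2)) by ring.
  lra.
Qed.

Lemma hol_at_comp f g p :
  hol_at g p -> hol_at f (g p) -> hol_at (fun u => f (g u)) p.
Proof. intros Hg Hf. now apply hol_at_comp_deriv. Qed.

Lemma Cmod_nonzero_lower (p u : C) : Cmod (u - p) < Cmod p / 2 -> Cmod p / 2 < Cmod u.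
Proof. intros H. generalize (Cmod_minus_le p u). rewrite Cmod_sym. lra. Qed.

Lemma Cneq_0_of_Cmod (u : C) : 0 < Cmod u -> u <> 0%C.
Proof. intros H. now apply Cmod_gt_0. Qed.

Lemma hol_at_inv_deriv (p : C) : p <> 0%C ->
  hol_at (fun u => / u)%C p /\ C_derive (fun u => / u)%C p = (- (/ (p * p)))%C.
Proof.
  intros Hp. assert (Hp0 : 0 < Cmod p) by now apply Cmod_gt_0.
  set (m := Cmod p / 2).
  assert (Hm : 0 < m) by (unfold m; lra).
  apply (hol_at_deriv_intro _ (fun u => - (/ (u * u)))%C p m (/ (m * m * m))); trivial.
  intros u v Hu Hv.
  assert (Mu : m < Cmod u) by now apply Cmod_nonzero_lower.
  assert (Mv : m < Cmod v) by now apply Cmod_nonzero_lower.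
  assert (Nu : u <> 0%C) by (apply Cneq_0_of_Cmod; lra).
  assert (Nv : v <> 0%C) by (apply Cneq_0_of_Cmod; lra).
  replace (/ v - / u - - / (u * u) * (v - u))%C
    with ((v - u) * (v - u) * / (u * u * v))%C by (field; auto).
  assert (Nuuv : (u * u * v)%C <> 0%C) by (repeat apply Cmult_neq_0; trivial).
  rewrite !Cmod_mult, Cmod_inv, !Cmod_mult; trivial.
  rewrite Rmult_comm. simpl. rewrite Rmult_1_r.
  apply Rmult_le_compat_r.
  { apply Rmult_le_pos; apply Cmod_ge_0. }
  apply Rinv_le_contravar; [repeat apply Rmult_lt_0_compat; lra|].
  apply Rmult_le_compat; try nra.
Qed.

Lemma hol_at_inv (p : C) : p <> 0%C -> hol_at (fun u => / u)%C p.
Proof. intros Hp. now apply hol_at_inv_deriv. Qed.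

Lemma hol_at_ext_deriv f g p r :
  0 < r -> (forall u, Cmod (u - p) < r -> f u = g u) -> hol_at f p ->
  hol_at g p /\ C_derive g p = C_derive f p.
Proof.
  intros Hr E [f' [r1 [M [Hr1 H]]]].
  apply (hol_at_deriv_intro _ f' p (Rmin r r1) M); [now apply Rmin_glb_lt| |].
  2: { symmetry. apply hol_on_C_derive with p r1 M; trivial. rewrite Cmod_center; trivial. }
  intros u v Hu Hv.
  assert (Cmod (u - p) < r /\ Cmod (u - p) < r1).
  { split; (eapply Rlt_le_trans; [exact Hu|]); [apply Rmin_l|apply Rmin_r]. }
  assert (Cmod (v - p) < r /\ Cmod (v - p) < r1).
  { split; (eapply Rlt_le_trans; [exact Hv|]); [apply Rmin_l|apply Rmin_r]. }
  rewrite <- !E by tauto. apply H; tauto.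
Qed.

Lemma hol_at_ext f g p r :
  0 < r -> (forall u, Cmod (u - p) < r -> f u = g u) -> hol_at f p -> hol_at g p.
Proof. intros Hr E H. now apply (hol_at_ext_deriv f g p r). Qed.

Lemma hol_at_opp f p : hol_at f p -> hol_at (fun u => - f u)%C p.
Proof.
  intros H. apply hol_at_ext with (fun u => - (1) * f u)%C 1; [lra| |].
  - intros u _; ring.
  - apply hol_at_mult; trivial. apply hol_at_const.
Qed.

Lemma hol_at_minus f g p :
  hol_at f p -> hol_at g p -> hol_at (fun u => (f u - g u)%C) p.
Proof. intros Hf Hg. apply hol_at_plus; trivial. now apply hol_at_opp. Qed.

Lemma hol_at_div f g p :
  hol_at f p -> hol_at g p -> g p <> 0%C -> hol_at (fun u => (f u / g u)%C) p.
Proof.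
  intros Hf Hg Hp. apply hol_at_mult; trivial.
  apply (hol_at_comp (fun u => / u)%C g); trivial. now apply hol_at_inv.
Qed.

Lemma hol_at_shift f p c : hol_at f (p + c)%C -> hol_at (fun u => f (u + c)%C) p.
Proof.
  intros H. apply (hol_at_comp f (fun u => u + c)%C); trivial.
  apply hol_at_plus; [apply hol_at_id|apply hol_at_const].
Qed.

Lemma hol_at_pow f p n : hol_at f p -> hol_at (fun u => (f u ^ n)%C) p.
Proof.
  intros H; induction n as [|n IH]; simpl; [apply hol_at_const|now apply hol_at_mult].
Qed.

(** The unnamed derivative in [hol_at] must be [C_derive f] on the whole disc, so the estimates may
    be stated for that function. *)
Lemma hol_at_std f p : hol_at f p ->
  exists r B, 0 < r /\ 0 <= B /\ hol_near f (C_derive f) p r B.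
Proof.
  intros H. destruct (hol_at_near f p H) as [f' [r [B [Hr [HB N]]]]].
  exists r, B; split; [|split]; trivial. intros u v Hu Hv.
  assert (HO : hol_on f f' p r B) by (intros x y Hx Hy; now apply N).
  rewrite (hol_on_C_derive _ _ _ _ _ _ HO Hu), (hol_on_C_derive _ _ _ _ _ _ HO Hv).
  now apply N.
Qed.

(** * Cauchy's estimate and its consequences *)

(** Complex-valued curves of a real parameter form the bridge to real calculus: their real and
    imaginary parts go into real integrals and mean value arguments. *)
Definition curve_deriv (g : R -> C) (t : R) (d : C) : Prop :=
  forall eps, 0 < eps -> exists delta, 0 < delta /\
    forall s, Rabs (s - t) < delta ->
      Cmod (g s - g t - (s - t)%R * d) <= eps * Rabs (s - t).

Lemma Rabs_Im_le (z : C) : Rabs (Im z) <= Cmod z.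
Proof. eapply Rle_trans; [apply Rmax_r|apply Rmax_Cmod]. Qed.

Lemma Cmod_le_Re_Im (z : C) : Cmod z <= Rabs (Re z) + Rabs (Im z).
Proof.
  replace z with (RtoC (Re z) + Ci * RtoC (Im z))%C at 1
    by (apply injective_projections; simpl; unfold Re, Im; ring).
  eapply Rle_trans; [apply Cmod_triangle|].
  rewrite Cmod_mult, Cmod_Ci, !Cmod_R. lra.
Qed.

Lemma is_derive_eps (g : R -> R) t l :
  is_derive g t l <->
  (forall eps, 0 < eps -> exists delta, 0 < delta /\
    forall s, Rabs (s - t) < delta -> Rabs (g s - g t - (s - t) * l) <= eps * Rabs (s - t)).
Proof.
  split.
  - intros [_ H] eps He.
    destruct (H t (fun P HP => HP) (mkposreal eps He)) as [d Hd].
    exists d; split; [apply cond_pos|]. intros s Hs. apply (Hd s Hs).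
  - intros H. split; [apply is_linear_scal_l|].
    intros x Hx. replace x with t
      by exact (is_filter_lim_locally_unique (V := AbsRing_NormedModule R_AbsRing) t x Hx).
    intros eps. destruct (H eps (cond_pos eps)) as [d [Hd Hd']].
    exists (mkposreal d Hd). intros s Hs. apply (Hd' s Hs).
Qed.

Lemma curve_deriv_Re g t d : curve_deriv g t d -> is_derive (fun s => Re (g s)) t (Re d).
Proof.
  intros H. apply is_derive_eps. intros eps He. destruct (H eps He) as [de [Hd K]].
  exists de; split; trivial. intros s Hs. eapply Rle_trans; [|apply K, Hs].
  replace (Re (g s) - Re (g t) - (s - t) * Re d)
    with (Re (g s - g t - (s - t)%R * d)); [apply re_le_Cmod|].
  unfold Re; simpl; ring.
Qed.

Lemma curve_deriv_Im g t d : curve_deriv g t d -> is_derive (fun s => Im (g s)) t (Im d).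
Proof.
  intros H. apply is_derive_eps. intros eps He. destruct (H eps He) as [de [Hd K]].
  exists de; split; trivial. intros s Hs. eapply Rle_trans; [|apply K, Hs].
  replace (Im (g s) - Im (g t) - (s - t) * Im d)
    with (Im (g s - g t - (s - t)%R * d)); [apply Rabs_Im_le|].
  unfold Im; simpl; ring.
Qed.

Lemma curve_deriv_pair (x y : R -> R) t dx dy :
  is_derive x t dx -> is_derive y t dy ->
  curve_deriv (fun s => (x s, y s) : C) t (dx, dy).
Proof.
  intros Hx Hy eps He.
  destruct (proj1 (is_derive_eps x t dx) Hx (eps / 2) ltac:(lra)) as [d1 [P1 K1]].
  destruct (proj1 (is_derive_eps y t dy) Hy (eps / 2) ltac:(lra)) as [d2 [P2 K2]].
  exists (Rmin d1 d2). split; [now apply Rmin_glb_lt|]. intros s Hs.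
  assert (S1 : Rabs (s - t) < d1) by split_min.
  assert (S2 : Rabs (s - t) < d2) by split_min.
  specialize (K1 s S1). specialize (K2 s S2).
  eapply Rle_trans; [apply Cmod_le_Re_Im|].
  replace (Re ((x s, y s) - (x t, y t) - (s - t)%R * (dx, dy)))
    with (x s - x t - (s - t) * dx) by (unfold Re; simpl; ring).
  replace (Im ((x s, y s) - (x t, y t) - (s - t)%R * (dx, dy)))
    with (y s - y t - (s - t) * dy) by (unfold Im; simpl; ring).
  lra.
Qed.

Lemma curve_deriv_lip g t d : curve_deriv g t d ->
  exists delta, 0 < delta /\
    forall s, Rabs (s - t) < delta -> Cmod (g s - g t) <= (Cmod d + 1) * Rabs (s - t).
Proof.
  intros H. destruct (H 1 Rlt_0_1) as [de [Hd K]]. exists de; split; trivial.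
  intros s Hs. specialize (K s Hs).
  replace (g s - g t)%C with ((g s - g t - (s - t)%R * d) + (s - t)%R * d)%C by ring.
  eapply Rle_trans; [apply Cmod_triangle|]. rewrite Cmod_mult, Cmod_R. lra.
Qed.

Lemma curve_deriv_cont g t d : curve_deriv g t d ->
  forall eps, 0 < eps -> exists delta, 0 < delta /\
    forall s, Rabs (s - t) < delta -> Cmod (g s - g t) < eps.
Proof.
  intros H eps He. destruct (curve_deriv_lip g t d H) as [de [Hd K]].
  assert (Hc : 0 < Cmod d + 1) by (generalize (Cmod_ge_0 d); lra).
  exists (Rmin de (eps / (Cmod d + 1))). split.
  { apply Rmin_glb_lt; trivial. now apply Rdiv_lt_0_compat. }
  intros s Hs.
  assert (S1 : Rabs (s - t) < de) by split_min.
  assert (S2 : Rabs (s - t) < eps / (Cmod d + 1))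
    by split_min.
  eapply Rle_lt_trans; [apply K, S1|].
  replace eps with ((Cmod d + 1) * (eps / (Cmod d + 1))) by (field; lra).
  now apply Rmult_lt_compat_l.
Qed.

Lemma curve_deriv_const (c : C) t : curve_deriv (fun _ => c) t 0.
Proof.
  intros eps He. exists 1; split; [lra|]. intros s _.
  replace (c - c - (s - t)%R * 0)%C with (RtoC 0) by ring. rewrite Cmod_0.
  generalize (Rabs_pos (s - t)); nra.
Qed.

Lemma curve_deriv_line (p d : C) t : curve_deriv (fun s => p + s * d)%C t d.
Proof.
  intros eps He. exists 1; split; [lra|]. intros s _.
  replace (p + s * d - (p + t * d) - (s - t)%R * d)%C with (RtoC 0)
    by (rewrite RtoC_minus; ring).
  rewrite Cmod_0. generalize (Rabs_pos (s - t)); nra.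
Qed.

Lemma curve_deriv_comp f g t d :
  curve_deriv g t d -> hol_at f (g t) ->
  curve_deriv (fun s => f (g s)) t (C_derive f (g t) * d)%C.
Proof.
  intros Hg Hf eps He.
  destruct (hol_at_std f (g t) Hf) as [r [B [Hr [HB N]]]].
  destruct (curve_deriv_lip g t d Hg) as [d1 [P1 K1]].
  set (m := Cmod d + 1) in *.
  assert (Hm : 0 < m) by (unfold m; generalize (Cmod_ge_0 d); lra).
  assert (HBm : 0 <= B * m * m) by (repeat apply Rmult_le_pos; lra).
  (* Half of [eps] absorbs the linear error of [g] multiplied by the derivative of [f], the other
     half the quadratic remainder of [f], where [g] moves by at most [m] times the parameter. *)
  assert (E2 : 0 < eps / 2 / (B + 1)) by (apply Rdiv_lt_0_compat; lra).
  destruct (Hg _ E2) as [d2 [P2 K2]].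
  assert (E3 : 0 < eps / 2 / (B * m * m + 1)) by (apply Rdiv_lt_0_compat; lra).
  exists (Rmin (Rmin d1 d2) (Rmin (r / m) (eps / 2 / (B * m * m + 1)))).
  split.
  { repeat apply Rmin_glb_lt; trivial. now apply Rdiv_lt_0_compat. }
  intros s Hs.
  assert (S1 : Rabs (s - t) < d1) by split_min.
  assert (S2 : Rabs (s - t) < d2) by split_min.
  assert (S3 : Rabs (s - t) < r / m) by split_min.
  assert (S4 : Rabs (s - t) < eps / 2 / (B * m * m + 1))
    by split_min.
  specialize (K1 s S1). specialize (K2 s S2).
  set (h := Rabs (s - t)) in *.
  assert (Hh : 0 <= h) by apply Rabs_pos.
  assert (Hgr : Cmod (g s - g t) < r).
  { eapply Rle_lt_trans; [exact K1|].
    replace r with (m * (r / m)) by (field; lra). now apply Rmult_lt_compat_l. }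
  assert (Hgt : Cmod (g t - g t) < r) by (rewrite Cmod_center; trivial).
  destruct (N (g t) (g s) Hgt Hgr) as [_ [N2 [_ [_ N5]]]].
  replace (f (g s) - f (g t) - (s - t)%R * (C_derive f (g t) * d))%C
    with ((f (g s) - f (g t) - C_derive f (g t) * (g s - g t))
      + C_derive f (g t) * (g s - g t - (s - t)%R * d))%C by ring.
  eapply Rle_trans; [apply Cmod_triangle|]. rewrite Cmod_mult.
  assert (A1 : Cmod (g s - g t) ^ 2 <= (m * h) ^ 2).
  { apply pow_incr; split; [apply Cmod_ge_0|trivial]. }
  assert (A2 : B * Cmod (g s - g t) ^ 2 <= B * (m * h) ^ 2)
    by now apply Rmult_le_compat_l.
  assert (A3 : (B * m * m) * h <= eps / 2).
  { apply Rle_trans with ((B * m * m + 1) * (eps / 2 / (B * m * m + 1)));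
      [apply Rmult_le_compat; lra|right; field; lra]. }
  assert (A4 : B * (m * h) ^ 2 <= eps / 2 * h).
  { replace (B * (m * h) ^ 2) with ((B * m * m) * h * h) by ring.
    now apply Rmult_le_compat_r. }
  assert (A5 : Cmod (C_derive f (g t)) * Cmod (g s - g t - (s - t)%R * d)
    <= B * (eps / 2 / (B + 1) * h)).
  { apply Rmult_le_compat; trivial; apply Cmod_ge_0. }
  assert (A6 : B * (eps / 2 / (B + 1) * h) <= eps / 2 * h).
  { rewrite <- Rmult_assoc. apply Rmult_le_compat_r; trivial.
    apply Rle_trans with ((B + 1) * (eps / 2 / (B + 1)));
      [apply Rmult_le_compat_r; lra|right; field; lra]. }
  lra.
Qed.

Lemma hol_at_curve_Re f p d (t : R) :
  hol_at f (p + t * d)%C ->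
  is_derive (fun s : R => Re (f (p + s * d)%C)) t (Re (C_derive f (p + t * d)%C * d)).
Proof.
  intros H. apply (curve_deriv_Re (fun s : R => f (p + s * d)%C)).
  apply (curve_deriv_comp f (fun s : R => p + s * d)%C); trivial. apply curve_deriv_line.
Qed.

Lemma hol_at_curve_Im f p d (t : R) :
  hol_at f (p + t * d)%C ->
  is_derive (fun s : R => Im (f (p + s * d)%C)) t (Im (C_derive f (p + t * d)%C * d)).
Proof.
  intros H. apply (curve_deriv_Im (fun s : R => f (p + s * d)%C)).
  apply (curve_deriv_comp f (fun s : R => p + s * d)%C); trivial. apply curve_deriv_line.
Qed.

Definition cis (t : R) : C := (cos t, sin t).

Lemma cis_conj t : (cis t * Cconj (cis t))%C = 1%C.
Proof.
  apply injective_projections; simpl; [|ring].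
  generalize (sin2_cos2 t). unfold Rsqr. lra.
Qed.

Lemma Cmod_cis t : Cmod (cis t) = 1.
Proof.
  unfold Cmod, cis; simpl. rewrite !Rmult_1_r.
  generalize (sin2_cos2 t). unfold Rsqr. intros H.
  replace (cos t * cos t + sin t * sin t) with 1 by lra. apply sqrt_1.
Qed.

Lemma curve_deriv_cis t : curve_deriv cis t (Ci * cis t)%C.
Proof.
  replace (Ci * cis t)%C with ((- sin t, cos t) : C)
    by (C_ring).
  apply (curve_deriv_pair cos sin); auto_derive; trivial; ring.
Qed.

Lemma curve_deriv_ext f g t d d' :
  (forall s, f s = g s) -> d = d' -> curve_deriv f t d -> curve_deriv g t d'.
Proof.
  intros E <- H eps He. destruct (H eps He) as [de [Hd K]]. exists de; split; trivial.
  intros s Hs. rewrite <- !E. auto.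
Qed.

Lemma curve_deriv_mult f g t df dg :
  curve_deriv f t df -> curve_deriv g t dg ->
  curve_deriv (fun s => f s * g s)%C t (df * g t + f t * dg)%C.
Proof.
  intros Hf Hg.
  assert (F1 := curve_deriv_Re _ _ _ Hf). assert (F2 := curve_deriv_Im _ _ _ Hf).
  assert (G1 := curve_deriv_Re _ _ _ Hg). assert (G2 := curve_deriv_Im _ _ _ Hg).
  assert (M : forall x y dx dy, is_derive x t dx -> is_derive y t dy ->
    is_derive (fun s : R => x s * y s) t (dx * y t + x t * dy)).
  { intros x y dx dy Hx Hy.
    apply (is_derive_mult (K := R_AbsRing) x y t dx dy Hx Hy). intros; apply Rmult_comm. }
  eapply curve_deriv_ext; [| |apply curve_deriv_pair;
    [apply (is_derive_minus (V := R_NormedModule) _ _ _ _ _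
      (M _ _ _ _ F1 G1) (M _ _ _ _ F2 G2))
    |apply (is_derive_plus (V := R_NormedModule) _ _ _ _ _
      (M _ _ _ _ F1 G2) (M _ _ _ _ F2 G1))]].
  - reflexivity.
  - apply injective_projections; unfold Re, Im, minus, plus, opp; simpl; ring.
Qed.

Lemma curve_deriv_conj g t d :
  curve_deriv g t d -> curve_deriv (fun s => Cconj (g s)) t (Cconj d).
Proof.
  intros H eps He. destruct (H eps He) as [de [Hd K]]. exists de; split; trivial.
  intros s Hs. specialize (K s Hs). rewrite <- Cmod_conj in K.
  rewrite !Cminus_conj, Cmult_conj in K.
  replace (Cconj (RtoC (s - t))) with (RtoC (s - t)) in K; trivial.
  C_ring.
Qed.

(** * Cauchy's formula for the derivative, by real integrals over concentric circles *)

Section Cauchy.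
Variables (f : C -> C) (p : C) (R0 : R).
Hypothesis Hf : forall u, Cmod (u - p) < R0 -> hol_at f u.

Let circ (r t : R) : C := (p + r * cis t)%C.
(** For z on the circle, f(z) dz / (z - p)^2 equals i/r times conj(cis t) f(z) dt, so this is the
    integrand of Cauchy's formula for f'(p) up to that factor. The free constant [k] allows every
    real linear functional to be reached through [Re]. *)
Let Phi (k : C) (r t : R) : C := (k * Cconj (cis t) * f (circ r t))%C.

Lemma circ_in r t : Rabs r < R0 -> Cmod (circ r t - p) < R0.
Proof.
  intros H. unfold circ. replace (p + r * cis t - p)%C with (r * cis t)%C by ring.
  rewrite Cmod_mult, Cmod_R, Cmod_cis. lra.
Qed.

Lemma Phi_deriv_r k r t : Rabs r < R0 ->
  curve_deriv (fun x => Phi k x t) r (k * C_derive f (circ r t))%C.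
Proof.
  intros Hr. generalize (circ_in r t Hr); intros Hc. apply Hf in Hc.
  eapply curve_deriv_ext;
    [ | | apply curve_deriv_mult;
        [apply (curve_deriv_const (k * Cconj (cis t))%C)
        |apply (curve_deriv_comp f (fun x => p + x * cis t)%C);
         [apply curve_deriv_line|exact Hc]]].
  - intros s; reflexivity.
  - simpl. change (p + r * cis t)%C with (circ r t).
    replace (k * C_derive f (circ r t))%C
      with (k * C_derive f (circ r t) * (cis t * Cconj (cis t)))%C
      by (rewrite cis_conj; ring).
    ring.
Qed.

Lemma Phi_deriv_t k r t : Rabs r < R0 ->
  curve_deriv (fun x => Phi k r x) t
    (k * (- Ci) * Cconj (cis t) * f (circ r t) + r * (k * Ci * C_derive f (circ r t)))%C.
Proof.
  intros Hr. generalize (circ_in r t Hr); intros Hc. apply Hf in Hc.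
  assert (H1 : curve_deriv (fun x => circ r x) t (r * (Ci * cis t))%C).
  { eapply curve_deriv_ext with (f := fun x => (r * cis x + p)%C);
      [intros; unfold circ; ring|reflexivity|].
    intros eps He.
    assert (H0 := curve_deriv_mult (fun _ => RtoC r) cis t _ _
        (curve_deriv_const r t) (curve_deriv_cis t)).
    destruct (H0 eps He) as [de [Hd K]].
    exists de; split; trivial. intros s Hs. eapply Rle_trans; [|apply K, Hs].
    right; f_equal; ring. }
  eapply curve_deriv_ext;
    [ | | apply curve_deriv_mult;
        [apply curve_deriv_mult;
           [apply (curve_deriv_const k)|apply curve_deriv_conj, curve_deriv_cis]
        |apply (curve_deriv_comp f (fun x => circ r x)); [exact H1|exact Hc]]].
  - intros s; reflexivity.
  - simpl. rewrite Cmult_conj.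
    replace (Cconj Ci) with (- Ci)%C by (C_ring).
    replace (r * (k * Ci * C_derive f (circ r t)))%C
      with (r * (k * Ci * C_derive f (circ r t)) * (cis t * Cconj (cis t)))%C
      by (rewrite cis_conj; ring).
    ring.
Qed.

Lemma circ_close r t eps : 0 < eps ->
  exists delta, 0 < delta /\ forall x y, Rabs (x - r) < delta -> Rabs (y - t) < delta ->
    Cmod (circ x y - circ r t) < eps.
Proof.
  intros He.
  assert (E2 : 0 < eps / 2 / (Rabs r + 1))
    by (apply Rdiv_lt_0_compat; [lra|generalize (Rabs_pos r); lra]).
  destruct (curve_deriv_cont _ _ _ (curve_deriv_cis t) _ E2) as [d [Hd K]].
  exists (Rmin d (eps / 2)). split; [apply Rmin_glb_lt; lra|].
  intros x y Hx Hy.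
  assert (Hx2 : Rabs (x - r) < eps / 2) by split_min.
  assert (Hy2 : Rabs (y - t) < d) by split_min.
  specialize (K y Hy2).
  replace (circ x y - circ r t)%C
    with ((x - r)%R * cis y + r * (cis y - cis t))%C
    by (unfold circ; rewrite RtoC_minus; ring).
  eapply Rle_lt_trans; [apply Cmod_triangle|].
  rewrite !Cmod_mult, !Cmod_R, Cmod_cis, Rmult_1_r.
  assert (Rabs r * Cmod (cis y - cis t) <= eps / 2).
  { generalize (Rabs_pos r); intros Pr.
    apply Rle_trans with ((Rabs r + 1) * (eps / 2 / (Rabs r + 1)));
      [apply Rmult_le_compat; try lra; apply Cmod_ge_0|right; field; lra]. }
  lra.
Qed.

(** Joint continuity in radius and angle is what differentiation under the integral sign requires;
    it follows from the Lipschitz bound on [C_derive f]. *)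
Lemma deriv_circ_cont k r t : Rabs r < R0 ->
  continuity_2d_pt (fun x y => Re (k * C_derive f (circ x y))) r t.
Proof.
  intros Hr eps.
  destruct (hol_at_std f _ (Hf _ (circ_in r t Hr))) as [q [B [Hq [HB N]]]].
  assert (He : 0 < eps / (Cmod k * B + 1)).
  { apply Rdiv_lt_0_compat; [apply cond_pos|].
    assert (0 <= Cmod k * B) by (apply Rmult_le_pos; trivial; apply Cmod_ge_0). lra. }
  destruct (circ_close r t (Rmin q (eps / (Cmod k * B + 1)))) as [d [Hd K]];
    [now apply Rmin_glb_lt|].
  exists (mkposreal d Hd). intros x y Hx Hy. simpl in Hx, Hy.
  specialize (K x y Hx Hy).
  assert (K1 : Cmod (circ x y - circ r t) < q)
    by split_min.
  assert (K2 : Cmod (circ x y - circ r t) < eps / (Cmod k * B + 1))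
    by split_min.
  assert (Kc : Cmod (circ r t - circ r t) < q) by (rewrite Cmod_center; trivial).
  destruct (N _ _ Kc K1) as [_ [_ [_ [N4 _]]]].
  replace (Re (k * C_derive f (circ x y)) - Re (k * C_derive f (circ r t)))
    with (Re (k * (C_derive f (circ x y) - C_derive f (circ r t))))
    by (unfold Re; simpl; ring).
  eapply Rle_lt_trans; [apply re_le_Cmod|]. rewrite Cmod_mult.
  assert (HkB : 0 <= Cmod k * B) by (apply Rmult_le_pos; trivial; apply Cmod_ge_0).
  apply Rle_lt_trans with (Cmod k * B * Cmod (circ x y - circ r t)).
  - rewrite Rmult_assoc. apply Rmult_le_compat_l; [apply Cmod_ge_0|trivial].
  - replace (pos eps) with ((Cmod k * B + 1) * (eps / (Cmod k * B + 1))) by (field; lra).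
    generalize (Cmod_ge_0 (circ x y - circ r t)); intros.
    apply Rle_lt_trans with ((Cmod k * B + 1) * Cmod (circ x y - circ r t)); [lra|].
    apply Rmult_lt_compat_l; lra.
Qed.

Lemma deriv_circ_cont_t k r t : Rabs r < R0 ->
  continuous (fun y => Re (k * C_derive f (circ r y))) t.
Proof.
  intros Hr. apply continuity_pt_filterlim.
  intros eps He.
  destruct (deriv_circ_cont k r t Hr (mkposreal eps He)) as [d Hd].
  exists d; split; [apply cond_pos|]. intros y [_ Hy].
  apply Hd; [rewrite Rminus_diag, Rabs_R0; apply cond_pos|exact Hy].
Qed.

Lemma Phi_cont_t k r t : Rabs r < R0 -> continuous (fun y => Re (Phi k r y)) t.
Proof.
  intros Hr. apply (ex_derive_continuous (V := R_NormedModule)).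
  eexists. apply curve_deriv_Re. now apply Phi_deriv_t.
Qed.

Lemma Phi_ex_RInt k r : Rabs r < R0 -> ex_RInt (fun y => Re (Phi k r y)) 0 (2 * PI).
Proof.
  intros Hr. apply (ex_RInt_continuous (V := R_CompleteNormedModule)).
  intros t _. now apply Phi_cont_t.
Qed.

Let J k r : R := RInt (fun t => Re (Phi k r t)) 0 (2 * PI).
Let J' k r : R := RInt (fun t => Re (k * C_derive f (circ r t))) 0 (2 * PI).

Lemma J_deriv k r : Rabs r < R0 -> is_derive (J k) r (J' k r).
Proof.
  intros Hr. unfold J, J'.
  assert (HD : forall x t, Rabs x < R0 ->
    Derive (fun z => Re (Phi k z t)) x = Re (k * C_derive f (circ x t))).
  { intros x t Hx. apply is_derive_unique. apply (curve_deriv_Re (fun z => Phi k z t)).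
    now apply Phi_deriv_r. }
  assert (HL : 0 < R0 - Rabs r) by lra.
  assert (HI : forall x, Rabs (x - r) < R0 - Rabs r -> Rabs x < R0).
  { intros x Hx. generalize (Rabs_triang (x - r) r).
    replace (x - r + r) with x by ring. lra. }
  rewrite (RInt_ext _ (fun t => Derive (fun u => Re (Phi k u t)) r)).
  2: { intros t _. symmetry. now apply HD. }
  apply (is_derive_RInt_param (fun x t => Re (Phi k x t))).
  - exists (mkposreal _ HL). intros x Hx t _. eexists.
    apply (curve_deriv_Re (fun z => Phi k z t)). apply Phi_deriv_r, HI, Hx.
  - intros t _. apply continuity_2d_pt_ext_loc with (2 := deriv_circ_cont k r t Hr).
    exists (mkposreal _ HL). intros x y Hx _. symmetry. apply HD, HI, Hx.
  - exists (mkposreal _ HL). intros x Hx. apply Phi_ex_RInt, HI, Hx.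
Qed.

(* [r f'(circ) - conj(cis) f(circ)] is a total derivative along the circle. *)
Lemma J_homogeneous k r : Rabs r < R0 -> r * J' k r = J k r.
Proof.
  intros Hr.
  (* The factor [- Ci] cancels the [Ci] produced by differentiating in the angle. *)
  pose (k1 := (- Ci * k)%C).
  assert (HE : forall t, Re (k1 * (- Ci) * Cconj (cis t) * f (circ r t)
      + r * (k1 * Ci * C_derive f (circ r t)))
    = r * Re (k * C_derive f (circ r t)) - Re (Phi k r t)).
  { intros t. unfold k1, Phi.
    replace ((- Ci * k) * (- Ci) * Cconj (cis t) * f (circ r t)
      + r * ((- Ci * k) * Ci * C_derive f (circ r t)))%C
      with (r * (k * C_derive f (circ r t)) - k * Cconj (cis t) * f (circ r t))%C.
    - unfold Re; simpl; ring.
    - assert (HC : (Ci * Ci)%C = (- (1))%C) by (C_ring).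
      replace ((- Ci * k) * (- Ci) * Cconj (cis t) * f (circ r t)
        + r * ((- Ci * k) * Ci * C_derive f (circ r t)))%C
        with ((Ci * Ci) * (k * Cconj (cis t) * f (circ r t)
        - r * (k * C_derive f (circ r t))))%C by ring.
      rewrite HC; ring. }
  assert (HI : is_RInt (fun t => r * Re (k * C_derive f (circ r t)) - Re (Phi k r t))
    0 (2 * PI) (Re (Phi k1 r (2 * PI)) - Re (Phi k1 r 0))).
  { apply (is_RInt_derive (V := R_CompleteNormedModule) (fun t => Re (Phi k1 r t))).
    - intros t _. rewrite <- HE. apply (curve_deriv_Re (fun t => Phi k1 r t)).
      now apply Phi_deriv_t.
    - intros t _. apply (continuous_minus (V := R_NormedModule)).
      + apply (continuous_scal_r (V := R_NormedModule) r). now apply deriv_circ_cont_t.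
      + now apply Phi_cont_t. }
  replace (Re (Phi k1 r (2 * PI)) - Re (Phi k1 r 0)) with 0 in HI.
  2: { unfold Phi, circ, cis. rewrite cos_2PI, sin_2PI, cos_0, sin_0. ring. }
  assert (HJ' : ex_RInt (fun t => Re (k * C_derive f (circ r t))) 0 (2 * PI)).
  { apply (ex_RInt_continuous (V := R_CompleteNormedModule)).
    intros t _. now apply deriv_circ_cont_t. }
  generalize (is_RInt_unique _ _ _ _ HI).
  rewrite (RInt_minus (V := R_CompleteNormedModule)
    (fun t => r * Re (k * C_derive f (circ r t))) (fun t => Re (Phi k r t))).
  - rewrite (RInt_scal (V := R_CompleteNormedModule)); trivial.
    unfold J, J', minus, plus, opp, scal; simpl. unfold mult; simpl. lra.
  - apply (ex_RInt_scal (V := R_NormedModule)); trivial.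
  - now apply Phi_ex_RInt.
Qed.

(** Because [r * J' = J], the quotient [J / r] has derivative zero in [r]. *)
Lemma J_ratio_const k r1 r2 : 0 < r1 < r2 -> r2 < R0 -> J k r1 / r1 = J k r2 / r2.
Proof.
  intros H1 H2.
  apply (eq_is_derive (V := R_NormedModule) (fun r => J k r / r)); [|lra].
  intros r Hr. assert (Hr' : Rabs r < R0) by (rewrite Rabs_right; lra).
  evar_last.
  - apply is_derive_div; [apply J_deriv, Hr'|apply is_derive_id|lra].
  - unfold one, zero; simpl. rewrite <- (J_homogeneous k r Hr'). field. lra.
Qed.

(** As [r] tends to 0, replace [f] by its first-order expansion at [p]: the constant term integrates
    to zero over a full turn, the linear term gives the limit, and the remainder is of order [r ^ 2]
    before division by [r]. *)
Lemma J_small k : 0 < R0 -> exists q B, 0 < q /\ 0 <= B /\ forall r, 0 < r < q ->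
  Rabs (J k r / r - 2 * PI * Re (k * C_derive f p)) <= B * r.
Proof.
  intros HR.
  assert (Hp : Cmod (p - p) < R0) by (rewrite Cmod_center; trivial).
  destruct (hol_at_std f p (Hf p Hp)) as [q [B [Hq [HB N]]]].
  exists (Rmin q R0), (2 * PI * (Cmod k * B)). split; [now apply Rmin_glb_lt|].
  generalize PI_RGT_0; intros HPI. generalize (Cmod_ge_0 k); intros Hk.
  assert (HkB : 0 <= Cmod k * B) by now apply Rmult_le_pos.
  split; [nra|].
  intros r [Hr0 Hr1].
  assert (Hrq : r < q) by split_min.
  assert (HrR : r < R0) by split_min.
  assert (HrA : Rabs r < R0) by (rewrite Rabs_right; lra).
  pose (c := (k * f p)%C). pose (D := Re (k * C_derive f p)).
  assert (H0 : is_RInt (fun t => Re (c * Cconj (cis t)) + r * D) 0 (2 * PI) (2 * PI * r * D)).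
  { evar_last.
    - apply (is_RInt_derive (V := R_CompleteNormedModule)
        (fun t => Re (c * Ci * Cconj (cis t)) + r * D * t)).
      + intros t _. apply (is_derive_plus (V := R_NormedModule)).
        * replace (c * Cconj (cis t))%C with (c * Ci * Cconj (Ci * cis t))%C.
          2: { rewrite Cmult_conj. C_ring. }
          replace (c * Ci * Cconj (Ci * cis t))%C
            with (0 * Cconj (cis t) + c * Ci * Cconj (Ci * cis t))%C by ring.
          apply (curve_deriv_Re (fun t => c * Ci * Cconj (cis t))%C).
          apply (curve_deriv_mult (fun _ => c * Ci)%C (fun t => Cconj (cis t)));
            [apply curve_deriv_const|apply curve_deriv_conj, curve_deriv_cis].
        * auto_derive; trivial. ring.
      + intros t _. apply (ex_derive_continuous (V := R_NormedModule)).
        unfold c, cis, Re; simpl. auto_derive; trivial.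
    - unfold minus, plus, opp; simpl. unfold cis.
      rewrite cos_2PI, sin_2PI, cos_0, sin_0. unfold Re; simpl; ring. }
  assert (H1 : is_RInt (fun t => Re (Phi k r t) - (Re (c * Cconj (cis t)) + r * D))
    0 (2 * PI) (J k r - 2 * PI * r * D)).
  { apply (is_RInt_minus (V := R_NormedModule)); trivial.
    apply (RInt_correct (V := R_CompleteNormedModule)). now apply Phi_ex_RInt. }
  assert (H2 : Rabs (J k r - 2 * PI * r * D) <= 2 * PI * (Cmod k * B * r ^ 2)).
  { rewrite <- (is_RInt_unique _ _ _ _ H1).
    replace (2 * PI * (Cmod k * B * r ^ 2)) with ((2 * PI - 0) * (Cmod k * B * r ^ 2)) by ring.
    apply abs_RInt_le_const; [lra|eexists; exact H1|].
    intros t _. unfold c, D, Phi.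
    replace (Re (k * Cconj (cis t) * f (circ r t))
      - (Re (k * f p * Cconj (cis t)) + r * Re (k * C_derive f p)))
      with (Re (k * Cconj (cis t) * (f (circ r t) - f p - C_derive f p * (circ r t - p)))).
    - eapply Rle_trans; [apply re_le_Cmod|].
      rewrite !Cmod_mult, Cmod_conj, Cmod_cis, Rmult_1_r, Rmult_assoc.
      apply Rmult_le_compat_l; trivial.
      assert (Hcm : Cmod (circ r t - p) = r).
      { unfold circ. replace (p + r * cis t - p)%C with (r * cis t)%C by ring.
        rewrite Cmod_mult, Cmod_R, Cmod_cis, Rabs_right; lra. }
      rewrite <- Hcm. replace (circ (Cmod (circ r t - p)) t) with (circ r t) by now rewrite Hcm.
      apply N; [rewrite Cmod_center; trivial|lra].
    - unfold circ.
      replace (k * Cconj (cis t) * (f (p + r * cis t) - f p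
        - C_derive f p * (p + r * cis t - p)))%C
        with (k * Cconj (cis t) * f (p + r * cis t) - (k * f p * Cconj (cis t)
        + r * (k * C_derive f p) * (cis t * Cconj (cis t))))%C by ring.
      rewrite cis_conj. unfold Re; simpl; ring. }
  fold D. replace (J k r / r - 2 * PI * D) with ((J k r - 2 * PI * r * D) / r) by (field; lra).
  unfold Rdiv. rewrite Rabs_mult, (Rabs_right (/ r)).
  2: { left; now apply Rinv_0_lt_compat. }
  apply Rle_trans with (2 * PI * (Cmod k * B * r ^ 2) * / r).
  - apply Rmult_le_compat_r; trivial. left; now apply Rinv_0_lt_compat.
  - right; field; lra.
Qed.

(** [J / r] does not depend on the radius, so it equals its limit at radius 0. *)
Lemma cauchy_formula k r : 0 < r < R0 -> J k r = 2 * PI * r * Re (k * C_derive f p).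
Proof.
  intros [H1 H2]. destruct (J_small k ltac:(lra)) as [q [B [Hq [HB K]]]].
  assert (E : J k r / r - 2 * PI * Re (k * C_derive f p) = 0).
  { apply RtoC_inj. apply Cmod_lt_eq0. intros eps He. rewrite Cmod_R.
    set (x := Rmin (Rmin (r / 2) (q / 2)) (eps / 2 / (B + 1))).
    assert (He2 : 0 < eps / 2 / (B + 1)) by (apply Rdiv_lt_0_compat; lra).
    assert (X1 : x <= r / 2) by (eapply Rle_trans; [apply Rmin_l|apply Rmin_l]).
    assert (X2 : x <= q / 2) by (eapply Rle_trans; [apply Rmin_l|apply Rmin_r]).
    assert (X3 : x <= eps / 2 / (B + 1)) by apply Rmin_r.
    assert (X0 : 0 < x) by (repeat apply Rmin_glb_lt; lra).
    rewrite <- (J_ratio_const k x r); [|lra|lra].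
    eapply Rle_lt_trans; [apply K; lra|].
    apply Rle_lt_trans with ((B + 1) * (eps / 2 / (B + 1))).
    - apply Rmult_le_compat; lra.
    - replace ((B + 1) * (eps / 2 / (B + 1))) with (eps / 2) by (field; lra). lra. }
  replace (J k r) with (J k r / r * r) by (field; lra).
  replace (J k r / r) with (2 * PI * Re (k * C_derive f p)) by lra. ring.
Qed.

Lemma cauchy_estimate r B : 0 < r < R0 ->
  (forall t, 0 <= t <= 2 * PI -> Cmod (f (p + r * cis t)%C) <= B) -> Cmod (C_derive f p) <= B / r.
Proof.
  intros Hr HB. generalize PI_RGT_0; intros HPI.
  set (d := C_derive f p).
  assert (HrA : Rabs r < R0) by (rewrite Rabs_right; lra).
  (* With [k] the conjugate of the derivative, [Re (k * d)] becomes [Cmod d ^ 2], so one real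
     integral controls the full modulus. *)
  generalize (cauchy_formula (Cconj d) r Hr). fold d. intros HJ.
  replace (Re (Cconj d * d)) with (Cmod d ^ 2) in HJ
    by (rewrite Cmod2_alt; unfold Re, Im; simpl; ring).
  assert (HI : Rabs (J (Cconj d) r) <= 2 * PI * (Cmod d * B)).
  { unfold J.
    replace (2 * PI * (Cmod d * B)) with ((2 * PI - 0) * (Cmod d * B)) by ring.
    apply abs_RInt_le_const; [lra|now apply Phi_ex_RInt|].
    intros t Ht. eapply Rle_trans; [apply re_le_Cmod|]. unfold Phi.
    rewrite !Cmod_mult, !Cmod_conj, Cmod_cis, Rmult_1_r.
    apply Rmult_le_compat_l; [apply Cmod_ge_0|now apply HB]. }
  rewrite HJ in HI. generalize (Cmod_ge_0 d); intros Hd.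
  assert (H1 : 0 <= 2 * PI * r * Cmod d ^ 2) by
    (apply Rmult_le_pos; [apply Rmult_le_pos; lra|apply pow2_ge_0]).
  rewrite Rabs_right in HI by (apply Rle_ge, H1).
  destruct Hd as [Hd|Hd].
  - apply Rmult_le_reg_r with (2 * PI * r * Cmod d);
      [apply Rmult_lt_0_compat; [apply Rmult_lt_0_compat|]; lra|].
    replace (B / r * (2 * PI * r * Cmod d)) with (2 * PI * (Cmod d * B)) by (field; lra).
    replace (Cmod d * (2 * PI * r * Cmod d)) with (2 * PI * r * Cmod d ^ 2) by ring.
    exact HI.
  - rewrite <- Hd. apply Rdiv_le_0_compat; [|lra].
    eapply Rle_trans; [apply Cmod_ge_0|apply (HB 0)]. lra.
Qed.

End Cauchy.

(** The maximum principle on a disc: Cauchy's estimate is applied to [(u - p) * f u], whose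
    derivative at [p] is [f p]. *)
Lemma hol_mean_bound f p R0 r B :
  (forall u, Cmod (u - p) < R0 -> hol_at f u) -> 0 < r < R0 ->
  (forall t, 0 <= t <= 2 * PI -> Cmod (f (p + r * cis t)%C) <= B) -> Cmod (f p) <= B.
Proof.
  intros Hf Hr HB.
  pose (F := fun u => ((u - p) * f u)%C).
  assert (Hp : Cmod (p - p) < R0) by (rewrite Cmod_center; lra).
  assert (HF : forall u, Cmod (u - p) < R0 -> hol_at F u).
  { intros u Hu. apply hol_at_mult; [|auto].
    apply hol_at_minus; [apply hol_at_id|apply hol_at_const]. }
  assert (HD : C_derive F p = f p).
  { destruct (hol_at_plus_deriv (fun u => u) (fun _ => - p)%C p (hol_at_id p)
      (hol_at_const (- p)%C p)) as [H1 H2].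
    unfold F. rewrite (proj2 (hol_at_mult_deriv (fun u => u - p)%C f p H1 (Hf p Hp))).
    replace (C_derive (fun u => u - p)%C p) with (C_derive (fun u => u + - p)%C p)
      by reflexivity.
    rewrite H2, (proj2 (hol_at_id_deriv p)), (proj2 (hol_at_const_deriv (- p)%C p)).
    ring. }
  rewrite <- HD. replace B with (r * B / r) by (field; lra).
  apply (cauchy_estimate F p R0); trivial.
  intros t Ht. unfold F. replace (p + r * cis t - p)%C with (r * cis t)%C by ring.
  rewrite !Cmod_mult, Cmod_cis, Cmod_R, Rabs_right, Rmult_1_r; [|lra].
  apply Rmult_le_compat_l; [lra|now apply HB].
Qed.

(** Liouville's theorem. Cauchy's estimate on discs of growing radius makes the derivative vanish,
    and real and imaginary part are then constant along the segment from [u] to [v]. *)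
Lemma entire_bounded_const f B :
  (forall u, hol_at f u) -> (forall u, Cmod (f u) <= B) -> forall u v, f u = f v.
Proof.
  intros Hf HB u v.
  assert (HB0 : 0 <= B) by (eapply Rle_trans; [apply Cmod_ge_0|apply (HB 0%C)]).
  assert (HD : forall p, C_derive f p = 0%C).
  { intros p. apply Cmod_lt_eq0. intros eps He.
    set (r := B / eps + 1).
    assert (Hr : 0 < r) by (unfold r; generalize (Rdiv_le_0_compat B eps HB0 He); lra).
    eapply Rle_lt_trans.
    - apply (cauchy_estimate f p (r + 1)) with (r := r) (B := B); auto; lra.
    - apply Rmult_lt_reg_r with r; trivial.
      replace (B / r * r) with B by (field; lra).
      replace (eps * r) with (B + eps) by (unfold r; field; lra). lra. }
  assert (E0 : f u = f (u + RtoC 0 * (v - u))%C) by (f_equal; ring).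
  assert (E1 : f v = f (u + RtoC 1 * (v - u))%C) by (f_equal; ring).
  rewrite E0, E1.
  apply injective_projections.
  - apply (eq_is_derive (V := R_NormedModule) (fun s : R => Re (f (u + s * (v - u))%C)));
      [|lra].
    intros t _. evar_last; [apply hol_at_curve_Re; auto|].
    rewrite HD. unfold Re, zero; simpl; ring.
  - apply (eq_is_derive (V := R_NormedModule) (fun s : R => Im (f (u + s * (v - u))%C)));
      [|lra].
    intros t _. evar_last; [apply hol_at_curve_Im; auto|].
    rewrite HD. unfold Im, zero; simpl; ring.
Qed.

Lemma hol_circle_bounded f p (r : R) :
  (forall t, hol_at f (p + r * cis t)%C) ->
  exists B, forall t, 0 <= t <= 2 * PI -> Cmod (f (p + r * cis t)%C) <= B.
Proof.
  intros Hf.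
  pose (g := fun t : R => Rabs (Re (f (p + r * cis t)%C)) + Rabs (Im (f (p + r * cis t)%C))).
  assert (Hg : forall t, continuity_pt g t).
  { intros t.
    assert (HC : curve_deriv (fun s => f (p + r * cis s)%C) t
      (C_derive f (p + r * cis t) * (0 + (0 * cis t + r * (Ci * cis t))))%C).
    { apply (curve_deriv_comp f (fun s => p + r * cis s)%C); trivial.
      assert (H0 := curve_deriv_mult (fun _ => RtoC r) cis t _ _
        (curve_deriv_const r t) (curve_deriv_cis t)).
      intros eps He. destruct (H0 eps He) as [de [Hd K]]. exists de; split; trivial.
      intros s Hs. eapply Rle_trans; [|apply K, Hs]. right; f_equal. ring. }
    apply continuity_pt_plus; apply (continuity_pt_comp _ Rabs);
      try apply Rcontinuity_abs; apply continuity_pt_filterlim;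
      apply (ex_derive_continuous (V := R_NormedModule)); eexists.
    - apply (curve_deriv_Re (fun s => f (p + r * cis s)%C)), HC.
    - apply (curve_deriv_Im (fun s => f (p + r * cis s)%C)), HC. }
  generalize PI_RGT_0; intros HPI.
  destruct (continuity_ab_maj g 0 (2 * PI) ltac:(lra)) as [m [Hm _]]; [auto|].
  exists (g m). intros t Ht.
  eapply Rle_trans; [apply Cmod_le_Re_Im|]. apply (Hm t Ht).
Qed.

(* Divide by [(u - p)^N], which is harmless where [f] vanishes, apply the mean value bound
   on a circle around [q] avoiding [p], and let [N] tend to infinity. *)
Lemma hol_identity f p R0 e q :
  (forall u, Cmod (u - p) < R0 -> hol_at f u) -> 0 < e ->
  (forall u, Cmod (u - p) < e -> f u = 0%C) -> 3 * Cmod (q - p) < R0 -> f q = 0%C.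
Proof.
  intros Hf He Hz Hq.
  destruct (Ceq_dec q p) as [->|Hne].
  { apply Hz. rewrite Cmod_center; trivial. }
  set (t := Cmod (q - p)) in *.
  assert (Ht : 0 < t).
  { apply Cmod_gt_0. now apply Cminus_neq0. }
  (* The disc of radius [R1] about [q] lies in the given disc, and [3 * t < R0] leaves room for
     [2 * t < r < R1]. The circle of radius [r] about [q] then keeps distance at least [s > t] from
     [p], and [t / s] is the ratio of the geometric decay. *)
  set (R1 := R0 - t). set (r := (2 * t + R1) / 2). set (s := r - t).
  assert (Hr : 2 * t < r < R1) by (unfold r, R1 in *; lra).
  assert (Hsub : forall u, Cmod (u - q) < R1 -> Cmod (u - p) < R0).
  { intros u Hu. generalize (Cmod_dist_triangle u q p). fold t. unfold R1 in Hu; lra. }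
  assert (Hcirc : forall x, Cmod (q + r * cis x - q) = r).
  { intros x. replace (q + r * cis x - q)%C with (r * cis x)%C by ring.
    rewrite Cmod_mult, Cmod_R, Cmod_cis, Rabs_right; lra. }
  destruct (hol_circle_bounded f q r) as [B HB].
  { intros x. apply Hf, Hsub. rewrite Hcirc; lra. }
  assert (HB0 : 0 <= B).
  { eapply Rle_trans; [apply Cmod_ge_0|apply (HB 0)]. generalize PI_RGT_0; lra. }
  assert (Hs : t < s) by (unfold s; lra).
  assert (HN : forall N, Cmod (f q) <= B * (t / s) ^ N).
  { intros N. pose (g := fun u => (f u * (/ (u - p)) ^ N)%C).
    assert (Hg : forall u, Cmod (u - q) < R1 -> hol_at g u).
    { intros u Hu. destruct (Ceq_dec u p) as [->|Hup].
      - apply (hol_at_ext (fun _ => RtoC 0) g p e He); [|apply hol_at_const].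
        intros v Hv. unfold g. rewrite Hz by trivial. ring.
      - apply hol_at_mult; [now apply Hf, Hsub|]. apply hol_at_pow.
        apply (hol_at_comp (fun u => / u)%C (fun u => u - p)%C).
        + apply hol_at_minus; [apply hol_at_id|apply hol_at_const].
        + now apply hol_at_inv, Cminus_neq0. }
    assert (Hgq : Cmod (g q) <= B * (/ s) ^ N).
    { apply (hol_mean_bound g q R1 r); trivial; [lra|].
      intros x Hx. unfold g. rewrite Cmod_mult, Cmod_pow.
      assert (Hl : s <= Cmod (q + r * cis x - p)).
      { generalize (Cmod_dist_triangle (q + r * cis x) p q). rewrite Hcirc, (Cmod_sym p q).
        fold t. unfold s. lra. }
      rewrite Cmod_inv by (apply Cneq_0_of_Cmod; lra).
      apply Rmult_le_compat; [apply Cmod_ge_0| |now apply HB|].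
      - apply pow_le. left. apply Rinv_0_lt_compat. lra.
      - apply pow_incr. split; [left; apply Rinv_0_lt_compat; lra|].
        apply Rinv_le_contravar; lra. }
    unfold g in Hgq. rewrite Cmod_mult, Cmod_pow, Cmod_inv in Hgq
      by (apply Cneq_0_of_Cmod; exact Ht).
    fold t in Hgq.
    assert (HtN : 0 < t ^ N) by now apply pow_lt.
    apply Rmult_le_reg_r with ((/ t) ^ N).
    { apply pow_lt. now apply Rinv_0_lt_compat. }
    eapply Rle_trans; [exact Hgq|]. right.
    rewrite Rmult_assoc, <- Rpow_mult_distr.
    replace (t / s * / t) with (/ s) by (field; lra). reflexivity. }
  apply Cmod_lt_eq0. intros eps Heps.
  assert (Hts : Rabs (t / s) < 1).
  { rewrite Rabs_right; [|left; apply Rdiv_lt_0_compat; lra].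
    apply Rmult_lt_reg_r with s; [lra|]. replace (t / s * s) with t by (field; lra). lra. }
  destruct (pow_lt_1_zero (t / s) Hts (eps / (B + 1))) as [N HNN].
  { apply Rdiv_lt_0_compat; lra. }
  specialize (HNN N (Nat.le_refl N)).
  eapply Rle_lt_trans; [apply (HN N)|].
  generalize (Rle_abs ((t / s) ^ N)); intros Ha.
  assert (Hpos : 0 <= (t / s) ^ N).
  { apply pow_le. left; apply Rdiv_lt_0_compat; lra. }
  replace eps with ((B + 1) * (eps / (B + 1))) by (field; lra).
  apply Rle_lt_trans with ((B + 1) * (t / s) ^ N).
  - apply Rmult_le_compat_r; lra.
  - apply Rmult_lt_compat_l; lra.
Qed.

(** * Sums over a rectangular lattice *)

(** The order of decay of 1/(u - l)^2 - 1/l^2; the [1 +] keeps the majorant finite at the origin. *)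
Definition weight (z : C) : R := / (1 + Cmod z) ^ 3.

Lemma weight_pos z : 0 < weight z.
Proof.
  apply Rinv_0_lt_compat, pow_lt. generalize (Cmod_ge_0 z); lra.
Qed.

(* [weight z] is at most a constant times [alpha (x/a) * alpha (y/b)], where [z = x + i y]. *)
Definition alpha (t : R) : R := / ((1 + Rabs t) * sqrt (1 + Rabs t)).

Lemma alpha_pos t : 0 < alpha t.
Proof.
  generalize (Rabs_pos t); intros H. apply Rinv_0_lt_compat, Rmult_lt_0_compat; [lra|].
  apply sqrt_lt_R0; lra.
Qed.

(** Zero is listed twice, which is harmless since only upper bounds are drawn from it. *)
Definition zrange (N : nat) : list Z :=
  map Z.of_nat (seq 0 (S N)) ++ map (fun i => - Z.of_nat i)%Z (seq 0 (S N)).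

Lemma zrange_In N n : (Z.abs n <= Z.of_nat N)%Z -> In n (zrange N).
Proof.
  intros H. apply in_app_iff. rewrite !in_map_iff.
  destruct (Z_lt_le_dec n 0); [right|left]; exists (Z.to_nat (Z.abs n));
    (split; [lia|apply in_seq; lia]).
Qed.

Lemma rsum_single {A} (g : A -> R) x : rsum g (x :: nil) = g x.
Proof. unfold rsum; simpl; ring. Qed.

(** The integral test in telescoping form: (j + 2)^(-3/2) lies below the increment of the primitive
    -2 t^(-1/2). *)
Lemma alpha_step (j : nat) :
  alpha (INR (S j)) <= 2 / sqrt (INR j + 1) - 2 / sqrt (INR j + 2).
Proof.
  unfold alpha. rewrite S_INR. generalize (pos_INR j); intros Hj.
  rewrite Rabs_right by lra. replace (1 + (INR j + 1)) with (INR j + 2) by ring.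
  set (p := sqrt (INR j + 1)). set (q := sqrt (INR j + 2)).
  assert (Hp : 0 < p) by (apply sqrt_lt_R0; lra).
  assert (Hpq : p < q) by (apply sqrt_lt_1; lra).
  assert (Ep : p * p = INR j + 1) by (apply sqrt_sqrt; lra).
  assert (Eq : q * q = INR j + 2) by (apply sqrt_sqrt; lra).
  replace (2 / p - 2 / q) with (/ (p * q * (p + q) / 2)).
  - rewrite <- Eq. apply Rinv_le_contravar.
    + repeat apply Rmult_lt_0_compat; lra.
    + assert (p * q <= q * q) by (apply Rmult_le_compat_r; lra).
      assert (0 < p * q) by (apply Rmult_lt_0_compat; lra).
      assert (p * q * (p + q) <= q * q * (2 * q)) by (apply Rmult_le_compat; lra).
      lra.
  - replace (2 / p - 2 / q) with (2 * ((q - p) * (q + p)) / (p * q * (p + q)))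
      by (field; repeat split; lra).
    replace ((q - p) * (q + p)) with 1 by nra. field. repeat split; lra.
Qed.

Lemma alpha_seq_bound M :
  rsum (fun j => alpha (INR j)) (seq 0 (S M)) <= 3 - 2 / sqrt (INR M + 1).
Proof.
  induction M as [|M IH].
  - unfold rsum, alpha; simpl. rewrite Rabs_R0.
    replace (1 + 0) with 1 by ring. replace (0 + 1) with 1 by ring.
    rewrite sqrt_1, Rmult_1_l, Rinv_1. lra.
  - rewrite seq_S, rsum_app, rsum_single. simpl (0 + S M)%nat.
    generalize (alpha_step M).
    replace (INR (S M) + 1) with (INR M + 2) by (rewrite S_INR; ring). lra.
Qed.

Lemma alpha_zrange_bound N : rsum (fun n => alpha (IZR n)) (zrange N) <= 6.
Proof.
  assert (H : forall g : nat -> Z, (forall i, Rabs (IZR (g i)) = Rabs (INR i)) ->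
    rsum (fun n => alpha (IZR n)) (map g (seq 0 (S N))) <= 3).
  { intros g Hg. replace (rsum (fun n => alpha (IZR n)) (map g (seq 0 (S N))))
      with (rsum (fun j => alpha (INR j)) (seq 0 (S N))).
    - generalize (alpha_seq_bound N) (pos_INR N); intros H HN.
      assert (0 < 2 / sqrt (INR N + 1))
        by (apply Rdiv_lt_0_compat; [lra|apply sqrt_lt_R0; lra]).
      lra.
    - unfold rsum. f_equal. rewrite map_map. apply map_ext. intros i.
      unfold alpha. now rewrite Hg. }
  unfold zrange. rewrite rsum_app.
  generalize (H Z.of_nat (fun i => f_equal Rabs (eq_sym (INR_IZR_INZ i)))).
  generalize (H (fun i => - Z.of_nat i)%Z). intros H1 H2.
  assert (forall i, Rabs (IZR (- Z.of_nat i)) = Rabs (INR i)).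
  { intros i. now rewrite opp_IZR, Rabs_Ropp, INR_IZR_INZ. }
  specialize (H1 H0). lra.
Qed.

Section Lattice.
Variables a b : R.
Hypothesis Ha : 0 < a.
Hypothesis Hb : 0 < b.

Definition rect_lattice : C -> Prop := lattice (RtoC a) (Ci * RtoC b)%C.
Notation L := rect_lattice.

Lemma rect_lattice_iff z : L z <-> exists m n : Z, z = (IZR m * a, IZR n * b).
Proof.
  unfold rect_lattice, lattice. split; intros [m [n H]]; exists m, n; rewrite H;
    C_ring.
Qed.

Lemma rect_lattice_mk m n : L (IZR m * a, IZR n * b).
Proof. apply rect_lattice_iff. now exists m, n. Qed.

Lemma rect_lattice_0 : L 0%C.
Proof. apply rect_lattice_iff. exists 0%Z, 0%Z. C_ring. Qed.

Lemma rect_lattice_plus x y : L x -> L y -> L (x + y)%C.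
Proof.
  rewrite !rect_lattice_iff. intros [m [n ->]] [m' [n' ->]]. exists (m + m')%Z, (n + n')%Z.
  rewrite !plus_IZR. C_ring.
Qed.

Lemma rect_lattice_opp x : L x -> L (- x)%C.
Proof.
  rewrite !rect_lattice_iff. intros [m [n ->]]. exists (- m)%Z, (- n)%Z.
  rewrite !opp_IZR. C_ring.
Qed.

Lemma rect_lattice_minus x y : L x -> L y -> L (x - y)%C.
Proof. intros Hx Hy. apply rect_lattice_plus; trivial. now apply rect_lattice_opp. Qed.

Lemma rect_lattice_conj x : L x -> L (Cconj x).
Proof.
  rewrite !rect_lattice_iff. intros [m [n ->]]. exists m, (- n)%Z.
  rewrite opp_IZR. C_ring.
Qed.

Lemma rect_lattice_sep z : L z -> z <> 0%C -> Rmin a b <= Cmod z.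
Proof.
  intros HL Hz. apply rect_lattice_iff in HL. destruct HL as [m [n ->]].
  assert (HZ : forall k : Z, k <> 0%Z -> 1 <= Rabs (IZR k)).
  { intros k Hk. rewrite <- abs_IZR. apply IZR_le. lia. }
  generalize (Rmax_Cmod (IZR m * a, IZR n * b)); simpl. rewrite !Rabs_mult.
  rewrite (Rabs_right a), (Rabs_right b) by lra. intros HM.
  destruct (Z.eq_dec m 0) as [->|Hm].
  - destruct (Z.eq_dec n 0) as [->|Hn].
    + exfalso; apply Hz. C_ring.
    + eapply Rle_trans; [apply Rmin_r|]. eapply Rle_trans; [|exact HM].
      eapply Rle_trans; [|apply Rmax_r]. specialize (HZ n Hn). nra.
  - eapply Rle_trans; [apply Rmin_l|]. eapply Rle_trans; [|exact HM].
    eapply Rle_trans; [|apply Rmax_l]. specialize (HZ m Hm). nra.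
Qed.

Lemma Rmin_ab_pos : 0 < Rmin a b.
Proof. now apply Rmin_glb_lt. Qed.

(** The three factors [1 + Cmod z] are shared out as 3/2 for each coordinate, so the double sum over
    a box splits into a product of two one-dimensional sums, each at most 6; this is the origin of
    36. *)
Lemma rect_lattice_weight : exists B, 0 <= B /\ summable_by L weight B.
Proof.
  pose (mu := Rmin a b). assert (Hmu : 0 < mu) by apply Rmin_ab_pos.
  (* This [c] compares a coordinate rescaled by [a] or [b] with the modulus:
     [1 + Rabs (x / d) <= c * (1 + Cmod z)]. *)
  pose (c := 1 + / mu).
  assert (Hc : 1 < c) by (unfold c; generalize (Rinv_0_lt_compat _ Hmu); lra).
  pose (G := fun z : C => c ^ 3 * (alpha (fst z / a) * alpha (snd z / b))).
  assert (HG0 : forall z, 0 <= G z).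
  { intros z. unfold G. apply Rmult_le_pos; [apply pow_le; lra|].
    apply Rmult_le_pos; left; apply alpha_pos. }
  assert (Hcoord : forall x d (z : C), Rabs x <= Cmod z -> 0 < d -> mu <= d ->
    1 + Rabs (x / d) <= c * (1 + Cmod z)).
  { intros x d z Hx Hd Hmd. unfold Rdiv. rewrite Rabs_mult, (Rabs_right (/ d)).
    2: { left; now apply Rinv_0_lt_compat. }
    assert (Rabs x * / d <= Cmod z * / mu).
    { apply Rmult_le_compat; trivial; [apply Rabs_pos|left; now apply Rinv_0_lt_compat|].
      now apply Rinv_le_contravar. }
    generalize (Cmod_ge_0 z) (Rinv_0_lt_compat _ Hmu); intros. unfold c; nra. }
  assert (HG : forall z, weight z <= G z).
  { intros z. set (p := 1 + Rabs (fst z / a)). set (q := 1 + Rabs (snd z / b)).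
    set (W := 1 + Cmod z).
    assert (HW : 1 <= W) by (unfold W; generalize (Cmod_ge_0 z); lra).
    assert (Hp : 1 <= p) by (unfold p; generalize (Rabs_pos (fst z / a)); lra).
    assert (Hq : 1 <= q) by (unfold q; generalize (Rabs_pos (snd z / b)); lra).
    assert (Hx := Rmax_Cmod z).
    assert (Hp2 : p <= c * W).
    { apply Hcoord; trivial; [|apply Rmin_l]. eapply Rle_trans; [apply Rmax_l|exact Hx]. }
    assert (Hq2 : q <= c * W).
    { apply Hcoord; trivial; [|apply Rmin_r]. eapply Rle_trans; [apply Rmax_r|exact Hx]. }
    unfold weight, G, alpha. fold p q W.
    assert (Hsp : 0 < sqrt p) by (apply sqrt_lt_R0; lra).
    assert (Hsq : 0 < sqrt q) by (apply sqrt_lt_R0; lra).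
    assert (HcW : 0 < c * W) by nra.
    assert (Hs : sqrt p * sqrt q <= c * W).
    { rewrite <- sqrt_mult by lra. rewrite <- (sqrt_square (c * W)) by lra.
      apply sqrt_le_1_alt. apply Rmult_le_compat; lra. }
    assert (Hpq : p * q <= (c * W) * (c * W)) by (apply Rmult_le_compat; lra).
    replace (c ^ 3 * (/ (p * sqrt p) * / (q * sqrt q)))
      with (c ^ 3 * / ((p * q) * (sqrt p * sqrt q))) by (field; repeat split; lra).
    apply Rle_trans with (c ^ 3 * / ((c * W) * (c * W) * (c * W))).
    - right. field. split; lra.
    - apply Rmult_le_compat_l; [apply pow_le; lra|].
      apply Rinv_le_contravar.
      + repeat apply Rmult_lt_0_compat; lra.
      + apply Rmult_le_compat; trivial; left; apply Rmult_lt_0_compat; lra. }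
  exists (c ^ 3 * 36). split; [apply Rmult_le_pos; [apply pow_le|]; lra|].
  intros l ND HL.
  assert (HN : exists N : nat, forall z, In z l -> exists m n,
    (Z.abs m <= Z.of_nat N)%Z /\ (Z.abs n <= Z.of_nat N)%Z /\ z = (IZR m * a, IZR n * b)).
  { clear ND. induction l as [|z l IH].
    - exists 0%nat. easy.
    - destruct IH as [N HN]; [intros; apply HL; now right|].
      destruct (proj1 (rect_lattice_iff z) (HL z (or_introl eq_refl))) as [m [n Hz]].
      exists (N + Z.to_nat (Z.abs m) + Z.to_nat (Z.abs n))%nat.
      intros y [<-|Hy].
      + exists m, n. split; [lia|split; [lia|trivial]].
      + destruct (HN y Hy) as [m' [n' [H1 [H2 H3]]]]. exists m', n'.
        split; [lia|split; [lia|trivial]]. }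
  destruct HN as [N HN].
  pose (box := flat_map (fun m => map (fun n => (IZR m * a, IZR n * b) : C) (zrange N)) (zrange N)).
  apply Rle_trans with (rsum G box).
  { apply Rle_trans with (rsum G l); [now apply rsum_le|].
    apply rsum_incl; [trivial| |intros; apply HG0].
    - intros z Hz. destruct (HN z Hz) as [m [n [H1 [H2 ->]]]].
      apply in_flat_map. exists m. split; [now apply zrange_In|].
      apply in_map_iff. exists n. split; trivial. now apply zrange_In. }
  assert (Hin : forall m k, rsum G (map (fun n => (IZR m * a, IZR n * b) : C) k)
    = c ^ 3 * alpha (IZR m) * rsum (fun n => alpha (IZR n)) k).
  { intros m; induction k as [|n k IH]; unfold rsum in *; simpl; [ring|].
    rewrite IH. unfold G; simpl.
    replace (IZR m * a / a) with (IZR m) by (field; lra).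
    replace (IZR n * b / b) with (IZR n) by (field; lra). ring. }
  set (s := rsum (fun n => alpha (IZR n)) (zrange N)).
  assert (Hout : forall k,
    rsum G (flat_map (fun m => map (fun n => (IZR m * a, IZR n * b) : C) (zrange N)) k)
    = c ^ 3 * s * rsum (fun n => alpha (IZR n)) k).
  { induction k as [|m k IH]; [unfold rsum; simpl; ring|].
    cbn [flat_map]. rewrite rsum_app, IH, Hin. fold s. unfold rsum; simpl. ring. }
  unfold box. rewrite Hout. fold s.
  assert (Hs : s <= 6) by apply alpha_zrange_bound.
  assert (Hs0 : 0 <= s).
  { apply rsum_nonneg. intros; left; apply alpha_pos. }
  rewrite Rmult_assoc. apply Rmult_le_compat_l; [apply pow_le; lra|]. nra.
Qed.

(** One inequality combines the isolation of lattice points near [u0] with linear growth far away. A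
    subset [S] is allowed so that [u0] may be 0 when the origin has been removed from the
    lattice. *)
Lemma rect_lattice_away (S : C -> Prop) (u0 : C) : (forall z, S z -> L z) -> ~ S u0 ->
  exists r c, 0 < r /\ 0 < c /\
    forall u l, Cmod (u - u0) < r -> S l -> c * (1 + Cmod l) <= Cmod (u - l).
Proof.
  intros HS Hu0. generalize Rmin_ab_pos; set (mu := Rmin a b); intros Hmu.
  assert (Hrho : exists rho, 0 < rho /\ forall l, S l -> rho <= Cmod (u0 - l)).
  (* Lattice points are at least [mu] apart, so at most one of them lies within [mu / 2] of [u0]; if
     there is one, its distance serves as [rho]. *)
  { destruct (classic (exists l0, S l0 /\ Cmod (u0 - l0) < mu / 2)) as [[l0 [Hl0 Hd]]|Hn].
    - assert (Hne : 0 < Cmod (u0 - l0)).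
      { apply Cmod_gt_0. apply Cminus_neq0. congruence. }
      exists (Cmod (u0 - l0)). split; trivial. intros l Hl.
      destruct (Ceq_dec l l0) as [->|Hll]; [lra|].
      assert (mu <= Cmod (l - l0)).
      { apply rect_lattice_sep; [apply rect_lattice_minus; auto|].
        now apply Cminus_neq0. }
      generalize (Cmod_dist_triangle l u0 l0). rewrite (Cmod_sym l u0). lra.
    - exists (mu / 2). split; [lra|]. intros l Hl. apply Rnot_lt_le. intros Hlt.
      apply Hn. exists l; auto. }
  destruct Hrho as [rho [Hr Hrho]].
  set (Q := Cmod u0 + rho / 2). assert (HQ : 0 < Q) by (unfold Q; generalize (Cmod_ge_0 u0); lra).
  (* The factor 1/2 handles [Cmod l >= 2 * Q + 1], where [Cmod l - Q] is at least half of
     [1 + Cmod l]; for smaller [l] the distance [rho / 2] is divided by the bound [2 * Q + 2] of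
     [1 + Cmod l]. *)
  exists (rho / 2), (Rmin (1 / 2) (rho / 2 / (2 * Q + 2))).
  split; [lra|]. split; [apply Rmin_glb_lt; [lra|apply Rdiv_lt_0_compat; lra]|].
  intros u l Hu Hl. set (c := Rmin (1 / 2) (rho / 2 / (2 * Q + 2))).
  assert (Hc1 : c <= 1 / 2) by apply Rmin_l.
  assert (Hc2 : c <= rho / 2 / (2 * Q + 2)) by apply Rmin_r.
  assert (Hc0 : 0 < c) by (apply Rmin_glb_lt; [lra|apply Rdiv_lt_0_compat; lra]).
  generalize (Cmod_ge_0 l); intros Hl0.
  assert (Huq : Cmod u < Q).
  { unfold Q. generalize (Cmod_minus_le u u0). lra. }
  destruct (Rle_lt_dec (2 * Q + 1) (Cmod l)) as [Hbig|Hsmall].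
  - generalize (Cmod_minus_le l u). rewrite (Cmod_sym l u). nra.
  - apply Rle_trans with (rho / 2 / (2 * Q + 2) * (2 * Q + 2)).
    + apply Rmult_le_compat; lra.
    + replace (rho / 2 / (2 * Q + 2) * (2 * Q + 2)) with (rho / 2) by (field; lra).
      generalize (Hrho l Hl) (Cmod_dist_triangle u0 u l). rewrite (Cmod_sym u0 u). lra.
Qed.

Lemma weighted_sum_exists (S : C -> Prop) (f : C -> C) K : (forall z, S z -> L z) ->
  0 <= K -> (forall l, S l -> Cmod (f l) <= K * weight l) ->
  is_unordered_sum S f (unordered_sum S f).
Proof.
  intros HS HK H. destruct rect_lattice_weight as [B [HB0 HB]].
  destruct (unordered_sum_exists S f (K * B)) as [s Hs].
  { apply summable_by_le with L weight; trivial. }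
  now rewrite (unordered_sum_eq S f s Hs).
Qed.

(** Termwise differentiation without interchanging limits: the remainder of the sum is the sum of
    the remainders, and the common majorant [weight] bounds it by [K * B] times the squared
    increment. *)
Lemma hol_at_unordered_sum (S : C -> Prop) (t t' : C -> C -> C) p r K :
  (forall z, S z -> L z) -> 0 < r -> 0 <= K ->
  (forall l u v, S l -> Cmod (u - p) < r -> Cmod (v - p) < r ->
    Cmod (t l u) <= K * weight l /\ Cmod (t' l u) <= K * weight l /\
    Cmod (t l v - t l u - t' l u * (v - u)) <= K * weight l * Cmod (v - u) ^ 2) ->
  (forall u, Cmod (u - p) < r ->
    is_unordered_sum S (fun l => t l u) (unordered_sum S (fun l => t l u))) /\
  hol_at (fun u => unordered_sum S (fun l => t l u)) p.
Proof.
  intros HS Hr HK H. destruct rect_lattice_weight as [B [HB0 HB]].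
  assert (E1 : forall u, Cmod (u - p) < r ->
    is_unordered_sum S (fun l => t l u) (unordered_sum S (fun l => t l u))).
  { intros u Hu. apply weighted_sum_exists with K; trivial. intros l Hl.
    now apply (H l u u). }
  assert (E2 : forall u, Cmod (u - p) < r ->
    is_unordered_sum S (fun l => t' l u) (unordered_sum S (fun l => t' l u))).
  { intros u Hu. apply weighted_sum_exists with K; trivial. intros l Hl.
    now apply (H l u u). }
  split; trivial.
  exists (fun u => unordered_sum S (fun l => t' l u)), r, (K * B). split; trivial.
  intros u v Hu Hv.
  replace (K * B * Cmod (v - u) ^ 2) with ((K * Cmod (v - u) ^ 2) * B) by ring.
  apply (is_unordered_sum_bound S (fun l => t l v - t l u - (v - u) * t' l u)%C).
  - apply summable_by_le with L weight; trivial.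
    + apply Rmult_le_pos; trivial. apply pow2_ge_0.
    + intros l Hl. destruct (H l u v Hl Hu Hv) as [_ [_ H3]].
      replace (t l v - t l u - (v - u) * t' l u)%C
        with (t l v - t l u - t' l u * (v - u))%C by ring.
      lra.
  - replace (unordered_sum S (fun l => t l v) - unordered_sum S (fun l => t l u)
      - unordered_sum S (fun l => t' l u) * (v - u))%C
      with (unordered_sum S (fun l => t l v) - unordered_sum S (fun l => t l u)
      - (v - u) * unordered_sum S (fun l => t' l u))%C by ring.
    apply is_unordered_sum_minus; [apply is_unordered_sum_minus; auto|].
    apply is_unordered_sum_scal; auto.
Qed.

End Lattice.

(** * Majorants for the terms of the lattice series *)

Lemma inv_square_remainder (p q : C) : p <> 0%C -> q <> 0%C ->
  (1 / (q * q) - 1 / (p * p) + 2 / (p * p * p) * (q - p))%C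
  = ((q - p) * (q - p) * (/ p * / p * / q * / q + 2 * (/ p * / p * / p * / q)))%C.
Proof. intros Hp Hq. field. auto. Qed.

Lemma Cinv_le (p : C) m x : 0 < m -> m <= Cmod p -> / m <= x -> p <> 0%C /\ Cmod (/ p) <= x.
Proof.
  intros Hm Hp Hx. assert (Hn : p <> 0%C) by (apply Cneq_0_of_Cmod; lra).
  split; trivial. rewrite Cmod_inv by trivial. eapply Rle_trans; [|exact Hx].
  now apply Rinv_le_contravar.
Qed.

Lemma Cmod_mult_le (u v : C) x y : Cmod u <= x -> Cmod v <= y -> Cmod (u * v) <= x * y.
Proof.
  intros Hu Hv. rewrite Cmod_mult. apply Rmult_le_compat; trivial; apply Cmod_ge_0.
Qed.

Lemma Cmod_plus_le (u v : C) x y : Cmod u <= x -> Cmod v <= y -> Cmod (u + v) <= x + y.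
Proof. intros Hu Hv. eapply Rle_trans; [apply Cmod_triangle|]. lra. Qed.

Lemma Cmod_2 : Cmod 2 = 2.
Proof. rewrite Cmod_R, Rabs_right; lra. Qed.

Lemma Cmod_square_mult (d z : C) x : Cmod z <= x -> Cmod (d * d * z) <= x * Cmod d ^ 2.
Proof.
  intros H. rewrite !Cmod_mult, Rmult_comm.
  replace (Cmod d ^ 2) with (Cmod d * Cmod d) by ring.
  apply Rmult_le_compat_r; trivial. apply Rmult_le_pos; apply Cmod_ge_0.
Qed.

Lemma pow_inv_weight (c : R) (l : C) n : 0 < c -> (3 <= n)%nat ->
  (/ (c * (1 + Cmod l))) ^ n <= (/ c) ^ n * weight l.
Proof.
  intros Hc Hn. rewrite Rinv_mult, Rpow_mult_distr.
  apply Rmult_le_compat_l; [apply pow_le; left; now apply Rinv_0_lt_compat|].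
  unfold weight. rewrite pow_inv. generalize (Cmod_ge_0 l); intros Hl.
  apply Rinv_le_contravar; [apply pow_lt; lra|]. apply Rle_pow; trivial. lra.
Qed.

(** Taking the factor [u] out of the difference of inverse squares leaves products of three inverse
    distances, hence the cubic decay. In [K], [2 * rho] comes from the term, 2 from its derivative,
    and 3 from the remainder, which is of fourth order. *)
Lemma wp_term_bounds c rho (l u v : C) :
  0 < c -> Cmod u <= rho -> c * (1 + Cmod l) <= Cmod (u - l) ->
  c * (1 + Cmod l) <= Cmod (v - l) -> c * (1 + Cmod l) <= Cmod l ->
  let K := (2 + 2 * rho) * (/ c) ^ 3 + 3 * (/ c) ^ 4 in
  Cmod (1 / ((u - l) * (u - l)) - 1 / (l * l)) <= K * weight l /\
  Cmod (- (2 / ((u - l) * (u - l) * (u - l)))) <= K * weight l /\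
  Cmod ((1 / ((v - l) * (v - l)) - 1 / (l * l)) - (1 / ((u - l) * (u - l)) - 1 / (l * l))
    - - (2 / ((u - l) * (u - l) * (u - l))) * (v - u)) <= K * weight l * Cmod (v - u) ^ 2.
Proof.
  intros Hc Hu H1 H2 H3 K.
  set (x := / (c * (1 + Cmod l))).
  assert (Hm : 0 < c * (1 + Cmod l)).
  { apply Rmult_lt_0_compat; trivial. generalize (Cmod_ge_0 l); lra. }
  assert (Hx : 0 < x) by now apply Rinv_0_lt_compat.
  destruct (Cinv_le (u - l) _ x Hm H1 (Rle_refl _)) as [N1 I1].
  destruct (Cinv_le (v - l) _ x Hm H2 (Rle_refl _)) as [N2 I2].
  destruct (Cinv_le l _ x Hm H3 (Rle_refl _)) as [N3 I3].
  assert (X3 : x ^ 3 <= (/ c) ^ 3 * weight l) by (apply pow_inv_weight; trivial).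
  assert (X4 : x ^ 4 <= (/ c) ^ 4 * weight l) by (apply pow_inv_weight; [trivial|lia]).
  assert (Hrho : 0 <= rho) by (eapply Rle_trans; [apply Cmod_ge_0|exact Hu]).
  assert (Hc3 : 0 <= (/ c) ^ 3) by (apply pow_le; left; now apply Rinv_0_lt_compat).
  assert (Hc4 : 0 <= (/ c) ^ 4) by (apply pow_le; left; now apply Rinv_0_lt_compat).
  generalize (weight_pos l); intros Hw.
  assert (Q3 : 0 <= (/ c) ^ 3 * weight l) by (apply Rmult_le_pos; lra).
  assert (Q4 : 0 <= (/ c) ^ 4 * weight l) by (apply Rmult_le_pos; lra).
  assert (Hru : rho * x ^ 3 <= rho * ((/ c) ^ 3 * weight l)) by now apply Rmult_le_compat_l.
  assert (Hq : 0 <= rho * ((/ c) ^ 3 * weight l)) by now apply Rmult_le_pos.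
  assert (HK : K * weight l = 2 * ((/ c) ^ 3 * weight l) + 2 * (rho * ((/ c) ^ 3 * weight l))
    + 3 * ((/ c) ^ 4 * weight l)) by (unfold K; ring).
  rewrite HK. repeat split.
  - replace (1 / ((u - l) * (u - l)) - 1 / (l * l))%C
      with (u * (/ (u - l) * / (u - l) * / l + - / (u - l) * / l * / l))%C.
    2: { field. auto. }
    apply Rle_trans with (rho * (x * x * x + x * x * x)).
    + repeat (apply Cmod_mult_le || apply Cmod_plus_le); rewrite ?Cmod_opp; trivial.
    + replace (rho * (x * x * x + x * x * x)) with (2 * (rho * x ^ 3)) by ring. lra.
  - rewrite Cmod_opp.
    replace (2 / ((u - l) * (u - l) * (u - l)))%C
      with (2 * (/ (u - l) * / (u - l) * / (u - l)))%C by (field; trivial).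
    apply Rle_trans with (2 * (x * x * x)).
    + repeat apply Cmod_mult_le; trivial. rewrite Cmod_2; lra.
    + replace (2 * (x * x * x)) with (2 * x ^ 3) by ring. lra.
  - replace (1 / ((v - l) * (v - l)) - 1 / (l * l) - (1 / ((u - l) * (u - l)) - 1 / (l * l))
      - - (2 / ((u - l) * (u - l) * (u - l))) * (v - u))%C
      with (1 / ((v - l) * (v - l)) - 1 / ((u - l) * (u - l))
      + 2 / ((u - l) * (u - l) * (u - l)) * ((v - l) - (u - l)))%C by ring.
    rewrite inv_square_remainder by trivial.
    replace ((v - l) - (u - l))%C with (v - u)%C by ring.
    apply Cmod_square_mult.
    apply Rle_trans with (x * x * x * x + 2 * (x * x * x * x)).
    + repeat (apply Cmod_mult_le || apply Cmod_plus_le); trivial. rewrite Cmod_2; lra.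
    + replace (x * x * x * x + 2 * (x * x * x * x)) with (3 * x ^ 4) by ring. lra.
Qed.

(* [(1/(z + u)^2 + 1/(z - u)^2)/2 - 1/z^2 = u^2 * half_term (z^2) (u^2)]. *)
Definition half_term (d w : C) : C := (2 / ((d - w) * (d - w)) + 1 / (d * (d - w)))%C.

Definition half_term' (d w : C) : C :=
  (4 / ((d - w) * (d - w) * (d - w)) + 1 / (d * ((d - w) * (d - w))))%C.

(** Here [d] stands for (h - l)^2, of quadratic size in [l]; two inverse factors therefore already
    decay like the fourth power, faster than [weight]. *)
Lemma half_term_bounds c (l d u v : C) :
  0 < c -> c * (1 + Cmod l) ^ 2 <= Cmod (d - u) -> c * (1 + Cmod l) ^ 2 <= Cmod (d - v) ->
  c * (1 + Cmod l) ^ 2 <= Cmod d ->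
  let K := 3 * (/ c) ^ 2 + 5 * (/ c) ^ 3 + 7 * (/ c) ^ 4 in
  Cmod (half_term d u) <= K * weight l /\
  Cmod (half_term' d u) <= K * weight l /\
  Cmod (half_term d v - half_term d u - half_term' d u * (v - u))
    <= K * weight l * Cmod (v - u) ^ 2.
Proof.
  intros Hc H1 H2 H3 K. generalize (Cmod_ge_0 l); intros Hl.
  set (x := / (c * (1 + Cmod l) ^ 2)).
  assert (Hm : 0 < c * (1 + Cmod l) ^ 2).
  { apply Rmult_lt_0_compat; trivial. apply pow_lt; lra. }
  assert (Hx : 0 < x) by now apply Rinv_0_lt_compat.
  destruct (Cinv_le (d - u) _ x Hm H1 (Rle_refl _)) as [N1 I1].
  destruct (Cinv_le (d - v) _ x Hm H2 (Rle_refl _)) as [N2 I2].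
  destruct (Cinv_le d _ x Hm H3 (Rle_refl _)) as [N3 I3].
  generalize (weight_pos l); intros Hw.
  assert (X : forall n, (2 <= n)%nat -> x ^ n <= (/ c) ^ n * weight l /\ 0 <= (/ c) ^ n * weight l).
  { intros n Hn. assert (Hcn : 0 <= (/ c) ^ n)
      by (apply pow_le; left; now apply Rinv_0_lt_compat).
    split; [|apply Rmult_le_pos; lra].
    unfold x. rewrite Rinv_mult, Rpow_mult_distr.
    apply Rmult_le_compat_l; trivial. unfold weight. rewrite pow_inv, <- pow_mult.
    apply Rinv_le_contravar; [apply pow_lt; lra|]. apply Rle_pow; [lra|lia]. }
  destruct (X 2%nat ltac:(lia)) as [X2 Q2]. destruct (X 3%nat ltac:(lia)) as [X3 Q3].
  destruct (X 4%nat ltac:(lia)) as [X4 Q4].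
  assert (HK : K * weight l = 3 * ((/ c) ^ 2 * weight l) + 5 * ((/ c) ^ 3 * weight l)
    + 7 * ((/ c) ^ 4 * weight l)) by (unfold K; ring).
  assert (C4 : Cmod 4 = 4) by (rewrite Cmod_R, Rabs_right; lra).
  rewrite HK. unfold half_term, half_term'. repeat split.
  - replace (2 / ((d - u) * (d - u)) + 1 / (d * (d - u)))%C
      with (2 * (/ (d - u) * / (d - u)) + / d * / (d - u))%C by (field; auto).
    apply Rle_trans with (2 * (x * x) + x * x).
    + repeat (apply Cmod_mult_le || apply Cmod_plus_le); trivial. rewrite Cmod_2; lra.
    + replace (2 * (x * x) + x * x) with (3 * x ^ 2) by ring. lra.
  - replace (4 / ((d - u) * (d - u) * (d - u)) + 1 / (d * ((d - u) * (d - u))))%C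
      with (4 * (/ (d - u) * / (d - u) * / (d - u)) + / d * (/ (d - u) * / (d - u)))%C
      by (field; auto).
    apply Rle_trans with (4 * (x * x * x) + x * (x * x)).
    + repeat (apply Cmod_mult_le || apply Cmod_plus_le); trivial. rewrite C4; lra.
    + replace (4 * (x * x * x) + x * (x * x)) with (5 * x ^ 3) by ring. lra.
  - replace (2 / ((d - v) * (d - v)) + 1 / (d * (d - v))
      - (2 / ((d - u) * (d - u)) + 1 / (d * (d - u)))
      - (4 / ((d - u) * (d - u) * (d - u)) + 1 / (d * ((d - u) * (d - u)))) * (v - u))%C
      with ((v - u) * (v - u) * (2 * (/ (d - u) * / (d - u) * / (d - v) * / (d - v)
        + 2 * (/ (d - u) * / (d - u) * / (d - u) * / (d - v)))
        + / d * (/ (d - u) * / (d - u) * / (d - v))))%C by (field; auto).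
    apply Cmod_square_mult.
    apply Rle_trans with (2 * (x * x * x * x + 2 * (x * x * x * x)) + x * (x * x * x)).
    + repeat (apply Cmod_mult_le || apply Cmod_plus_le); trivial; rewrite Cmod_2; lra.
    + replace (2 * (x * x * x * x + 2 * (x * x * x * x)) + x * (x * x * x))
        with (7 * x ^ 4) by ring. lra.
Qed.

(** * The Weierstrass function of a rectangular lattice *)

Lemma is_unordered_sum_iff (S S' : C -> Prop) f s :
  (forall z, S z <-> S' z) -> is_unordered_sum S f s -> is_unordered_sum S' f s.
Proof.
  intros E H eps. destruct (H eps) as [L0 [H0 H1]]. exists L0; split.
  - intros z Hz. apply E; auto.
  - intros L ND HL Hi. apply H1; trivial. intros z Hz. apply E; auto.
Qed.

Section Weierstrass.
Variables a b : R.
Hypothesis Ha : 0 < a.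
Hypothesis Hb : 0 < b.

Notation L := (rect_lattice a b).
Let L' (l : C) : Prop := L l /\ l <> RtoC 0.
Definition wpR : C -> C := weierstrass_p (RtoC a) (Ci * RtoC b).
Notation W := wpR.
Definition wp_reg (u : C) : C :=
  unordered_sum (fun l => L l /\ l <> RtoC 0)
    (fun l => (1 / ((u - l) * (u - l)) - 1 / (l * l))%C).
Notation Rg := wp_reg.

Lemma wpR_reg u : W u = (1 / (u * u) + Rg u)%C.
Proof. reflexivity. Qed.

Lemma rect_lattice_zero_not : ~ L' 0.
Proof. intros [_ H]. now apply H. Qed.

Lemma wp_reg_sum u : ~ L' u ->
  is_unordered_sum L' (fun l => (1 / ((u - l) * (u - l)) - 1 / (l * l))%C) (Rg u) /\
  hol_at Rg u.
Proof.
  intros Hu.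
  assert (HS : forall z, L' z -> L z) by (intros z [H _]; exact H).
  destruct (rect_lattice_away a b Ha Hb L' u HS Hu) as [r [c [Hr [Hc H]]]].
  destruct (rect_lattice_away a b Ha Hb L' 0%C HS rect_lattice_zero_not)
    as [r0 [c0 [Hr0 [Hc0 H0]]]].
  set (m := Rmin c c0). assert (Hm : 0 < m) by now apply Rmin_glb_lt.
  set (rho := Cmod u + r).
  assert (Hrho : 0 < rho) by (unfold rho; generalize (Cmod_ge_0 u); lra).
  set (K := (2 + 2 * rho) * (/ m) ^ 3 + 3 * (/ m) ^ 4).
  assert (HK : 0 <= K).
  { assert (0 < / m) by now apply Rinv_0_lt_compat.
    apply Rplus_le_le_0_compat; apply Rmult_le_pos; try lra; apply pow_le; lra. }
  destruct (hol_at_unordered_sum a b Ha Hb L'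
    (fun l u => (1 / ((u - l) * (u - l)) - 1 / (l * l))%C)
    (fun l u => (- (2 / ((u - l) * (u - l) * (u - l))))%C) u r K) as [E1 E2]; trivial.
  - intros l x y Hl Hx Hy.
    assert (Hlw : 0 <= 1 + Cmod l) by (generalize (Cmod_ge_0 l); lra).
    assert (Hmc : forall d, m <= d -> m * (1 + Cmod l) <= d * (1 + Cmod l))
      by (intros; now apply Rmult_le_compat_r).
    apply (wp_term_bounds m rho l x y); trivial.
    + generalize (Cmod_minus_le x u). unfold rho; lra.
    + eapply Rle_trans; [apply (Hmc c), Rmin_l|auto].
    + eapply Rle_trans; [apply (Hmc c), Rmin_l|auto].
    + eapply Rle_trans; [apply (Hmc c0), Rmin_r|].
      replace (Cmod l) with (Cmod (0 - l)) at 2.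
      * apply H0; trivial. rewrite Cmod_center; trivial.
      * rewrite Cmod_sym. f_equal; ring.
  - split; [|exact E2]. apply E1. rewrite Cmod_center; trivial.
Qed.

Lemma not_lattice_not_L' u : ~ L u -> ~ L' u.
Proof. intros H [H1 _]. contradiction. Qed.

Lemma not_lattice_neq0 u : ~ L u -> u <> 0%C.
Proof. intros H ->. apply H, rect_lattice_0. Qed.

Lemma wpR_hol u : ~ L u -> hol_at W u.
Proof.
  intros Hu. apply (hol_at_plus (fun u => 1 / (u * u))%C Rg).
  - apply hol_at_div; [apply hol_at_const|apply hol_at_mult; apply hol_at_id|].
    apply Cmult_neq_0; now apply not_lattice_neq0.
  - now apply wp_reg_sum, not_lattice_not_L'.
Qed.

Lemma not_lattice_near u : ~ L u -> exists r, 0 < r /\ forall v, Cmod (v - u) < r -> ~ L v.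
Proof.
  intros Hu. destruct (rect_lattice_away a b Ha Hb L u (fun _ H => H) Hu)
    as [r [c [Hr [Hc H]]]].
  exists r; split; trivial. intros v Hv HL. specialize (H v v Hv HL).
  rewrite Cmod_center in H. generalize (Cmod_ge_0 v); nra.
Qed.

Lemma not_lattice_near0 : exists r, 0 < r /\ forall v, Cmod v < r -> v <> 0%C -> ~ L v.
Proof.
  exists (Rmin a b). split; [now apply Rmin_glb_lt|]. intros v Hv H0 HL.
  generalize (rect_lattice_sep a b Ha Hb v HL H0). lra.
Qed.

Lemma lattice_split (z : C) : z = 0%C \/ L' z <-> L z.
Proof.
  split.
  - intros [->|[H _]]; trivial. apply rect_lattice_0.
  - intros H. destruct (Ceq_dec z 0) as [->|Hz]; [now left|right; split; trivial].
Qed.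

(** In a difference the corrections 1/l^2 cancel and the polar part supplies the term at [l = 0].
    The index set becomes the full lattice, which translations preserve. *)
Lemma wpR_diff_sum u v : ~ L u -> ~ L v ->
  is_unordered_sum L (fun l => (1 / ((u - l) * (u - l)) - 1 / ((v - l) * (v - l)))%C)
    (W u - W v)%C.
Proof.
  intros Hu Hv.
  destruct (wp_reg_sum u (not_lattice_not_L' u Hu)) as [Su _].
  destruct (wp_reg_sum v (not_lattice_not_L' v Hv)) as [Sv _].
  apply (is_unordered_sum_iff (fun z => z = 0%C \/ L' z)); [apply lattice_split|].
  set (f := fun l => (1 / ((u - l) * (u - l)) - 1 / ((v - l) * (v - l)))%C).
  replace (W u - W v)%C with (f 0%C + (Rg u - Rg v))%C.
  2: { rewrite !wpR_reg. unfold f.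
       replace (u - 0)%C with u by ring. replace (v - 0)%C with v by ring. ring. }
  apply is_unordered_sum_union.
  - intros z -> [_ H]. now apply H.
  - apply is_unordered_sum_singleton.
  - apply (is_unordered_sum_ext L' (fun l =>
      ((1 / ((u - l) * (u - l)) - 1 / (l * l)) - (1 / ((v - l) * (v - l)) - 1 / (l * l)))%C)).
    + intros; unfold f; ring.
    + now apply is_unordered_sum_minus.
Qed.

Lemma not_lattice_opp u : ~ L u -> ~ L (- u)%C.
Proof.
  intros H HL. apply H. replace u with (- - u)%C by ring. now apply rect_lattice_opp.
Qed.

Lemma not_lattice_plus u w : L w -> ~ L u -> ~ L (u + w)%C.
Proof.
  intros Hw H HL. apply H. replace u with (u + w - w)%C by ring.
  now apply rect_lattice_minus.
Qed.

Lemma Cinv_sq_opp (x : C) : (1 / (- x * - x) = 1 / (x * x))%C.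
Proof. f_equal. ring. Qed.

Lemma wpR_even u : ~ L u -> W (- u)%C = W u.
Proof.
  intros Hu. rewrite !wpR_reg, Cinv_sq_opp. f_equal.
  destruct (wp_reg_sum u (not_lattice_not_L' u Hu)) as [Su _].
  destruct (wp_reg_sum (- u)%C (not_lattice_not_L' _ (not_lattice_opp u Hu))) as [Sv _].
  assert (HL' : forall z, L' z -> L' (- z)%C).
  { intros z [H1 H2]. split; [now apply rect_lattice_opp|]. intros E; apply H2.
    replace z with (- - z)%C by ring. rewrite E; ring. }
  eapply unordered_sum_inj; [exact Sv|].
  assert (Hinv : forall z : C, (- - z = z)%C) by (intros; ring).
  eapply is_unordered_sum_ext;
    [|exact (is_unordered_sum_reindex L' L' Copp Copp _ _ HL' HL' Hinv Hinv Su)].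
  intros z _. simpl. replace (u - - z)%C with (- (- u - z))%C by ring.
  rewrite !Cinv_sq_opp. reflexivity.
Qed.

(** Only differences are visibly invariant under translation. Comparing [u] with [- (u + w)] and
    using evenness gives W(u + w) - W(u) = W(u) - W(u + w). *)
Lemma wpR_period w u : L w -> ~ L u -> W (u + w)%C = W u.
Proof.
  intros Hw Hu.
  assert (HD : forall w, L w -> forall x y, ~ L x -> ~ L y ->
    (W (x + w) - W (y + w) = W x - W y)%C).
  { clear w u Hw Hu. intros w Hw x y Hx Hy.
    eapply unordered_sum_inj;
      [apply wpR_diff_sum; now apply not_lattice_plus|].
    assert (I1 : forall z : C, (z - w + w = z)%C) by (intros; ring).
    assert (I2 : forall z : C, (z + w - w = z)%C) by (intros; ring).
    eapply is_unordered_sum_ext;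
      [|exact (is_unordered_sum_reindex L L (fun l => l - w)%C (fun l => l + w)%C _ _
        (fun z Hz => rect_lattice_minus a b z w Hz Hw)
        (fun z Hz => rect_lattice_plus a b z w Hz Hw) I1 I2 (wpR_diff_sum x y Hx Hy))].
    intros z _. simpl. replace (x - (z - w))%C with (x + w - z)%C by ring.
    replace (y - (z - w))%C with (y + w - z)%C by ring. reflexivity. }
  assert (Hnu := not_lattice_opp u Hu).
  assert (Huw := not_lattice_plus u w Hw Hu).
  generalize (HD w Hw u (- (u + w))%C Hu (not_lattice_opp _ Huw)).
  replace (- (u + w) + w)%C with (- u)%C by ring. rewrite !wpR_even by trivial.
  intros E.
  assert (E2 : (2 * (W (u + w) - W u) = 0)%C).
  { replace (2 * (W (u + w) - W u))%C with ((W (u + w) - W u) - (W u - W (u + w)))%C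
      by ring. rewrite E; ring. }
  assert (E3 : (W (u + w) - W u = 0)%C).
  { replace (W (u + w) - W u)%C with (/ 2 * (2 * (W (u + w) - W u)))%C by field.
    rewrite E2; ring. }
  replace (W (u + w)%C) with (W (u + w) - W u + W u)%C by ring. rewrite E3; ring.
Qed.

Lemma wpR_conj u : ~ L u -> W (Cconj u) = Cconj (W u).
Proof.
  intros Hu.
  assert (Hcu : ~ L (Cconj u)).
  { intros H. apply Hu. rewrite <- (Cconj_conj u). now apply rect_lattice_conj. }
  assert (Hq : forall x : C, x <> 0%C -> Cconj (1 / (x * x)) = (1 / (Cconj x * Cconj x))%C).
  { intros x Hx. rewrite Cdiv_conj by now apply Cmult_neq_0. rewrite Cmult_conj.
    f_equal. C_ring. }
  rewrite !wpR_reg, Cplus_conj, Hq by now apply not_lattice_neq0.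
  f_equal.
  destruct (wp_reg_sum u (not_lattice_not_L' u Hu)) as [Su _].
  destruct (wp_reg_sum _ (not_lattice_not_L' _ Hcu)) as [Sv _].
  assert (HL' : forall z, L' z -> L' (Cconj z)).
  { intros z [H1 H2]. split; [now apply rect_lattice_conj|]. intros E; apply H2.
    rewrite <- (Cconj_conj z), E. C_ring. }
  eapply unordered_sum_inj; [exact Sv|].
  apply is_unordered_sum_conj in Su.
  eapply is_unordered_sum_ext;
    [|exact (is_unordered_sum_reindex L' L' Cconj Cconj _ _ HL' HL' Cconj_conj Cconj_conj Su)].
  intros z [Hz Hz0]. simpl. rewrite Cminus_conj.
  assert (Hz1 : Cconj z <> 0%C) by now apply HL'.
  rewrite !Hq, Cminus_conj, Cconj_conj; trivial.
  intros E. apply Hu. replace u with (Cconj z) by (symmetry; now apply Ceq_of_minus).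
  now apply rect_lattice_conj.
Qed.

Lemma wp_reg_bounded_near0 : exists r M, 0 < r /\ 0 <= M /\ forall u, Cmod u < r ->
  Cmod (Rg u) <= M /\ Cmod (C_derive Rg u) <= M.
Proof.
  destruct (hol_at_std _ _ (proj2 (wp_reg_sum 0%C rect_lattice_zero_not)))
    as [r [M [Hr [HM N]]]].
  exists r, M. split; trivial. split; trivial. intros u Hu.
  assert (Hu' : Cmod (u - 0) < r) by (now replace (u - 0)%C with u by ring).
  destruct (N u u Hu' Hu') as [N1 [N2 _]]. now split.
Qed.

Lemma wpR_pole B : exists delta, 0 < delta /\
  forall u, 0 < Cmod u < delta -> ~ L u /\ B < Cmod (W u).
Proof.
  destruct wp_reg_bounded_near0 as [r [M [Hr [HM N]]]].
  destruct not_lattice_near0 as [r1 [Hr1 H1]].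
  set (Q := Rabs B + M + 1).
  assert (HQ : 1 <= Q) by (unfold Q; generalize (Rabs_pos B); lra).
  exists (Rmin (Rmin r r1) (/ Q)). split.
  { repeat apply Rmin_glb_lt; trivial. apply Rinv_0_lt_compat; lra. }
  intros u [Hu0 Hu].
  assert (A1 : Cmod u < r) by split_min.
  assert (A2 : Cmod u < r1) by split_min.
  assert (A3 : Cmod u < / Q) by split_min.
  assert (Hu1 : u <> 0%C) by now apply Cneq_0_of_Cmod.
  split; [now apply H1|].
  destruct (N u A1) as [HRu _].
  rewrite wpR_reg.
  assert (Hinv : Q <= Cmod (1 / (u * u))).
  { replace (1 / (u * u))%C with (/ u * / u)%C by (field; trivial).
    rewrite Cmod_mult, Cmod_inv by trivial.
    assert (Q < / Cmod u).
    { rewrite <- (Rinv_inv Q). apply Rinv_lt_contravar; trivial.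
      apply Rmult_lt_0_compat; trivial. apply Rinv_0_lt_compat; lra. }
    nra. }
  generalize (Cmod_minus_le (1 / (u * u))%C (- Rg u)%C). rewrite Cmod_opp.
  replace (1 / (u * u) - - Rg u)%C with (1 / (u * u) + Rg u)%C by ring.
  generalize (Rle_abs B). unfold Q in Hinv. lra.
Qed.

(** Translation moves every point into the closed period rectangle, which is compact. The gauge
    number [d] at a point serves both as a radius and, through its inverse, as a local bound for
    [f], so a lower bound of the gauge is a global bound. *)
Lemma doubly_periodic_bounded (f : C -> C) :
  (forall u, hol_at f u) -> (forall w u, L w -> f (u + w)%C = f u) ->
  exists B, forall u, Cmod (f u) <= B.
Proof.
  intros Hf Hper.
  assert (Hd : forall x y : R, {d : posreal | forall v : C,
    Rabs (fst v - x) < d -> Rabs (snd v - y) < d -> Cmod (f v) <= / d}).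
  { intros x y. apply constructive_indefinite_description.
    destruct (hol_at_std f (x, y) (Hf _)) as [r [B [Hr [HB N]]]].
    assert (Hp : 0 < Rmin (r / 2) (/ (B + 1))).
    { apply Rmin_glb_lt; [lra|apply Rinv_0_lt_compat; lra]. }
    exists (mkposreal _ Hp). simpl. intros v Hx Hy.
    set (d := Rmin (r / 2) (/ (B + 1))) in *.
    assert (Hv : Cmod (v - (x, y)) < r).
    { eapply Rle_lt_trans; [apply Cmod_le_Re_Im|]. unfold Re, Im; simpl.
      fold (fst v - x) (snd v - y).
      assert (d <= r / 2) by apply Rmin_l. unfold Rminus in *. lra. }
    destruct (N v v Hv Hv) as [Hb' _].
    eapply Rle_trans; [exact Hb'|].
    assert (d <= / (B + 1)) by apply Rmin_r.
    apply Rle_trans with (B + 1); [lra|]. rewrite <- (Rinv_inv (B + 1)).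
    now apply Rinv_le_contravar. }
  destruct (compactness_value_2d 0 a 0 b (fun x y => proj1_sig (Hd x y))) as [d HdK].
  exists (/ d). intros u.
  assert (Hred : forall x p, 0 < p -> exists n : Z, 0 <= x - IZR n * p <= p).
  { intros x p Hp. exists (up (x / p) - 1)%Z. rewrite minus_IZR.
    destruct (archimed (x / p)) as [A1 A2].
    assert (Hx : x = x / p * p) by (field; lra).
    split; rewrite Hx at 1; nra. }
  destruct (Hred (fst u) a Ha) as [m Hm]. destruct (Hred (snd u) b Hb) as [n Hn].
  set (v := (fst u - IZR m * a, snd u - IZR n * b) : C).
  assert (Huv : f u = f v).
  { rewrite <- (Hper (IZR m * a, IZR n * b) v); [|now apply rect_lattice_mk].
    f_equal. C_ring. }
  rewrite Huv. apply NNPP. intros Hcon.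
  apply (HdK (fst v) (snd v) Hm Hn). intros [x [y [_ [_ [H1 [H2 H3]]]]]].
  apply Hcon. destruct (Hd x y) as [e He]. simpl in *.
  eapply Rle_trans; [apply He; trivial|].
  apply Rinv_le_contravar; [apply cond_pos|trivial].
Qed.

(** * Translation by a half period *)

Section HalfPeriod.
Variable h : C.
Hypothesis Hh : ~ L h.
Hypothesis H2h : L (h + h)%C.

Let e : C := W h.
Let Q (w : C) : C := unordered_sum L (fun l => half_term ((h - l) * (h - l)) w).

Lemma half_sum : exists r, 0 < r /\
  (forall w, Cmod w < r ->
    is_unordered_sum L (fun l => half_term ((h - l) * (h - l)) w) (Q w)) /\
  hol_at Q 0%C.
Proof.
  destruct (rect_lattice_away a b Ha Hb L h (fun _ H => H) Hh) as [r0 [c1 [Hr0 [Hc1 H1]]]].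
  (* Half of the lower bound of (h - l)^2 is given away, so that subtracting any [w] with
     [Cmod w < c] keeps the estimate. *)
  set (c := c1 ^ 2 / 2). assert (Hc : 0 < c) by (unfold c; nra).
  exists c. split; trivial.
  set (K := 3 * (/ c) ^ 2 + 5 * (/ c) ^ 3 + 7 * (/ c) ^ 4).
  assert (HK : 0 <= K).
  { assert (0 < / c) by now apply Rinv_0_lt_compat.
    repeat apply Rplus_le_le_0_compat; apply Rmult_le_pos; try lra; apply pow_le; lra. }
  assert (Hl : forall l w, L l -> Cmod w < c ->
    c * (1 + Cmod l) ^ 2 <= Cmod ((h - l) * (h - l)) /\
    c * (1 + Cmod l) ^ 2 <= Cmod ((h - l) * (h - l) - w)).
  { intros l w Hl Hw. specialize (H1 h l). rewrite Cmod_center in H1. specialize (H1 Hr0 Hl).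
    generalize (Cmod_ge_0 l); intros Hl0.
    assert (H2 : 2 * c * (1 + Cmod l) ^ 2 <= Cmod ((h - l) * (h - l))).
    { rewrite Cmod_mult. unfold c.
      replace (2 * (c1 ^ 2 / 2) * (1 + Cmod l) ^ 2)
        with ((c1 * (1 + Cmod l)) * (c1 * (1 + Cmod l))) by field.
      apply Rmult_le_compat; trivial; apply Rmult_le_pos; lra. }
    assert (H3 : c <= c * (1 + Cmod l) ^ 2) by nra.
    generalize (Cmod_minus_le ((h - l) * (h - l))%C w). split; lra. }
  destruct (hol_at_unordered_sum a b Ha Hb L
    (fun l w => half_term ((h - l) * (h - l)) w)
    (fun l w => half_term' ((h - l) * (h - l)) w) 0%C c K) as [E1 E2]; trivial.
  - intros l u v HL Hu Hv.
    replace (u - 0)%C with u in Hu by ring. replace (v - 0)%C with v in Hv by ring.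
    destruct (Hl l u HL Hu) as [P1 P2]. destruct (Hl l v HL Hv) as [_ P3].
    now apply half_term_bounds.
  - split; [|exact E2]. intros w Hw. apply E1. now replace (w - 0)%C with w by ring.
Qed.

(** Since [h + h] is a period, [W] agrees at [u + h] and [h - u]. The average of the two difference
    series pairs (h - l) + u with (h - l) - u, which leaves u^2 times a series in u^2 and exhibits
    the double zero of W(u + h) - e. *)
Lemma wpR_half_expansion : exists r, 0 < r /\
  (forall u, Cmod u < r -> ~ L (u + h)%C /\ (W (u + h) - e = u * u * Q (u * u))%C) /\
  hol_at Q 0%C.
Proof.
  destruct half_sum as [r [Hr [HQ HQ0]]].
  destruct (not_lattice_near h Hh) as [r1 [Hr1 H1]].
  exists (Rmin (Rmin r r1) 1).
  split; [repeat apply Rmin_glb_lt; trivial; lra|]. split; trivial.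
  intros u Hu.
  assert (A1 : Cmod u < r) by split_min.
  assert (A2 : Cmod u < r1) by split_min.
  assert (A3 : Cmod u < 1) by split_min.
  assert (Hp : ~ L (u + h)%C).
  { apply H1. now replace (u + h - h)%C with u by ring. }
  assert (Hm : ~ L (h - u)%C).
  { apply H1. replace (h - u - h)%C with (- u)%C by ring. now rewrite Cmod_opp. }
  split; trivial.
  assert (Hw : Cmod (u * u) < r).
  { rewrite Cmod_mult. generalize (Cmod_ge_0 u); nra. }
  assert (Esym : W (h - u)%C = W (u + h)%C).
  { rewrite <- (wpR_even (h - u)%C Hm).
    replace (u + h)%C with (- (h - u) + (h + h))%C by ring.
    symmetry. apply wpR_period; trivial. now apply not_lattice_opp. }
  assert (S1 := wpR_diff_sum _ _ Hp Hh). assert (S2 := wpR_diff_sum _ _ Hm Hh).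
  rewrite Esym in S2. fold e in S1, S2.
  assert (S3 := is_unordered_sum_scal _ _ _ (/ 2)%C (is_unordered_sum_plus _ _ _ _ _ S1 S2)).
  replace (/ 2 * (W (u + h) - e + (W (u + h) - e)))%C with (W (u + h) - e)%C in S3
    by field.
  eapply unordered_sum_inj; [exact S3|].
  eapply is_unordered_sum_ext; [|apply is_unordered_sum_scal, HQ, Hw].
  intros l Hl. simpl. unfold half_term.
  assert (N0 : (h - l)%C <> 0%C).
  { intros E. apply Hh. replace h with (h - l + l)%C by ring. rewrite E.
    now replace (0 + l)%C with l by ring. }
  assert (N1 : (u + h - l)%C <> 0%C).
  { intros E. apply Hp. replace (u + h)%C with (u + h - l + l)%C by ring. rewrite E.
    now replace (0 + l)%C with l by ring. }
  assert (N2 : (h - u - l)%C <> 0%C).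
  { intros E. apply Hm. replace (h - u)%C with (h - u - l + l)%C by ring. rewrite E.
    now replace (0 + l)%C with l by ring. }
  set (d := (h - l)%C) in *.
  replace (u + h - l)%C with (d + u)%C in * by (unfold d; ring).
  replace (h - u - l)%C with (d - u)%C in * by (unfold d; ring).
  assert (N3 : (d * d - u * u)%C <> 0%C).
  { replace (d * d - u * u)%C with ((d + u) * (d - u))%C by ring. now apply Cmult_neq_0. }
  field. repeat split; trivial.
Qed.

Let sing (u : C) : Prop := L u \/ L (u + h)%C.

(** The product with its singularities filled in. The value [Q 0] is the limit at 0, where the
    double pole of the first factor meets the double zero of the second. *)
Let F (u : C) : C :=
  if excluded_middle_informative (sing u) then Q 0 else ((W u - e) * (W (u + h) - e))%C.

Lemma sing_shift u0 u : sing u0 -> (sing (u + u0)%C <-> sing u).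
Proof.
  unfold sing. intros H0.
  assert (K : forall x y, L y -> (L (x + y)%C <-> L x)).
  { intros x y Hy. split; intros Hx.
    - replace x with (x + y - y)%C by ring. now apply rect_lattice_minus.
    - now apply rect_lattice_plus. }
  destruct H0 as [H0|H0].
  - rewrite (K u u0 H0). replace (u + u0 + h)%C with (u + h + u0)%C by ring.
    rewrite (K (u + h)%C u0 H0). tauto.
  - replace (u + u0 + h)%C with (u + (u0 + h))%C by ring. rewrite (K u _ H0).
    replace (u + u0)%C with (u + h + (u0 + h - (h + h)))%C by ring.
    rewrite (K (u + h)%C); [tauto|]. now apply rect_lattice_minus.
Qed.

(** A lattice translation fixes both factors, and translation by a point congruent to [h] exchanges
    them. Every singular point therefore behaves like 0. *)
Lemma half_product_shift u0 u : sing u0 -> F (u + u0)%C = F u.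
Proof.
  intros H0. unfold F. generalize (sing_shift u0 u H0); intros Hs.
  destruct (excluded_middle_informative (sing (u + u0)%C)) as [H1|H1];
    destruct (excluded_middle_informative (sing u)) as [H2|H2]; try tauto.
  unfold sing in H2. assert (Nu : ~ L u) by tauto. assert (Nuh : ~ L (u + h)%C) by tauto.
  destruct H0 as [H0|H0].
  - rewrite (wpR_period u0 u) by trivial.
    replace (u + u0 + h)%C with (u + h + u0)%C by ring.
    now rewrite (wpR_period u0 (u + h)%C) by trivial.
  - assert (H3 : L (u0 + h - (h + h))%C) by now apply rect_lattice_minus.
    replace (u + u0 + h)%C with (u + (u0 + h))%C by ring.
    rewrite (wpR_period _ u H0) by trivial.
    replace (u + u0)%C with (u + h + (u0 + h - (h + h)))%C by ring.
    rewrite (wpR_period _ (u + h)%C H3) by trivial. ring.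
Qed.

Lemma half_product_near0 : exists r, 0 < r /\ forall u, Cmod u < r ->
  F u = (Q (u * u) * (1 + u * u * (Rg u - e)))%C.
Proof.
  destruct wpR_half_expansion as [r [Hr [HE _]]].
  destruct not_lattice_near0 as [r1 [Hr1 H1]].
  exists (Rmin r r1). split; [now apply Rmin_glb_lt|]. intros u Hu.
  assert (A1 : Cmod u < r) by split_min.
  assert (A2 : Cmod u < r1) by split_min.
  destruct (HE u A1) as [N1 E1].
  unfold F. destruct (excluded_middle_informative (sing u)) as [Hs|Hs].
  - destruct Hs as [Hs|Hs]; [|contradiction].
    destruct (Ceq_dec u 0) as [->|Hu0]; [|exfalso; now apply (H1 u)].
    replace (0 * 0)%C with (RtoC 0) by ring. ring.
  - assert (Hu0 : u <> 0%C).
    { intros ->. apply Hs. left. apply rect_lattice_0. }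
    rewrite E1, wpR_reg. field; trivial.
Qed.

Lemma half_product_hol u : hol_at F u.
Proof.
  destruct (classic (sing u)) as [Hs|Hs].
  - apply (hol_at_ext (fun v => F (v + - u)%C) F u 1); [lra| |].
    + intros v _. rewrite <- (half_product_shift u (v + - u)%C Hs). f_equal; ring.
    + apply hol_at_shift. replace (u + - u)%C with (RtoC 0) by ring.
      destruct half_product_near0 as [r [Hr HF]].
      apply (hol_at_ext (fun u => Q (u * u) * (1 + u * u * (Rg u - e)))%C F 0%C r Hr).
      { intros v Hv. replace (v - 0)%C with v in Hv by ring. symmetry; auto. }
      assert (Hsq : hol_at (fun u => u * u)%C 0%C) by (apply hol_at_mult; apply hol_at_id).
      apply hol_at_mult.
      * apply (hol_at_comp Q (fun u => u * u)%C); trivial.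
        replace (0 * 0)%C with (RtoC 0) by ring.
        now destruct wpR_half_expansion as [_ [_ [_ HQ]]].
      * apply hol_at_plus; [apply hol_at_const|]. apply hol_at_mult; trivial.
        apply hol_at_minus; [|apply hol_at_const].
        apply wp_reg_sum, rect_lattice_zero_not.
  - assert (N1 : ~ L u) by (unfold sing in Hs; tauto).
    assert (N2 : ~ L (u + h)%C) by (unfold sing in Hs; tauto).
    destruct (not_lattice_near _ N1) as [r1 [Hr1 K1]].
    destruct (not_lattice_near _ N2) as [r2 [Hr2 K2]].
    apply (hol_at_ext (fun u => (W u - e) * (W (u + h) - e))%C F u (Rmin r1 r2)).
    + now apply Rmin_glb_lt.
    + intros v Hv. unfold F. destruct (excluded_middle_informative (sing v)) as [[H|H]|H];
        trivial; exfalso.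
      * apply (K1 v); trivial. eapply Rlt_le_trans; [exact Hv|apply Rmin_l].
      * apply (K2 (v + h)%C); trivial. replace (v + h - (u + h))%C with (v - u)%C by ring.
        eapply Rlt_le_trans; [exact Hv|apply Rmin_r].
    + apply hol_at_mult; (apply hol_at_minus; [|apply hol_at_const]).
      * now apply wpR_hol.
      * apply hol_at_shift. now apply wpR_hol.
Qed.

Lemma half_period_product : exists c, forall u, ~ L u -> ~ L (u + h)%C ->
  ((W u - W h) * (W (u + h) - W h) = c)%C.
Proof.
  destruct (doubly_periodic_bounded F half_product_hol) as [B HB].
  { intros w u Hw. apply half_product_shift. now left. }
  exists (F 0%C). intros u Hu Huh.
  rewrite <- (entire_bounded_const F B half_product_hol HB u 0%C).
  unfold F. destruct (excluded_middle_informative (sing u)) as [[H|H]|H]; trivial; contradiction.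
Qed.

(* If the product vanished, [W] would equal [W h] near [h], hence near every [(3/4)^n h] by
   the identity principle, contradicting the pole at [0]. *)
Lemma half_period_product_neq0 c :
  (forall t l, 0 < t <= 1 -> L l -> t * Cmod h <= Cmod (l - t * h)) ->
  (forall u, ~ L u -> ~ L (u + h)%C -> ((W u - W h) * (W (u + h) - W h) = c)%C) ->
  c <> 0%C.
Proof.
  intros Hstar Hc Hc0. rewrite Hc0 in Hc.
  assert (Hh0 : 0 < Cmod h) by (apply Cmod_gt_0; now apply not_lattice_neq0).
  destruct (wpR_pole (Cmod (W h))) as [d [Hd Hpole]].
  destruct (not_lattice_near h Hh) as [r [Hr Hnear]].
  pose (p := fun n : nat => (RtoC ((3 / 4) ^ n) * h)%C).
  assert (Hpn : forall n, Cmod (p n) = (3 / 4) ^ n * Cmod h).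
  { intros n. unfold p. rewrite Cmod_mult, Cmod_R, Rabs_right; trivial.
    apply Rle_ge, pow_le; lra. }
  assert (Hp34 : forall n, 0 < (3 / 4) ^ n <= 1).
  { intros n. split; [apply pow_lt; lra|]. rewrite <- (pow1 n). apply pow_incr; lra. }
  (* [Hstar] says that 0 is a nearest lattice point of each [p n], so the open disc about [p n]
     through 0 contains no pole. *)
  assert (Hball : forall n u, Cmod (u - p n) < Cmod (p n) -> ~ L u).
  { intros n u Hu HL. generalize (Hstar _ u (Hp34 n) HL). rewrite <- Hpn.
    fold (p n). lra. }
  assert (HI : forall n, exists eps, 0 < eps /\
    forall u, Cmod (u - p n) < eps -> (W u - W h = 0)%C).
  { induction n as [|n [eps [He IH]]].
    (* For [u] near [h] the factor at [u - h] is nonzero because of the pole at 0, so the vanishing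
       product forces the factor at [u] to vanish. *)
    - exists (Rmin d r). split; [now apply Rmin_glb_lt|]. intros u Hu.
      replace (p 0%nat) with h in Hu by (unfold p; simpl; ring).
      destruct (Ceq_dec u h) as [->|Huh]; [ring|].
      assert (A1 : Cmod (u - h) < d) by split_min.
      assert (A2 : Cmod (u - h) < r) by split_min.
      assert (A3 : 0 < Cmod (u - h)).
      { apply Cmod_gt_0. now apply Cminus_neq0. }
      destruct (Hpole (u - h)%C (conj A3 A1)) as [N1 B1].
      assert (N2 : ~ L (u - h + h)%C).
      { replace (u - h + h)%C with u by ring. now apply Hnear. }
      generalize (Hc (u - h)%C N1 N2). replace (u - h + h)%C with u by ring. intros E.
      destruct (Ceq_dec (W u - W h)%C 0%C) as [|Hne]; trivial.
      exfalso. apply (Cmult_neq_0 (W (u - h) - W h)%C (W u - W h)%C); trivial.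
      intros E2. replace (W (u - h)%C) with (W h) in B1; [lra|].
      replace (W (u - h)%C) with (W (u - h) - W h + W h)%C by ring. rewrite E2; ring.
    - assert (Hq : Cmod (p (S n) - p n) = Cmod (p n) / 4).
      { rewrite Hpn. replace (p (S n) - p n)%C with (RtoC (- ((3 / 4) ^ n / 4)) * h)%C.
        - rewrite Cmod_mult, Cmod_R, Rabs_Ropp, Rabs_right.
          + field.
          + generalize (Hp34 n); lra.
        - unfold p. C_field. }
      assert (Hpp : 0 < Cmod (p n)).
      { rewrite Hpn. apply Rmult_lt_0_compat; trivial. apply Hp34. }
      (* The ratio 3/4 puts the next centre at distance [Cmod (p n) / 4], and 3 (1/4 + 1/12) = 1 is
         exactly the reach of [hol_identity] within the pole-free disc. *)
      exists (Cmod (p n) / 12). split; [lra|]. intros u Hu.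
      apply (hol_identity (fun u => W u - W h)%C (p n) (Cmod (p n)) eps); trivial.
      + intros v Hv. apply hol_at_minus; [|apply hol_at_const]. apply wpR_hol.
        now apply (Hball n).
      + generalize (Cmod_dist_triangle u (p (S n)) (p n)). lra. }
  destruct (pow_lt_1_zero (3 / 4) ltac:(rewrite Rabs_right; lra) (d / Cmod h))
    as [n Hn]; [now apply Rdiv_lt_0_compat|].
  specialize (Hn n (Nat.le_refl n)). rewrite Rabs_right in Hn by (generalize (Hp34 n); lra).
  assert (Hpd : 0 < Cmod (p n) < d).
  { rewrite Hpn. split; [apply Rmult_lt_0_compat; trivial; apply Hp34|].
    replace d with (d / Cmod h * Cmod h) by (field; lra). now apply Rmult_lt_compat_r. }
  destruct (Hpole (p n) Hpd) as [_ HB]. destruct (HI n) as [eps [He HE]].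
  specialize (HE (p n)). rewrite Cmod_center in HE. specialize (HE He).
  replace (W (p n)) with (W h) in HB; [lra|].
  replace (W (p n)) with (W (p n) - W h + W h)%C by ring. rewrite HE; ring.
Qed.

End HalfPeriod.
End Weierstrass.

(** * Duplication formula and differential equation *)

Lemma Cmult_neq0_inv (x y : C) : (x * y)%C <> 0%C -> x <> 0%C /\ y <> 0%C.
Proof. intros H; split; intros ->; apply H; ring. Qed.

Lemma Cdiv_of_mult (x y c : C) : x <> 0%C -> (x * y = c)%C -> y = (c / x)%C.
Proof. intros Hx <-. field; trivial. Qed.

(* The value of [4 wp(2u)] in terms of [x = wp u]. *)
Definition dup (c1 c2 c3 e1 e2 e3 x : C) : C :=
  (x + (e1 + c1 / (x - e1)) + (e2 + c2 / (x - e2)) + (e3 + c3 / (x - e3)))%C.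

Lemma dup_deriv c1 c2 c3 e1 e2 e3 x : x <> e1 -> x <> e2 -> x <> e3 ->
  hol_at (dup c1 c2 c3 e1 e2 e3) x /\
  C_derive (dup c1 c2 c3 e1 e2 e3) x =
  (1 - c1 / ((x - e1) * (x - e1)) - c2 / ((x - e2) * (x - e2)) - c3 / ((x - e3) * (x - e3)))%C.
Proof.
  intros H1 H2 H3.
  assert (K : forall c e, x <> e -> hol_at (fun x => e + c / (x - e))%C x /\
    C_derive (fun x => e + c / (x - e))%C x = (- (c / ((x - e) * (x - e))))%C).
  { intros c e Hx. assert (Hxe : (x + - e)%C <> 0%C) by exact (Cminus_neq0 _ _ Hx).
    destruct (hol_at_plus_deriv (fun u => u) (fun _ => - e)%C x (hol_at_id x)
      (hol_at_const (- e)%C x)) as [A1 A2].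
    destruct (hol_at_comp_deriv (fun u => / u)%C (fun u => u + - e)%C x A1
      (hol_at_inv _ Hxe)) as [B1 B2].
    destruct (hol_at_mult_deriv (fun _ => c) (fun u => / (u + - e))%C x
      (hol_at_const c x) B1) as [D1 D2].
    destruct (hol_at_plus_deriv (fun _ => e) (fun u => c * / (u + - e))%C x
      (hol_at_const e x) D1) as [E1 E2].
    split; [exact E1|]. etransitivity; [exact E2|].
    rewrite D2, B2, A2, !(proj2 (hol_at_const_deriv _ _)), (proj2 (hol_at_id_deriv x)),
      (proj2 (hol_at_inv_deriv _ Hxe)).
    field; trivial. }
  destruct (K c1 e1 H1) as [P1 Q1]. destruct (K c2 e2 H2) as [P2 Q2].
  destruct (K c3 e3 H3) as [P3 Q3].
  destruct (hol_at_plus_deriv (fun u => u) _ x (hol_at_id x) P1) as [R1 S1].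
  destruct (hol_at_plus_deriv _ _ x R1 P2) as [R2 S2].
  destruct (hol_at_plus_deriv _ _ x R2 P3) as [R3 S3].
  split; [exact R3|]. etransitivity; [exact S3|].
  rewrite S2, S1, Q1, Q2, Q3, (proj2 (hol_at_id_deriv x)). ring.
Qed.

Section Doubling.
Variables a b : R.
Hypothesis Ha : 0 < a.
Hypothesis Hb : 0 < b.

Notation L := (rect_lattice a b).
Notation W := (wpR a b).

Definition half1 : C := (a / 2, 0).
Definition half2 : C := (0, b / 2).
Definition half3 : C := (a / 2, b / 2).
Notation h1 := half1.
Notation h2 := half2.
Notation h3 := half3.
Let e1 := W h1.
Let e2 := W h2.
Let e3 := W h3.

Lemma half_coord m n :
  L (IZR m * (a / 2), IZR n * (b / 2)) <-> (Z.Even m /\ Z.Even n).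
Proof.
  split.
  - intros H. apply rect_lattice_iff in H. destruct H as [M [N E]].
    assert (E1 := f_equal fst E). assert (E2 := f_equal snd E). simpl in E1, E2.
    split.
    + exists M. apply eq_IZR. rewrite mult_IZR. apply Rmult_eq_reg_r with (a / 2); lra.
    + exists N. apply eq_IZR. rewrite mult_IZR. apply Rmult_eq_reg_r with (b / 2); lra.
  - intros [[M ->] [N ->]]. apply rect_lattice_iff. exists M, N.
    rewrite !mult_IZR. C_field.
Qed.

Lemma half_as_coord (u : C) m n :
  u = (IZR m * (a / 2), IZR n * (b / 2)) -> (L u <-> (Z.Even m /\ Z.Even n)).
Proof. intros ->. apply half_coord. Qed.

Ltac not_even := let H := fresh in intros H;
  match type of H with Z.Even _ /\ Z.Even _ =>
    destruct H as [[? ?] [? ?]]; lia end.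

Ltac half_coords m n := rewrite (half_as_coord _ m n); [not_even|C_ring].

Lemma half1_not : ~ L h1.
Proof. half_coords 1%Z 0%Z. Qed.
Lemma half2_not : ~ L h2.
Proof. half_coords 0%Z 1%Z. Qed.
Lemma half3_not : ~ L h3.
Proof. half_coords 1%Z 1%Z. Qed.

Lemma half1_twice : L (h1 + h1)%C.
Proof.
  apply rect_lattice_iff. exists 1%Z, 0%Z. C_field.
Qed.
Lemma half2_twice : L (h2 + h2)%C.
Proof.
  apply rect_lattice_iff. exists 0%Z, 1%Z. C_field.
Qed.
Lemma half3_twice : L (h3 + h3)%C.
Proof.
  apply rect_lattice_iff. exists 1%Z, 1%Z. C_field.
Qed.

Lemma half12 : (h1 + h2)%C = h3.
Proof. C_ring. Qed.

(** The single condition that [u + u] is not a period keeps [u], its half-period translates and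
    [u + u] away from all poles. *)
Lemma not_half_lattice u : ~ L (u + u)%C ->
  ~ L u /\ ~ L (u + h1)%C /\ ~ L (u + h2)%C /\ ~ L (u + h3)%C.
Proof.
  intros H. assert (K : forall h, L (h + h)%C -> ~ L (u + h)%C).
  { intros h Hh Hu. apply H.
    replace (u + u)%C with ((u + h) + (u + h) - (h + h))%C by ring.
    apply rect_lattice_minus; trivial. now apply rect_lattice_plus. }
  split; [|split; [|split]].
  - intros Hu. apply H. now apply rect_lattice_plus.
  - apply K, half1_twice.
  - apply K, half2_twice.
  - apply K, half3_twice.
Qed.

(** The constant is read off at another half period [h']; translation by [h] carries it to the third
    one. *)
Lemma wp_half_product h h' u : ~ L h -> L (h + h)%C -> ~ L h' -> ~ L (h' + h)%C ->
  ~ L u -> ~ L (u + h)%C ->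
  ((W u - W h) * (W (u + h) - W h) = (W h - W h') * (W h - W (h' + h)))%C.
Proof.
  intros Hh H2h Hh' Hhh Hu Huh.
  destruct (half_period_product a b Ha Hb h Hh H2h) as [c Hc].
  rewrite (Hc u Hu Huh), <- (Hc h' Hh' Hhh). ring.
Qed.

Lemma wp_half_product1 u : ~ L u -> ~ L (u + h1)%C ->
  ((W u - e1) * (W (u + h1) - e1) = (e1 - e2) * (e1 - e3))%C.
Proof.
  assert (E : (h2 + h1)%C = h3) by (rewrite <- half12; ring).
  intros Hu Hu1. unfold e3. rewrite <- E. unfold e1, e2. apply wp_half_product; trivial;
    rewrite ?E; auto using half1_not, half2_not, half3_not, half1_twice.
Qed.

Lemma wp_half_product2 u : ~ L u -> ~ L (u + h2)%C ->
  ((W u - e2) * (W (u + h2) - e2) = (e2 - e1) * (e2 - e3))%C.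
Proof.
  intros Hu Hu1. unfold e3. rewrite <- half12. unfold e1, e2. apply wp_half_product; trivial;
    rewrite ?half12; auto using half1_not, half2_not, half3_not, half2_twice.
Qed.

Lemma wp_half_product3 u : ~ L u -> ~ L (u + h3)%C ->
  ((W u - e3) * (W (u + h3) - e3) = (e3 - e1) * (e3 - e2))%C.
Proof.
  assert (E : (h1 + h3)%C = (h2 + (h1 + h1))%C) by (rewrite <- half12; ring).
  assert (E2 : e2 = W (h1 + h3)%C).
  { rewrite E. symmetry. apply wpR_period; auto using half1_twice, half2_not. }
  intros Hu Hu1. rewrite E2. unfold e1, e3. apply wp_half_product; trivial;
    auto using half1_not, half3_not, half3_twice.
  rewrite E. apply not_lattice_plus; auto using half1_twice, half2_not.
Qed.

(** One coordinate of the fact that on the segment from 0 to a half period on an axis no lattice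
    point is nearer than 0. *)
Lemma star_half (x t : R) (m : Z) : 0 < x -> 0 < t <= 1 ->
  t * (x / 2) <= Rabs (IZR m * x - t * (x / 2)).
Proof.
  intros Hx Ht.
  destruct (Z_le_gt_dec m 0) as [Hm|Hm].
  - apply IZR_le in Hm. rewrite Rabs_left1; nra.
  - assert (1 <= IZR m) by (apply IZR_le; lia). rewrite Rabs_right; nra.
Qed.

Lemma wp_e1_neq : ((e1 - e2) * (e1 - e3))%C <> 0%C.
Proof.
  apply (half_period_product_neq0 a b Ha Hb h1 half1_not).
  - intros t l Ht Hl. apply rect_lattice_iff in Hl. destruct Hl as [m [n ->]].
    assert (Hm : Cmod h1 = a / 2).
    { unfold half1. change (a / 2, 0) with (RtoC (a / 2)). rewrite Cmod_R, Rabs_right; lra. }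
    rewrite Hm. eapply Rle_trans; [apply (star_half a t m Ha Ht)|].
    eapply Rle_trans; [|apply re_le_Cmod]. right. f_equal. unfold Re; simpl. ring.
  - intros u Hu Huh. now apply wp_half_product1.
Qed.

Lemma wp_e2_neq : ((e2 - e1) * (e2 - e3))%C <> 0%C.
Proof.
  apply (half_period_product_neq0 a b Ha Hb h2 half2_not).
  - intros t l Ht Hl. apply rect_lattice_iff in Hl. destruct Hl as [m [n ->]].
    assert (Hm : Cmod h2 = b / 2).
    { replace h2 with (Ci * RtoC (b / 2))%C by (C_ring).
      rewrite Cmod_mult, Cmod_Ci, Cmod_R, Rabs_right; lra. }
    rewrite Hm. eapply Rle_trans; [apply (star_half b t n Hb Ht)|].
    eapply Rle_trans; [|apply Rabs_Im_le]. right. f_equal. unfold Im; simpl. ring.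
  - intros u Hu Huh. now apply wp_half_product2.
Qed.

Lemma wp_e_distinct : e1 <> e2 /\ e1 <> e3 /\ e2 <> e3.
Proof.
  destruct (Cmult_neq0_inv _ _ wp_e1_neq) as [H1 H2].
  destruct (Cmult_neq0_inv _ _ wp_e2_neq) as [H3 H4].
  repeat split; now apply Cneq_of_minus.
Qed.

Lemma wp_neq_e u : ~ L (u + u)%C -> W u <> e1 /\ W u <> e2 /\ W u <> e3.
Proof.
  intros Hu. destruct (not_half_lattice u Hu) as [H0 [H1 [H2 H3]]].
  destruct wp_e_distinct as [D1 [D2 D3]].
  repeat split; intros E.
  - apply wp_e1_neq. rewrite <- (wp_half_product1 u H0 H1), E. ring.
  - apply wp_e2_neq. rewrite <- (wp_half_product2 u H0 H2), E. ring.
  - assert (Hc : ((e3 - e1) * (e3 - e2))%C <> 0%C)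
      by (apply Cmult_neq_0; apply Cminus_neq0; congruence).
    apply Hc. rewrite <- (wp_half_product3 u H0 H3), E. ring.
Qed.

Let coset (h m : C) : Prop := L (m / 2 - h)%C.

(** Substitute m = 2(l + h) in the series at [u - h], where [W] has the same value as at [u + h].
    Then u - h - l = (2u - m)/2, which produces the factor 4. *)
Lemma coset_sum h u v : L (h + h)%C -> ~ L (u + u)%C -> ~ L (v + v)%C ->
  is_unordered_sum (coset h)
    (fun m => 4 * (1 / ((u + u - m) * (u + u - m)) - 1 / ((v + v - m) * (v + v - m))))%C
    (W (u + h) - W (v + h))%C.
Proof.
  intros Hh Hu Hv.
  assert (K : forall u, ~ L (u + u)%C -> ~ L (u - h)%C).
  { clear u v Hu Hv. intros u Hu HL. apply Hu.
    replace (u + u)%C with ((u - h) + (u - h) + (h + h))%C by ring.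
    apply rect_lattice_plus; trivial. now apply rect_lattice_plus. }
  assert (P : forall u, ~ L (u + u)%C -> W (u + h)%C = W (u - h)%C).
  { clear u v Hu Hv. intros u Hu. replace (u + h)%C with (u - h + (h + h))%C by ring.
    apply wpR_period; trivial. now apply K. }
  rewrite !P by trivial.
  assert (I1 : forall z : C, (2 * ((z / 2 - h) + h) = z)%C)
    by (intros; field).
  assert (I2 : forall z : C, ((2 * (z + h)) / 2 - h = z)%C)
    by (intros; field).
  assert (HS : forall z, L z -> coset h (2 * (z + h))%C).
  { intros z Hz. unfold coset. now rewrite I2. }
  eapply is_unordered_sum_ext;
    [|exact (is_unordered_sum_reindex (coset h) L (fun m => m / 2 - h)%C
      (fun l => 2 * (l + h))%C _ _ (fun z Hz => Hz) HS I1 I2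
      (wpR_diff_sum a b Ha Hb _ _ (K u Hu) (K v Hv)))].
  intros m Hm. simpl.
  assert (E : forall x, ~ L (x + x)%C ->
    (1 / ((x - h - (m / 2 - h)) * (x - h - (m / 2 - h)))
      = 4 * (1 / ((x + x - m) * (x + x - m))))%C).
  { intros x Hx.
    assert (Hne : (x + x - m)%C <> 0%C).
    { intros E. apply (K x Hx). replace (x - h)%C with (m / 2 - h)%C; trivial.
      replace m with (x + x - (x + x - m))%C by ring. rewrite E.
      field. }
    replace (x - h - (m / 2 - h))%C with ((x + x - m) / 2)%C by field.
    field. trivial. }
  rewrite !E by trivial. ring.
Qed.

Lemma coset_disjoint h h' m : ~ L (h - h')%C -> coset h m -> coset h' m -> False.
Proof.
  unfold coset. intros H H1 H2. apply H.
  replace (h - h')%C with ((m / 2 - h') - (m / 2 - h))%C by ring.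
  now apply rect_lattice_minus.
Qed.

Lemma coset_cover m :
  (coset 0 m \/ coset h1 m) \/ (coset h2 m \/ coset h3 m) <-> L m.
Proof.
  assert (K : forall h, L (h + h)%C -> coset h m -> L m).
  { intros h Hh Hm. unfold coset in Hm.
    replace m with ((m / 2 - h) + (m / 2 - h) + (h + h))%C by field.
    apply rect_lattice_plus; trivial. now apply rect_lattice_plus. }
  split.
  - intros [[H|H]|[H|H]]; revert H; apply K.
    + replace (0 + 0)%C with (RtoC 0) by ring. apply rect_lattice_0.
    + apply half1_twice.
    + apply half2_twice.
    + apply half3_twice.
  - intros H. apply rect_lattice_iff in H. destruct H as [M [N ->]].
    destruct (Z.Even_or_Odd M) as [[p ->]|[p ->]]; destruct (Z.Even_or_Odd N) as [[q ->]|[q ->]].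
    + left; left. apply rect_lattice_iff; exists p, q.
      rewrite !mult_IZR. C_field.
    + right; left. apply rect_lattice_iff; exists p, q.
      rewrite plus_IZR, !mult_IZR. C_field.
    + left; right. apply rect_lattice_iff; exists p, q.
      rewrite plus_IZR, !mult_IZR. C_field.
    + right; right. apply rect_lattice_iff; exists p, q.
      rewrite !plus_IZR, !mult_IZR. C_field.
Qed.

Lemma half_diff_not :
  ~ L (0 - h1)%C /\ ~ L (h2 - h3)%C /\ ~ L (0 - h2)%C /\ ~ L (0 - h3)%C /\
  ~ L (h1 - h2)%C /\ ~ L (h1 - h3)%C.
Proof.
  repeat split; [half_coords (-1)%Z 0%Z|half_coords (-1)%Z 0%Z|half_coords 0%Z (-1)%Z
    |half_coords (-1)%Z (-1)%Z|half_coords 1%Z (-1)%Z|half_coords 0%Z (-1)%Z].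
Qed.

(** The four cosets of 2L in [L] are disjoint and cover it, so the four series add up to 4 times the
    series of W(2u) - W(2v). Both sides being differences, an additive constant stays open. *)
Lemma wp_double_diff u v : ~ L (u + u)%C -> ~ L (v + v)%C ->
  (4 * W (u + u) - (W u + W (u + h1) + W (u + h2) + W (u + h3))
   = 4 * W (v + v) - (W v + W (v + h1) + W (v + h2) + W (v + h3)))%C.
Proof.
  intros Hu Hv. destruct half_diff_not as [D1 [D2 [D3 [D4 [D5 D6]]]]].
  assert (H00 : L (0 + 0)%C) by (replace (0 + 0)%C with (RtoC 0) by ring; apply rect_lattice_0).
  assert (S := is_unordered_sum_union _ _ _ _ _
    (fun z Hz Hz' => match Hz, Hz' with
      | or_introl A, or_introl B => coset_disjoint _ _ z D3 A B
      | or_introl A, or_intror B => coset_disjoint _ _ z D4 A B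
      | or_intror A, or_introl B => coset_disjoint _ _ z D5 A B
      | or_intror A, or_intror B => coset_disjoint _ _ z D6 A B end)
    (is_unordered_sum_union _ _ _ _ _ (fun z => coset_disjoint _ _ z D1)
      (coset_sum 0 u v H00 Hu Hv) (coset_sum h1 u v half1_twice Hu Hv))
    (is_unordered_sum_union _ _ _ _ _ (fun z => coset_disjoint _ _ z D2)
      (coset_sum h2 u v half2_twice Hu Hv) (coset_sum h3 u v half3_twice Hu Hv))).
  apply (is_unordered_sum_iff _ L _ _ coset_cover) in S.
  assert (S' := is_unordered_sum_scal _ _ _ 4%C (wpR_diff_sum a b Ha Hb _ _ Hu Hv)).
  generalize (unordered_sum_inj _ _ _ _ S S').
  replace (u + 0)%C with u by ring. replace (v + 0)%C with v by ring.
  intros E. apply Ceq_of_minus.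
  replace (4 * W (u + u) - (W u + W (u + h1) + W (u + h2) + W (u + h3))
    - (4 * W (v + v) - (W v + W (v + h1) + W (v + h2) + W (v + h3))))%C
    with (4 * (W (u + u) - W (v + v)) - (W u - W v + (W (u + h1) - W (v + h1))
      + (W (u + h2) - W (v + h2) + (W (u + h3) - W (v + h3)))))%C by ring.
  rewrite E. ring.
Qed.

Let c1 := ((e1 - e2) * (e1 - e3))%C.
Let c2 := ((e2 - e1) * (e2 - e3))%C.
Let c3 := ((e3 - e1) * (e3 - e2))%C.

Lemma wp_half_shifts u : ~ L (u + u)%C ->
  (W (u + h1) = e1 + c1 / (W u - e1) /\ W (u + h2) = e2 + c2 / (W u - e2) /\
   W (u + h3) = e3 + c3 / (W u - e3))%C.
Proof.
  intros Hu. destruct (not_half_lattice u Hu) as [H0 [H1 [H2 H3]]].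
  destruct (wp_neq_e u Hu) as [N1 [N2 N3]].
  apply Cminus_neq0 in N1. apply Cminus_neq0 in N2. apply Cminus_neq0 in N3.
  repeat split.
  - replace (W (u + h1)%C) with (e1 + (W (u + h1) - e1))%C by ring.
    now rewrite (Cdiv_of_mult _ _ _ N1 (wp_half_product1 u H0 H1)).
  - replace (W (u + h2)%C) with (e2 + (W (u + h2) - e2))%C by ring.
    now rewrite (Cdiv_of_mult _ _ _ N2 (wp_half_product2 u H0 H2)).
  - replace (W (u + h3)%C) with (e3 + (W (u + h3) - e3))%C by ring.
    now rewrite (Cdiv_of_mult _ _ _ N3 (wp_half_product3 u H0 H3)).
Qed.

(* The additive constant is evaluated at the quarter period [a / 4]. *)
Lemma wp_double u : ~ L (u + u)%C -> (4 * W (u + u) = dup c1 c2 c3 e1 e2 e3 (W u))%C.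
Proof.
  intros Hu. pose (q := (a / 4, 0) : C).
  assert (Eq : (q + q)%C = h1) by (C_field).
  assert (Hq : ~ L (q + q)%C) by (rewrite Eq; apply half1_not).
  destruct (not_half_lattice q Hq) as [Q0 [Q1 _]].
  (* At the quarter period, [q + h1] is congruent to [- q], so [X - e1] is a square root of [c1];
     this quadratic relation is what makes the additive constant vanish. *)
  assert (EX : W (q + h1)%C = W q).
  { replace (q + h1)%C with (- q + (h1 + h1))%C by (rewrite <- Eq; ring).
    rewrite wpR_period; trivial; [|apply half1_twice|now apply not_lattice_opp].
    now apply wpR_even. }
  assert (HC := wp_double_diff u q Hu Hq).
  destruct (wp_half_shifts u Hu) as [U1 [U2 U3]].
  destruct (wp_half_shifts q Hq) as [_ [V2 V3]].
  rewrite EX, V2, V3, Eq in HC. fold e1 in HC.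
  destruct (wp_neq_e q Hq) as [N1 [N2 N3]].
  set (X := W q) in *. set (Y := (X - e1)%C).
  assert (HY : (Y * Y - (e1 - e2) * (e1 - e3) = 0)%C).
  { unfold Y. rewrite <- (wp_half_product1 q Q0 Q1), EX. fold X. ring. }
  apply Cminus_neq0 in N2. apply Cminus_neq0 in N3.
  assert (Hz : (4 * e1 - (X + X + (e2 + c2 / (X - e2)) + (e3 + c3 / (X - e3))) = 0)%C).
  { transitivity (- ((Y * Y - (e1 - e2) * (e1 - e3)) * (2 * Y + (e1 - e2) + (e1 - e3))
      / ((X - e2) * (X - e3))))%C.
    - unfold Y, c2, c3. field. auto.
    - rewrite HY. field. auto. }
  rewrite Hz in HC. unfold dup. rewrite <- U1, <- U2, <- U3.
  apply Ceq_of_minus. rewrite <- HC. ring.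
Qed.

Lemma wp_double_e u : ~ L (u + u)%C ->
  let x := W u in
  let p := (4 * ((x - e1) * (x - e2) * (x - e3)))%C in
  p <> 0%C /\
  (W (u + u) - e1 = ((x - e1) * (x - e1) - c1) * ((x - e1) * (x - e1) - c1) / p /\
   W (u + u) - e2 = ((x - e2) * (x - e2) - c2) * ((x - e2) * (x - e2) - c2) / p /\
   W (u + u) - e3 = ((x - e3) * (x - e3) - c3) * ((x - e3) * (x - e3) - c3) / p)%C.
Proof.
  intros Hu x p. destruct (wp_neq_e u Hu) as [N1 [N2 N3]]. fold x in N1, N2, N3.
  apply Cminus_neq0 in N1. apply Cminus_neq0 in N2. apply Cminus_neq0 in N3.
  assert (H4 : RtoC 4 <> RtoC 0) by (intros E; apply RtoC_inj in E; lra).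
  split; [unfold p; repeat apply Cmult_neq_0; trivial|].
  assert (E : W (u + u)%C = (dup c1 c2 c3 e1 e2 e3 x / 4)%C).
  { unfold x. rewrite <- (wp_double u Hu). field. }
  rewrite E. unfold p, dup, c1, c2, c3. repeat split; field; repeat split; trivial.
Qed.

(** * The differential equation *)

Let pi (u : C) : C := ((W u - e1) * (W u - e2) * (W u - e3))%C.

(** Derivative of the duplication formula; 8 is 4 times the inner derivative 2 of doubling. *)
Lemma wp_deriv_double u : ~ L (u + u)%C ->
  (8 * C_derive W (u + u) = (1 - c1 / ((W u - e1) * (W u - e1))
    - c2 / ((W u - e2) * (W u - e2)) - c3 / ((W u - e3) * (W u - e3))) * C_derive W u)%C.
Proof.
  intros Hu. destruct (not_half_lattice u Hu) as [H0 _].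
  destruct (wp_neq_e u Hu) as [N1 [N2 N3]].
  destruct (dup_deriv c1 c2 c3 e1 e2 e3 (W u) N1 N2 N3) as [D1 D2].
  destruct (hol_at_comp_deriv _ W u (wpR_hol a b Ha Hb u H0) D1) as [D3 D4].
  rewrite <- D2, <- D4.
  destruct (hol_at_plus_deriv (fun u => u) (fun u => u) u (hol_at_id u) (hol_at_id u))
    as [A1 A2].
  destruct (hol_at_comp_deriv W (fun u => u + u)%C u A1 (wpR_hol a b Ha Hb _ Hu)) as [B1 B2].
  destruct (hol_at_mult_deriv (fun _ => RtoC 4) (fun u => W (u + u)%C) u (hol_at_const _ _) B1)
    as [E1 E2].
  destruct (not_lattice_near a b Ha Hb _ Hu) as [r [Hr K]].
  destruct (hol_at_ext_deriv (fun u => 4 * W (u + u))%C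
    (fun u => dup c1 c2 c3 e1 e2 e3 (W u)) u (r / 2)) as [_ F2]; [lra| |exact E1|].
  - intros v Hv. apply wp_double. apply K.
    replace (v + v - (u + u))%C with (2 * (v - u))%C by ring.
    rewrite Cmod_mult, Cmod_2. lra.
  - rewrite F2, E2, B2, A2, (proj2 (hol_at_id_deriv u)), (proj2 (hol_at_const_deriv _ _)).
    ring.
Qed.
(** After duplication and its derivative are inserted, both sides are [C_derive W u ^ 2] times the
    same rational function of [W u]: the squares in [wp_double_e] match the square of the derivative
    factor. *)
Lemma wp_ode_double u : ~ L (u + u)%C ->
  (C_derive W (u + u) ^ 2 * pi u = C_derive W u ^ 2 * pi (u + u))%C.
Proof.
  intros Hu. destruct (wp_neq_e u Hu) as [N1 [N2 N3]].
  destruct (wp_double_e u Hu) as [Hp [E1 [E2 E3]]].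
  assert (HD : C_derive W (u + u)%C = ((1 - c1 / ((W u - e1) * (W u - e1))
    - c2 / ((W u - e2) * (W u - e2)) - c3 / ((W u - e3) * (W u - e3))) * C_derive W u / 8)%C).
  { rewrite <- (wp_deriv_double u Hu). field. }
  unfold pi. rewrite E1, E2, E3, HD. clear E1 E2 E3 HD.
  apply Cminus_neq0 in N1. apply Cminus_neq0 in N2. apply Cminus_neq0 in N3.
  unfold c1, c2, c3. field. auto.
Qed.

Lemma wpR_deriv_reg u : ~ L u ->
  C_derive W u = (- (2) / (u * u * u) + C_derive (wp_reg a b) u)%C.
Proof.
  intros Hu. assert (Hu0 : u <> 0%C) by exact (not_lattice_neq0 a b u Hu).
  destruct (hol_at_mult_deriv (fun u => u) (fun u => u) u (hol_at_id u) (hol_at_id u))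
    as [A1 A2].
  assert (Huu : (u * u)%C <> 0%C) by now apply Cmult_neq_0.
  destruct (hol_at_comp_deriv (fun u => / u)%C (fun u => u * u)%C u A1 (hol_at_inv _ Huu))
    as [B1 B2].
  destruct (hol_at_mult_deriv (fun _ => RtoC 1) (fun u => / (u * u))%C u (hol_at_const _ u) B1)
    as [D1 D2].
  destruct (wp_reg_sum a b Ha Hb u (not_lattice_not_L' a b u Hu)) as [_ HR].
  destruct (hol_at_plus_deriv _ (wp_reg a b) u D1 HR) as [E1 E2].
  etransitivity; [exact E2|].
  rewrite D2, B2, A2, (proj2 (hol_at_inv_deriv _ Huu)), (proj2 (hol_at_id_deriv u)),
    (proj2 (hol_at_const_deriv _ _)).
  field. trivial.
Qed.

(** Multiplication by v^6 clears the poles: the left side becomes (x - 2)^2, the right side k (1 +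
    y1)(1 + y2)(1 + y3), where x and the y's are of order [Cmod v]. Comparing constant terms gives 4
    = k up to that order. *)
Lemma wp_ode_const_near0 (k : C) : exists K r, 0 < r /\ forall v, 0 < Cmod v < r ->
  (C_derive W v ^ 2 = k * pi v)%C -> Cmod (4 - k) <= K * Cmod v.
Proof.
  destruct (wp_reg_bounded_near0 a b Ha Hb) as [r [M [Hr [HM N]]]].
  destruct (not_lattice_near0 a b Ha Hb) as [r1 [Hr1 H1]].
  set (B := M + Cmod e1 + Cmod e2 + Cmod e3).
  generalize (Cmod_ge_0 e1) (Cmod_ge_0 e2) (Cmod_ge_0 e3) (Cmod_ge_0 k);
    intros P1 P2 P3 Pk.
  exists (M * (M + 4) + Cmod k * (B * (1 + B) * (1 + B) + B * (1 + B) + B)), (Rmin (Rmin r r1) 1).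
  split; [repeat apply Rmin_glb_lt; trivial; lra|].
  intros v [Hv0 Hv] HE.
  assert (A1 : Cmod v < r) by split_min.
  assert (A2 : Cmod v < r1) by split_min.
  assert (A3 : Cmod v < 1) by split_min.
  assert (Hv1 : v <> 0%C) by now apply Cneq_0_of_Cmod.
  assert (HL : ~ L v) by now apply H1.
  destruct (N v A1) as [N1 N2].
  rewrite wpR_deriv_reg in HE by trivial. unfold pi in HE. rewrite wpR_reg in HE.
  set (R := wp_reg a b v) in *. set (R' := C_derive (wp_reg a b) v) in *.
  set (x := (v * (v * v * R'))%C).
  set (y1 := (v * (v * (R - e1)))%C). set (y2 := (v * (v * (R - e2)))%C).
  set (y3 := (v * (v * (R - e3)))%C).
  set (d := Cmod v) in *.
  assert (Hd : 0 <= d <= 1) by lra.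
  assert (HB : 0 <= B) by (unfold B; lra).
  assert (Hx : Cmod x <= d * M).
  { unfold x. rewrite !Cmod_mult. fold d.
    apply Rmult_le_compat_l; [lra|]. generalize (Cmod_ge_0 R'); intros.
    replace M with (1 * 1 * M) by ring.
    repeat apply Rmult_le_compat; try lra. apply Rmult_le_pos; lra. }
  assert (Hy : forall e, Cmod e <= Cmod e1 + Cmod e2 + Cmod e3 ->
    Cmod (v * (v * (R - e))) <= d * B).
  { intros e He. rewrite !Cmod_mult. fold d. apply Rmult_le_compat_l; [lra|].
    generalize (Cmod_ge_0 (R - e)) (Cmod_minus_triangle R e); intros.
    replace B with (1 * B) by ring. apply Rmult_le_compat; unfold B; lra. }
  assert (Y1 : Cmod y1 <= d * B) by (apply Hy; lra).
  assert (Y2 : Cmod y2 <= d * B) by (apply Hy; lra).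
  assert (Y3 : Cmod y3 <= d * B) by (apply Hy; lra).
  assert (HdB : d * B <= B) by nra.
  assert (HdM : d * M <= M) by nra.
  assert (Q : ((4 - k) = - (x * (x - 4))
    + k * (y1 * (1 + y2) * (1 + y3) + y2 * (1 + y3) + y3))%C).
  { assert (E : ((v * v * v) * (v * v * v) * (- (2) / (v * v * v) + R') ^ 2
      = k * ((v * v) * (1 / (v * v) + R - e1) * ((v * v) * (1 / (v * v) + R - e2))
        * ((v * v) * (1 / (v * v) + R - e3))))%C) by (rewrite HE; ring).
    assert (E1 : ((v * v * v) * (v * v * v) * (- (2) / (v * v * v) + R') ^ 2
      = (x - 2) * (x - 2))%C) by (unfold x; field; trivial).
    assert (E2 : forall e, ((v * v) * (1 / (v * v) + R - e) = 1 + v * (v * (R - e)))%C)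
      by (intros; field; trivial).
    rewrite E1, !E2 in E. fold y1 y2 y3 in E.
    replace (4 - k)%C with ((x - 2) * (x - 2) - k - x * (x - 4))%C by ring.
    rewrite E. ring. }
  rewrite Q. clearbody x y1 y2 y3. eapply Rle_trans; [apply Cmod_triangle|].
  rewrite Cmod_opp.
  assert (C4 : Cmod 4 = 4) by (rewrite Cmod_R, Rabs_right; lra).
  assert (C1 : Cmod 1 = 1) by apply Cmod_1.
  assert (T1 : Cmod (x * (x - 4)) <= (d * M) * (M + 4)).
  { apply Cmod_mult_le; trivial. generalize (Cmod_minus_triangle x 4). lra. }
  assert (O2 : Cmod (1 + y2) <= 1 + B) by (apply Cmod_plus_le; lra).
  assert (O3 : Cmod (1 + y3) <= 1 + B) by (apply Cmod_plus_le; lra).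
  assert (T2 : Cmod (k * (y1 * (1 + y2) * (1 + y3) + y2 * (1 + y3) + y3))
    <= Cmod k * ((d * B) * (1 + B) * (1 + B) + (d * B) * (1 + B) + d * B)).
  { repeat (apply Cmod_mult_le || apply Cmod_plus_le); trivial; lra. }
  replace ((M * (M + 4) + Cmod k * (B * (1 + B) * (1 + B) + B * (1 + B) + B)) * d)
    with ((d * M) * (M + 4) + Cmod k * ((d * B) * (1 + B) * (1 + B) + (d * B) * (1 + B) + d * B))
    by ring.
  lra.
Qed.

(* [wp'^2 / pi] is invariant under doubling, hence equal to its limit [4] at the origin. *)
Lemma wp_ode u : ~ L (u + u)%C ->
  (C_derive W u ^ 2 = 4 * ((W u - e1) * (W u - e2) * (W u - e3)))%C.
Proof.
  intros Hu. change (C_derive W u ^ 2 = 4 * pi u)%C.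
  assert (Hpi : forall u, ~ L (u + u)%C -> pi u <> 0%C).
  { clear u Hu. intros u Hu. destruct (wp_neq_e u Hu) as [N1 [N2 N3]].
    unfold pi. repeat apply Cmult_neq_0; now apply Cminus_neq0. }
  set (k := (C_derive W u ^ 2 / pi u)%C).
  pose (p := fun n : nat => (RtoC ((1 / 2) ^ n) * u)%C).
  assert (Hpp : forall n, (p (S n) + p (S n))%C = p n).
  { intros n. unfold p. C_field. }
  assert (Hnp : forall n, ~ L (p n + p n)%C).
  { induction n as [|n IH].
    - unfold p. simpl. now replace (1 * u + 1 * u)%C with (u + u)%C by ring.
    - rewrite Hpp. intros HL. apply IH. now apply rect_lattice_plus. }
  assert (HI : forall n, (C_derive W (p n) ^ 2 = k * pi (p n))%C).
  { induction n as [|n IH].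
    - unfold p. simpl (RtoC ((1 / 2) ^ 0)). replace (1 * u)%C with u by ring.
      unfold k. field. now apply Hpi.
    - assert (E := wp_ode_double (p (S n)) (Hnp (S n))). rewrite Hpp, IH in E.
      assert (H1 := Hpi _ (Hnp n)). assert (H2 := Hpi _ (Hnp (S n))).
      transitivity (C_derive W (p (S n)) ^ 2 * pi (p n) / pi (p n))%C; [field; trivial|].
      rewrite <- E. field. trivial. }
  assert (Hk : (4 - k)%C = 0%C).
  { destruct (wp_ode_const_near0 k) as [K [r [Hr HK]]].
    assert (Hu0 : 0 < Cmod u).
    { apply Cmod_gt_0. apply (not_lattice_neq0 a b). now apply not_half_lattice. }
    assert (Hpn : forall n, Cmod (p n) = (1 / 2) ^ n * Cmod u).
    { intros n. unfold p. rewrite Cmod_mult, Cmod_R, Rabs_right; trivial.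
      apply Rle_ge, pow_le; lra. }
    apply Cmod_lt_eq0. intros eps He.
    set (eta := Rmin r (eps / (Rabs K + 1))).
    assert (HKp : 0 <= Rabs K) by apply Rabs_pos.
    assert (Heta : 0 < eta) by (apply Rmin_glb_lt; trivial; apply Rdiv_lt_0_compat; lra).
    destruct (pow_lt_1_zero (1 / 2) ltac:(rewrite Rabs_right; lra) (eta / Cmod u))
      as [n Hn]; [now apply Rdiv_lt_0_compat|].
    specialize (Hn n (Nat.le_refl n)).
    assert (Hp2 : 0 < (1 / 2) ^ n) by (apply pow_lt; lra).
    rewrite Rabs_right in Hn by lra.
    assert (Hpe : 0 < Cmod (p n) < eta).
    { rewrite Hpn. split; [now apply Rmult_lt_0_compat|].
      replace eta with (eta / Cmod u * Cmod u) by (field; lra). now apply Rmult_lt_compat_r. }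
    assert (Hr2 : eta <= r) by apply Rmin_l.
    assert (He2 : eta <= eps / (Rabs K + 1)) by apply Rmin_r.
    eapply Rle_lt_trans; [apply (HK (p n)); [lra|apply HI]|].
    apply Rle_lt_trans with (Rabs K * Cmod (p n)).
    - apply Rmult_le_compat_r; [lra|apply Rle_abs].
    - apply Rle_lt_trans with ((Rabs K + 1) * Cmod (p n)); [nra|].
      replace eps with ((Rabs K + 1) * (eps / (Rabs K + 1))) by (field; lra).
      apply Rmult_lt_compat_l; lra. }
  replace (4 * pi u)%C with (k * pi u + (4 - k) * pi u)%C by ring. rewrite Hk.
  unfold k. field. now apply Hpi.
Qed.

End Doubling.

(** * The complete elliptic integral *)

Definition ell_integrand (q psi : R) : R := / sqrt (1 - q ^ 2 * sin psi ^ 2).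

Lemma ell_radicand_pos q psi : 0 <= q < 1 -> 0 < 1 - q ^ 2 * sin psi ^ 2.
Proof.
  intros Hq. assert (H1 : sin psi ^ 2 <= 1).
  { generalize (sin2_cos2 psi) (Rle_0_sqr (cos psi)). unfold Rsqr. intros. simpl. lra. }
  assert (H2 : 0 <= sin psi ^ 2) by apply pow2_ge_0.
  assert (q ^ 2 < 1) by nra. nra.
Qed.

Lemma ell_integrand_cont q psi : 0 <= q < 1 -> continuous (ell_integrand q) psi.
Proof.
  intros Hq. apply (ex_derive_continuous (V := R_NormedModule)). unfold ell_integrand.
  generalize (ell_radicand_pos q psi Hq); intros H.
  auto_derive. simpl in H. repeat split; trivial.
  apply Rgt_not_eq. now apply sqrt_lt_R0.
Qed.

Definition ellF (q phi : R) : R := RInt (ell_integrand q) 0 phi.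

Lemma ellF_derive q phi : 0 <= q < 1 -> is_derive (ellF q) phi (ell_integrand q phi).
Proof.
  intros Hq. apply (is_derive_RInt (V := R_NormedModule) (ell_integrand q) (ellF q) 0 phi).
  - apply filter_forall. intros x. apply (RInt_correct (V := R_CompleteNormedModule)).
    apply (ex_RInt_continuous (V := R_CompleteNormedModule)).
    intros z _. now apply ell_integrand_cont.
  - now apply ell_integrand_cont.
Qed.

Lemma ellF_0 q : ellF q 0 = 0.
Proof. apply (RInt_point (V := R_CompleteNormedModule)). Qed.

Lemma ellF_PI2 q : ellF q (PI / 2) = ellK q.
Proof. reflexivity. Qed.

Lemma derive_continuity_pt (f : R -> R) x l : is_derive f x l -> continuity_pt f x.
Proof.
  intros H. apply continuity_pt_filterlim.
  apply (ex_derive_continuous (V := R_NormedModule)). now exists l.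
Qed.

Lemma ellK_increasing q1 q2 : 0 <= q1 < q2 -> q2 < 1 -> ellK q1 < ellK q2.
Proof.
  intros H1 H2. generalize PI_RGT_0; intros HPI. unfold ellK.
  apply RInt_lt; [lra| | |].
  - intros x _. apply (ell_integrand_cont q2 x); lra.
  - intros x _. apply (ell_integrand_cont q1 x); lra.
  - intros x Hx. assert (Hs : 0 < sin x) by (apply sin_gt_0; lra).
    assert (P2 : 0 < 1 - q2 ^ 2 * sin x ^ 2) by (apply ell_radicand_pos; lra).
    apply Rinv_lt_contravar.
    + apply Rmult_lt_0_compat; apply sqrt_lt_R0; trivial. apply ell_radicand_pos; lra.
    + apply sqrt_lt_1_alt. split; [lra|].
      assert (q1 ^ 2 < q2 ^ 2) by nra. assert (0 < sin x ^ 2) by now apply pow_lt. nra.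
Qed.

Lemma ellK_pos q : 0 <= q < 1 -> 0 < ellK q.
Proof.
  intros Hq. generalize PI_RGT_0; intros HPI. unfold ellK.
  apply RInt_gt_0; [lra| |].
  - intros x _. apply Rinv_0_lt_compat, sqrt_lt_R0. now apply ell_radicand_pos.
  - intros x _. now apply (ell_integrand_cont q x).
Qed.

(** The radicand is cos^2 x + k^2 sin^2 x, at most (PI/2 - x + k)^2. The inverse of PI/2 - x + k has
    integral ln (PI/2 + k) - ln k, and the first logarithm is nonnegative since PI/2 > 1. *)
Lemma ellK_compl_lower k : 0 < k < 1 -> - ln k <= ellK (sqrt (1 - k ^ 2)).
Proof.
  intros Hk. set (q := sqrt (1 - k ^ 2)).
  assert (Hq0 : 0 <= q) by apply sqrt_pos.
  assert (Hq2 : q ^ 2 = 1 - k ^ 2) by (apply pow2_sqrt; nra).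
  assert (Hq : 0 <= q < 1) by nra.
  generalize PI_RGT_0 PI2_1; intros HPI HP1.
  pose (g := fun x => / (PI / 2 - x + k)).
  assert (HI : is_RInt g 0 (PI / 2) (- ln k - - ln (PI / 2 + k))).
  { evar_last.
    - apply (is_RInt_derive (V := R_CompleteNormedModule) (fun x => - ln (PI / 2 - x + k))).
      + intros x Hx. rewrite Rmin_left, Rmax_right in Hx by lra.
        unfold g. auto_derive; [lra|field; lra].
      + intros x Hx. rewrite Rmin_left, Rmax_right in Hx by lra.
        apply (ex_derive_continuous (V := R_NormedModule)). unfold g. auto_derive. lra.
    - unfold minus, plus, opp; simpl.
      replace (PI / 2 - PI / 2 + k) with k by ring.
      replace (PI / 2 - 0 + k) with (PI / 2 + k) by ring.
      reflexivity. }
  assert (Hln : 0 <= ln (PI / 2 + k)).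
  { rewrite <- ln_1. apply ln_le; lra. }
  apply Rle_trans with (RInt g 0 (PI / 2)).
  { rewrite (is_RInt_unique _ _ _ _ HI). lra. }
  unfold ellK. apply RInt_le; [lra|now exists (- ln k - - ln (PI / 2 + k))| |].
  - apply (ex_RInt_continuous (V := R_CompleteNormedModule)).
    intros z _. now apply (ell_integrand_cont q z).
  - intros x Hx. unfold g.
    assert (P2 : 0 < 1 - q ^ 2 * sin x ^ 2) by now apply ell_radicand_pos.
    apply Rinv_le_contravar; [now apply sqrt_lt_R0|].
    rewrite <- (sqrt_square (PI / 2 - x + k)) by lra. apply sqrt_le_1_alt.
    assert (Hc : cos x <= PI / 2 - x) by (rewrite <- sin_shift; left; apply sin_lt_x; lra).
    assert (Hc0 : 0 <= cos x) by (apply cos_ge_0; lra).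
    generalize (sin2_cos2 x). unfold Rsqr. intros Hsc.
    rewrite Hq2. replace (sin x ^ 2) with (1 - cos x * cos x) by (simpl; lra).
    assert (cos x * cos x <= (PI / 2 - x) * (PI / 2 - x)) by (apply Rmult_le_compat; lra).
    assert (0 <= k ^ 2 * (cos x * cos x)) by (apply Rmult_le_pos; [apply pow2_ge_0|nra]).
    nra.
Qed.

(** * Half periods of solutions of the differential equation as complete elliptic integrals *)

Section Legendre.
Variables (P dP : R -> R) (h e1 e2 e3 : R).
Hypothesis Hh : 0 < h.
Hypothesis H23 : e2 < e3.
Hypothesis H31 : e3 < e1.
Hypothesis HD : forall x, 0 < x <= h -> is_derive P x (dP x).
Hypothesis Hode : forall x, 0 < x < h -> dP x ^ 2 = 4 * ((P x - e1) * (P x - e2) * (P x - e3)).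
Hypothesis Hgt : forall x, 0 < x < h -> e1 < P x.
Hypothesis HPh : P h = e1.
Hypothesis Hinf : forall B, exists d, 0 < d /\ forall x, 0 < x < d -> B < P x.

(** The equation forbids zeros of [dP] where [P > e1]. Were [dP x] positive, [P] would be below
    [P x] just left of [x] and above it near 0, hence would have an interior minimum with zero
    derivative. *)
Lemma legendre_deriv_neg x : 0 < x < h -> dP x < 0.
Proof.
  intros Hx. assert (Hne : forall y, 0 < y < h -> dP y <> 0).
  { intros y Hy E. generalize (Hode y Hy) (Hgt y Hy). rewrite E. intros H1 H2.
    assert (0 < (P y - e1) * (P y - e2) * (P y - e3)) by (repeat apply Rmult_lt_0_compat; lra).
    lra. }
  destruct (Rtotal_order (dP x) 0) as [H|[H|H]]; trivial; [now apply Hne in H|].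
  exfalso.
  destruct (Hinf (P x)) as [d [Hd Hd']].
  set (y0 := Rmin (d / 2) (x / 2)).
  assert (Hy0 : 0 < y0 /\ y0 < d /\ y0 < x).
  { unfold y0. generalize (Rmin_l (d / 2) (x / 2)) (Rmin_r (d / 2) (x / 2)).
    assert (0 < Rmin (d / 2) (x / 2)) by (apply Rmin_glb_lt; lra). lra. }
  assert (Hbig : P x < P y0) by (apply Hd'; lra).
  destruct (proj1 (is_derive_eps P x (dP x)) (HD x ltac:(lra)) (dP x / 2) ltac:(lra))
    as [de [Hde K]].
  set (s := Rmin (de / 2) ((x - y0) / 2)).
  assert (Hs : 0 < s /\ s < de /\ s < x - y0).
  { unfold s. generalize (Rmin_l (de / 2) ((x - y0) / 2)) (Rmin_r (de / 2) ((x - y0) / 2)).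
    assert (0 < Rmin (de / 2) ((x - y0) / 2)) by (apply Rmin_glb_lt; lra). lra. }
  specialize (K (x - s)). replace (x - s - x) with (- s) in K by ring.
  rewrite Rabs_Ropp, (Rabs_right s) in K by lra. specialize (K ltac:(lra)).
  assert (Hlow : P (x - s) < P x).
  { generalize (Rle_abs (P (x - s) - P x - - s * dP x)). nra. }
  destruct (continuity_ab_min P y0 x) as [m [Hm1 Hm2]]; [lra| |].
  { intros c Hc. apply derive_continuity_pt with (dP c). apply HD; lra. }
  assert (Hmlow : P m < P x).
  { eapply Rle_lt_trans; [apply (Hm1 (x - s)); lra|exact Hlow]. }
  assert (Hmx : y0 < m < x).
  { split; apply Rnot_le_lt; intros Hc.
    - replace m with y0 in Hmlow by lra. lra.
    - replace m with x in Hmlow by lra. lra. }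
  assert (pr : derivable_pt_lim P m (dP m)).
  { apply is_derive_Reals, HD. lra. }
  apply (Hne m ltac:(lra)).
  rewrite <- (derive_pt_eq_0 P m (dP m) (exist _ (dP m) pr) pr).
  apply (deriv_minimum P y0 x m); try lra. intros; apply Hm1; lra.
Qed.

Let lam := sqrt (e1 - e2).
Let q := sqrt ((e3 - e2) / (e1 - e2)).

Lemma legendre_lam : 0 < lam /\ lam * lam = e1 - e2.
Proof. split; [apply sqrt_lt_R0; lra|apply sqrt_sqrt; lra]. Qed.

Lemma legendre_modulus : 0 <= q < 1 /\ q ^ 2 = (e3 - e2) / (e1 - e2).
Proof.
  assert (H0 : 0 < (e3 - e2) / (e1 - e2)) by (apply Rdiv_lt_0_compat; lra).
  split; [split; [apply sqrt_pos|]|].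
  - rewrite <- sqrt_1. apply sqrt_lt_1_alt. split; [lra|].
    apply Rmult_lt_reg_r with (e1 - e2); [lra|].
    replace ((e3 - e2) / (e1 - e2) * (e1 - e2)) with (e3 - e2) by (field; lra). lra.
  - apply pow2_sqrt. lra.
Qed.

(** The amplitude has tangent [lam / sqrt (P x - e1)]; writing it as [PI / 2 - atan] of the inverse
    keeps it continuous up to [x = h], where [P = e1]. *)
Let G (x : R) : R := ellF q (PI / 2 - atan (sqrt (P x - e1) / lam)) - lam * x.

(* With [sn^2 = (e1 - e2) / (P - e2)] the amplitude has constant speed in the variable [ellF]. *)
Lemma legendre_G_deriv x : 0 < x < h -> is_derive G x 0.
Proof.
  intros Hx. destruct legendre_lam as [Hl Hll]. destruct legendre_modulus as [Hq Hq2].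
  assert (HA : 0 < P x - e1) by (generalize (Hgt x Hx); lra).
  assert (HB : 0 < P x - e2) by lra. assert (HC : 0 < P x - e3) by lra.
  assert (SA : 0 < sqrt (P x - e1)) by now apply sqrt_lt_R0.
  assert (SB : 0 < sqrt (P x - e2)) by now apply sqrt_lt_R0.
  assert (SC : 0 < sqrt (P x - e3)) by now apply sqrt_lt_R0.
  assert (HdP : dP x = - (2 * (sqrt (P x - e1) * sqrt (P x - e2) * sqrt (P x - e3)))).
  { set (r := sqrt (P x - e1) * sqrt (P x - e2) * sqrt (P x - e3)).
    assert (Hr : r * r = (P x - e1) * (P x - e2) * (P x - e3)).
    { unfold r. rewrite <- (sqrt_sqrt (P x - e1)) at 3 by lra.
      rewrite <- (sqrt_sqrt (P x - e2)) at 3 by lra.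
      rewrite <- (sqrt_sqrt (P x - e3)) at 3 by lra. ring. }
    assert (Hr0 : 0 < r) by (unfold r; repeat apply Rmult_lt_0_compat; trivial).
    generalize (Hode x Hx) (legendre_deriv_neg x Hx). rewrite <- Hr. intros E Hn.
    assert (E2 : (dP x - 2 * r) * (dP x + 2 * r) = 0) by (simpl in E; lra).
    apply Rmult_integral in E2. destruct E2; lra. }
  set (y := sqrt (P x - e1) / lam).
  assert (Hy : 0 < y) by now apply Rdiv_lt_0_compat.
  assert (Hy2 : 1 + y ^ 2 = (P x - e2) / (e1 - e2)).
  { unfold y. rewrite <- Hll. unfold Rdiv. rewrite Rpow_mult_distr.
    rewrite <- Rsqr_pow2, Rsqr_sqrt by lra.
    replace (P x - e2) with (P x - e1 + lam * lam) by lra. field. lra. }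
  assert (D1 : is_derive (fun x => sqrt (P x - e1)) x (dP x / (2 * sqrt (P x - e1)))).
  { apply (is_derive_sqrt (fun x => P x - e1)); trivial.
    replace (dP x) with (dP x - 0) by ring.
    apply (is_derive_minus (V := R_NormedModule) P (fun _ => e1)); [apply HD; lra|].
    apply (is_derive_const (V := R_NormedModule)). }
  assert (D2 : is_derive (fun x => sqrt (P x - e1) / lam) x
    (dP x / (2 * sqrt (P x - e1)) / lam)).
  { apply (is_derive_ext (fun x => / lam * sqrt (P x - e1))); [intros; apply Rmult_comm|].
    evar_last; [apply (is_derive_scal (fun x => sqrt (P x - e1))), D1|].
    simpl. field. lra. }
  assert (D3 : is_derive (fun x => atan (sqrt (P x - e1) / lam)) x
    (dP x / (2 * sqrt (P x - e1)) / lam * / (1 + y ^ 2))).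
  { apply (is_derive_comp atan (fun x => sqrt (P x - e1) / lam)); [|exact D2].
    rewrite <- Rsqr_pow2. apply is_derive_atan. }
  assert (D4 : is_derive (fun x => PI / 2 - atan (sqrt (P x - e1) / lam)) x
    (0 - dP x / (2 * sqrt (P x - e1)) / lam * / (1 + y ^ 2))).
  { apply (is_derive_minus (V := R_NormedModule) (fun _ => PI / 2)); [|exact D3].
    apply (is_derive_const (V := R_NormedModule)). }
  assert (D5 := is_derive_comp (ellF q) _ x _ _ (ellF_derive q _ Hq) D4).
  unfold G. evar_last.
  - apply (is_derive_minus (V := R_NormedModule) _ (fun x => lam * x)); [exact D5|].
    apply (is_derive_scal (fun x => x)), (is_derive_id (K := R_AbsRing)).
  - unfold ell_integrand. rewrite sin_shift, cos_atan. fold y.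
    replace (1 - q ^ 2 * (1 / sqrt (1 + y²)) ^ 2) with ((P x - e3) / (P x - e2)).
    2: { unfold Rdiv at 2. rewrite Rmult_1_l, pow_inv, <- (Rsqr_pow2 (sqrt _)).
         rewrite Rsqr_sqrt by (generalize (Rle_0_sqr y); lra).
         rewrite Rsqr_pow2, Hy2, Hq2. field. lra. }
    rewrite Hy2, sqrt_div_alt by lra. rewrite <- Hll, HdP.
    unfold minus, plus, opp, scal, one; simpl. unfold mult; simpl.
    replace (P x - e2) with (sqrt (P x - e2) * sqrt (P x - e2)) at 2 by (apply sqrt_sqrt; lra).
    field. repeat split; lra.
Qed.

(** [G] is constant up to [h] by the mean value theorem. It tends to 0 at 0, where the pole of [P]
    sends the amplitude to 0, while at [h] the amplitude is PI/2. *)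
Lemma legendre_period : lam * h = ellK q.
Proof.
  destruct legendre_lam as [Hl Hll]. destruct legendre_modulus as [Hq Hq2].
  assert (HcF : forall phi, continuity_pt (ellF q) phi).
  { intros phi. eapply derive_continuity_pt. now apply ellF_derive. }
  assert (HGh : forall x, 0 < x < h -> G h = G x).
  { intros x Hx. destruct (MVT_gen G x h (fun _ => 0)) as [c [_ Hc]]; [| |lra].
    - intros y Hy. rewrite Rmin_left, Rmax_right in Hy by lra. apply legendre_G_deriv. lra.
    - intros y Hy. rewrite Rmin_left, Rmax_right in Hy by lra.
      assert (HcP : continuity_pt P y).
      { apply derive_continuity_pt with (dP y). apply HD; lra. }
      assert (HPy : 0 <= P y - e1).
      { destruct (Rle_lt_or_eq_dec y h) as [Hlt| ->]; [lra| |lra].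
        generalize (Hgt y); lra. }
      apply continuity_pt_minus.
      + apply (continuity_pt_comp (fun x => PI / 2 - atan (sqrt (P x - e1) / lam)) (ellF q));
          [|apply HcF].
        apply continuity_pt_minus; [apply continuity_pt_const; intros ? ?; reflexivity|].
        apply (continuity_pt_comp (fun x => sqrt (P x - e1) / lam) atan).
        * apply continuity_pt_mult; [|apply continuity_pt_const; intros ? ?; reflexivity].
          apply (continuity_pt_comp (fun x => P x - e1) sqrt); [|now apply continuity_pt_sqrt].
          apply continuity_pt_minus; trivial. apply continuity_pt_const; intros ? ?; reflexivity.
        * apply derive_continuity_pt with (1 := is_derive_atan _).
      + apply continuity_pt_mult; [apply continuity_pt_const; intros ? ?; reflexivity|].
        apply derivable_continuous_pt, derivable_pt_id. }
  assert (E : G h = 0).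
  { apply RtoC_inj. apply Cmod_lt_eq0. intros eps He. rewrite Cmod_R.
    destruct (HcF 0 (eps / 2) ltac:(lra)) as [eta [Heta K1]].
    assert (Hat : continuity_pt atan 0) by
      (apply derive_continuity_pt with (1 := is_derive_atan 0)).
    destruct (Hat eta Heta) as [zeta [Hzeta K2]].
    (* [P x > B] makes [sqrt (P x - e1) / lam] exceed [2 / zeta], so the tangent of the amplitude is
       below [zeta]. *)
    set (B := (2 * lam / zeta) * (2 * lam / zeta) + e1).
    destruct (Hinf B) as [d [Hd K3]].
    set (x := Rmin (Rmin (h / 2) (d / 2)) (eps / 2 / lam / 2)).
    assert (Hel : 0 < eps / 2 / lam) by (apply Rdiv_lt_0_compat; lra).
    assert (X1 : x <= h / 2) by (eapply Rle_trans; [apply Rmin_l|apply Rmin_l]).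
    assert (X2 : x <= d / 2) by (eapply Rle_trans; [apply Rmin_l|apply Rmin_r]).
    assert (X3 : x <= eps / 2 / lam / 2) by apply Rmin_r.
    assert (X0 : 0 < x) by (repeat apply Rmin_glb_lt; lra).
    rewrite (HGh x) by lra.
    specialize (K3 x ltac:(lra)).
    assert (Hzl : 0 < 2 * lam / zeta) by (apply Rdiv_lt_0_compat; lra).
    assert (Hs : 2 * lam / zeta < sqrt (P x - e1)).
    { rewrite <- (sqrt_square (2 * lam / zeta)) by lra. apply sqrt_lt_1_alt.
      split; [nra|]. unfold B in K3. lra. }
    set (y := sqrt (P x - e1) / lam).
    assert (Hy : 2 / zeta < y).
    { unfold y. apply Rmult_lt_reg_r with lam; trivial.
      replace (sqrt (P x - e1) / lam * lam) with (sqrt (P x - e1)) by (field; lra).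
      replace (2 / zeta * lam) with (2 * lam / zeta) by (field; lra). lra. }
    assert (Hz2 : 0 < 2 / zeta) by (apply Rdiv_lt_0_compat; lra).
    assert (Hy0 : 0 < y) by lra.
    assert (Hyi : 0 < / y < zeta).
    { split; [now apply Rinv_0_lt_compat|].
      apply Rle_lt_trans with (/ (2 / zeta)); [apply Rinv_le_contravar; lra|].
      replace (/ (2 / zeta)) with (zeta / 2) by (field; lra). lra. }
    assert (Hphi : Rabs (atan (/ y)) < eta).
    { specialize (K2 (/ y)). simpl in K2. unfold R_dist in K2.
      rewrite atan_0, !Rminus_0_r in K2. apply K2.
      split; [split; [exact I|lra]|]. rewrite Rabs_right; lra. }
    assert (HF : Rabs (ellF q (atan (/ y))) < eps / 2).
    { destruct (Req_dec (atan (/ y)) 0) as [E0|E0].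
      - rewrite E0, ellF_0, Rabs_R0. lra.
      - specialize (K1 (atan (/ y))). simpl in K1. unfold R_dist in K1.
        rewrite ellF_0, !Rminus_0_r in K1. apply K1.
        split; [split; [exact I|auto]|trivial]. }
    unfold G. fold y. rewrite <- atan_inv by trivial.
    eapply Rle_lt_trans; [apply Rabs_triang|]. rewrite Rabs_Ropp, (Rabs_right (lam * x)).
    2: { apply Rle_ge, Rmult_le_pos; lra. }
    assert (lam * x < eps / 2).
    { replace (eps / 2) with (lam * (eps / 2 / lam)) by (field; lra).
      apply Rmult_lt_compat_l; lra. }
    lra. }
  unfold G in E. rewrite HPh in E.
  replace (e1 - e1) with 0 in E by ring. rewrite sqrt_0 in E.
  replace (0 / lam) with 0 in E by (field; lra). rewrite atan_0, Rminus_0_r, ellF_PI2 in E.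
  lra.
Qed.

End Legendre.

Lemma compl_decreasing s t : 0 < s < t -> t < 1 ->
  0 <= sqrt (1 - t ^ 2) < sqrt (1 - s ^ 2) /\ sqrt (1 - s ^ 2) < 1.
Proof.
  intros Hst Ht. split; [split; [apply sqrt_pos|apply sqrt_lt_1_alt; nra]|].
  rewrite <- sqrt_1 at 2. apply sqrt_lt_1_alt. nra.
Qed.

(** If [x < k], monotonicity of K forces [lam < 1] in the first equation, while the complementary
    moduli are ordered the other way and force [lam > 1] in the second; [x > k] is symmetric. One
    equation alone would not separate [x] from [lam]. *)
Lemma ellK_ratio_inj k x lam : 0 < k < 1 -> 0 < x < 1 ->
  lam * ellK k = ellK x ->
  lam * ellK (sqrt (1 - k ^ 2)) = ellK (sqrt (1 - x ^ 2)) -> x = k /\ lam = 1.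
Proof.
  intros Hk Hx E1 E2.
  assert (Pk : 0 < ellK k) by (apply ellK_pos; lra).
  destruct (Rtotal_order x k) as [H|[->|H]].
  - destruct (compl_decreasing x k) as [C1 C2]; [lra|lra|].
    assert (P2 := ellK_pos (sqrt (1 - k ^ 2)) ltac:(lra)).
    assert (A1 := ellK_increasing x k ltac:(lra) ltac:(lra)).
    assert (A2 := ellK_increasing _ _ C1 C2). nra.
  - split; trivial. apply Rmult_eq_reg_r with (ellK k); lra.
  - destruct (compl_decreasing k x) as [C1 C2]; [lra|lra|].
    assert (P2 := ellK_pos (sqrt (1 - k ^ 2)) ltac:(lra)).
    assert (A1 := ellK_increasing k x ltac:(lra) ltac:(lra)).
    assert (A2 := ellK_increasing _ _ C1 C2). nra.
Qed.

(** * Half-period values *)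

Lemma C_of_real (z : C) : Im z = 0 -> z = RtoC (Re z).
Proof. intros H. apply injective_projections; simpl; trivial. Qed.

Section Direction.
Variables a b : R.
Hypothesis Ha : 0 < a.
Hypothesis Hb : 0 < b.
Notation L := (rect_lattice a b).
Notation W := (wpR a b).

Variables (d : C) (sg l E1 E2 E3 : R).
Hypothesis Hd : (d * d)%C = RtoC sg.
Hypothesis Hsg : sg * sg = 1.
Hypothesis Hd1 : Cmod d = 1.
Hypothesis Hl : 0 < l.
Let path (s : R) : C := (0 + s * d)%C.
Hypothesis Hend : ~ L (path l).
Hypothesis Hmid : forall s, 0 < s < l -> ~ L (path s + path s)%C.
Hypothesis Hreal : forall s, 0 < s < l -> Im (W (path s)) = 0.
Hypothesis He1 : W (half1 a) = RtoC E1.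
Hypothesis He2 : W (half2 b) = RtoC E2.
Hypothesis He3 : W (half3 a b) = RtoC E3.

(** Treats the real axis ([d = 1]) and the imaginary axis ([d = Ci]) together: near 0, W(s d)
    behaves like 1/(s^2 sg), and the factor [sg] makes the pole positive in both cases. *)
Definition ray_value (s : R) : R := sg * Re (W (0 + s * d)%C).
Definition ray_deriv (s : R) : R := sg * Re (C_derive W (0 + s * d)%C * d).
Notation P := ray_value.
Notation dP := ray_deriv.

Lemma path_not s : 0 < s <= l -> ~ L (path s).
Proof.
  intros Hs. destruct (Req_dec s l) as [->|Hne]; trivial.
  apply (not_half_lattice a b). apply Hmid. lra.
Qed.

Lemma ray_is_derive s : 0 < s <= l -> is_derive P s (dP s).
Proof.
  intros Hs. apply (is_derive_scal (fun s : R => Re (W (0 + s * d)%C))).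
  apply hol_at_curve_Re. now apply wpR_hol; [| |apply path_not].
Qed.

(** As [W] is real along the ray, so is its derivative along it, [C_derive W * d]. Its real part can
    then be squared as a complex number, which contributes the factor d^2 = sg. *)
Lemma ray_ode s : 0 < s < l ->
  dP s ^ 2 = 4 * ((P s - sg * E1) * (P s - sg * E2) * (P s - sg * E3)).
Proof.
  intros Hs. set (z := (C_derive W (path s) * d)%C).
  assert (HL : ~ L (path s)) by (apply path_not; lra).
  assert (Hz : Im z = 0).
  { assert (D : is_derive (fun s : R => Im (W (0 + s * d)%C)) s (Im z)).
    { apply hol_at_curve_Im. now apply wpR_hol. }
    assert (D0 : is_derive (fun s : R => Im (W (0 + s * d)%C)) s 0).
    { apply (is_derive_ext_loc (fun _ => 0)).
      - assert (Hr : 0 < Rmin s (l - s)) by (apply Rmin_glb_lt; lra).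
        exists (mkposreal _ Hr). intros t Ht. symmetry. apply Hreal.
        change (Rabs (t - s) < Rmin s (l - s)) in Ht.
        generalize (Rmin_l s (l - s)) (Rmin_r s (l - s)). apply Rabs_def2 in Ht. lra.
      - apply (is_derive_const (V := R_NormedModule)). }
    rewrite <- (is_derive_unique _ _ _ D). now apply is_derive_unique. }
  apply C_of_real in Hz.
  assert (HW := C_of_real _ (Hreal s Hs)).
  set (w := Re (W (path s))) in *. set (r := Re z) in *.
  assert (Hr : r ^ 2 = sg * (4 * ((w - E1) * (w - E2) * (w - E3)))).
  { apply RtoC_inj.
    assert (E : (z * z = (C_derive W (path s) ^ 2) * (d * d))%C) by (unfold z; simpl; ring).
    rewrite (wp_ode a b Ha Hb (path s) (Hmid s Hs)), Hd, He1, He2, He3, HW, Hz in E.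
    rewrite !RtoC_mult, !RtoC_minus, RtoC_pow. simpl.
    replace (r * (r * 1))%C with (r * r)%C by ring. rewrite E. ring. }
  unfold ray_deriv, ray_value. change (0 + s * d)%C with (path s). fold z r w.
  replace ((sg * r) ^ 2) with (sg * sg * r ^ 2) by ring. rewrite Hsg, Hr.
  replace (4 * ((sg * w - sg * E1) * (sg * w - sg * E2) * (sg * w - sg * E3)))
    with (sg * sg * (sg * (4 * ((w - E1) * (w - E2) * (w - E3))))) by ring.
  rewrite Hsg. ring.
Qed.

Lemma ray_blowup B : exists del, 0 < del /\ forall s, 0 < s < del -> B < P s.
Proof.
  destruct (wp_reg_bounded_near0 a b Ha Hb) as [r [M [Hr [HM N]]]].
  set (Q := Rabs B + M + 1).
  assert (HQ : 1 <= Q) by (unfold Q; generalize (Rabs_pos B); lra).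
  exists (Rmin r (/ Q)). split; [apply Rmin_glb_lt; trivial; apply Rinv_0_lt_compat; lra|].
  intros s [Hs0 Hs].
  assert (S1 : s < r) by split_min.
  assert (S2 : s < / Q) by split_min.
  assert (Hpath : Cmod (path s) < r).
  { unfold path. replace (0 + s * d)%C with (s * d)%C by ring.
    rewrite Cmod_mult, Hd1, Cmod_R, Rabs_right; lra. }
  destruct (N (path s) Hpath) as [N1 _].
  assert (Hsgne : sg <> 0) by nra.
  assert (HE : P s = / s * / s + sg * Re (wp_reg a b (path s))).
  { unfold ray_value. change (0 + s * d)%C with (path s). rewrite wpR_reg.
    replace (path s * path s)%C with (RtoC (s * s * sg)).
    2: { unfold path. rewrite !RtoC_mult, <- Hd. ring. }
    replace (Re (1 / RtoC (s * s * sg) + wp_reg a b (path s)))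
      with (/ (s * s * sg) + Re (wp_reg a b (path s))).
    2: { unfold Re; simpl. field. repeat split; lra. }
    rewrite Rmult_plus_distr_l. f_equal. field. split; lra. }
  assert (Hre : Rabs (sg * Re (wp_reg a b (path s))) <= M).
  { rewrite Rabs_mult.
    assert (Rabs sg = 1).
    { assert (Hs2 : (sg - 1) * (sg + 1) = 0) by lra.
      apply Rmult_integral in Hs2. destruct Hs2 as [Hs2|Hs2].
      - replace sg with 1 by lra. apply Rabs_R1.
      - replace sg with (- (1)) by lra. rewrite Rabs_Ropp. apply Rabs_R1. }
    rewrite H, Rmult_1_l. eapply Rle_trans; [apply re_le_Cmod|exact N1]. }
  assert (Hinv : Q < / s).
  { rewrite <- (Rinv_inv Q). apply Rinv_lt_contravar; trivial.
    apply Rmult_lt_0_compat; trivial. apply Rinv_0_lt_compat; lra. }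
  rewrite HE. generalize (Rle_abs B) (Rle_abs (- (sg * Re (wp_reg a b (path s))))).
  rewrite Rabs_Ropp. unfold Q in *. nra.
Qed.

Lemma ray_cont s : 0 < s <= l -> continuity_pt P s.
Proof. intros Hs. eapply derive_continuity_pt. now apply ray_is_derive. Qed.

(** [P] starts at plus infinity and, before the half period, never equals a root, since [W] differs
    from the three values off the half lattice; the intermediate value theorem keeps it above each
    root. *)
Lemma ray_gt s E : 0 < s < l -> E = E1 \/ E = E2 \/ E = E3 -> sg * E < P s.
Proof.
  intros Hs HE.
  assert (Hne : forall t, 0 < t < l -> P t <> sg * E).
  { intros t Ht Heq.
    destruct (wp_neq_e a b Ha Hb (path t) (Hmid t Ht)) as [N1 [N2 N3]].
    rewrite He1 in N1. rewrite He2 in N2. rewrite He3 in N3.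
    assert (HW := C_of_real _ (Hreal t Ht)).
    assert (EE : Re (W (path t)) = E).
    { unfold ray_value in Heq. fold (path t) in Heq.
      replace (Re (W (path t))) with (sg * sg * Re (W (path t))) by (rewrite Hsg; ring).
      rewrite Rmult_assoc, Heq, <- Rmult_assoc, Hsg. ring. }
    rewrite EE in HW.
    destruct HE as [->|[->| ->]]; congruence. }
  destruct (Rtotal_order (sg * E) (P s)) as [H|[H|H]]; trivial.
  { exfalso. now apply (Hne s Hs). }
  exfalso. destruct (ray_blowup (sg * E)) as [del [Hdel K]].
  set (t := Rmin (del / 2) (s / 2)).
  assert (Ht : 0 < t /\ t < del /\ t < s).
  { unfold t. generalize (Rmin_l (del / 2) (s / 2)) (Rmin_r (del / 2) (s / 2)).
    assert (0 < Rmin (del / 2) (s / 2)) by (apply Rmin_glb_lt; lra). lra. }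
  specialize (K t ltac:(lra)).
  destruct (IVT_interv (fun x => sg * E - P x) t s) as [z [Hz1 Hz2]]; try lra.
  - intros x Hx. apply continuity_pt_minus; [apply continuity_pt_const; intros ? ?; reflexivity|].
    apply ray_cont. lra.
  - apply (Hne z); lra.
Qed.

Lemma ray_end_ge E : E = E1 \/ E = E2 \/ E = E3 -> sg * E <= P l.
Proof.
  intros HE. apply Rnot_lt_le. intros Hlt.
  destruct (ray_cont l ltac:(lra) (sg * E - P l) ltac:(lra)) as [del [Hdel K]].
  set (s := l - Rmin (del / 2) (l / 2)).
  assert (Hs : 0 < s < l /\ l - s < del).
  { unfold s. generalize (Rmin_l (del / 2) (l / 2)) (Rmin_r (del / 2) (l / 2)).
    assert (0 < Rmin (del / 2) (l / 2)) by (apply Rmin_glb_lt; lra). lra. }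
  specialize (K s). simpl in K. unfold R_dist in K.
  assert (HK : Rabs (P s - P l) < sg * E - P l).
  { apply K. split; [split; [exact I|lra]|]. rewrite Rabs_left; lra. }
  generalize (ray_gt s E (proj1 Hs) HE). apply Rabs_def2 in HK. lra.
Qed.

(** The roots are passed in sorted order because multiplication by [sg = - (1)] reverses it; the
    polynomial identity in [X] records that only the order has changed. *)
Lemma ray_period top bot mid :
  P l = top -> bot < mid -> mid < top ->
  (top = sg * E1 \/ top = sg * E2 \/ top = sg * E3) ->
  (forall X, (X - sg * E1) * (X - sg * E2) * (X - sg * E3)
    = (X - top) * (X - bot) * (X - mid)) ->
  sqrt (top - bot) * l = ellK (sqrt ((mid - bot) / (top - bot))).
Proof.
  intros Htop H1 H2 H3 HX.
  apply (legendre_period P dP l top bot mid); trivial.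
  - intros x Hx. now apply ray_is_derive.
  - intros x Hx. rewrite ray_ode by trivial. now rewrite HX.
  - intros x Hx. destruct H3 as [->|[->| ->]]; apply ray_gt; tauto.
  - exact ray_blowup.
Qed.

End Direction.

(** * Order and differences of the three half-period values *)

Section Values.
Variables a b : R.
Hypothesis Ha : 0 < a.
Hypothesis Hb : 0 < b.
Notation L := (rect_lattice a b).
Notation W := (wpR a b).
Notation h1 := (half1 a).
Notation h2 := (half2 b).
Notation h3 := (half3 a b).

Lemma wpR_real (u w : C) : ~ L u -> L w -> Cconj u = (u + w)%C \/ Cconj u = (- u + w)%C ->
  Im (W u) = 0.
Proof.
  intros Hu Hw H.
  assert (E : W (Cconj u) = W u).
  { destruct H as [->| ->].
    - now apply wpR_period.
    - rewrite wpR_period; trivial; [now apply wpR_even|now apply not_lattice_opp]. }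
  rewrite wpR_conj in E by trivial.
  apply (f_equal Im) in E. rewrite im_conj in E. lra.
Qed.

Definition wp_root1 : R := Re (W h1).
Definition wp_root2 : R := Re (W h2).
Definition wp_root3 : R := Re (W h3).

Notation E1 := wp_root1.
Notation E2 := wp_root2.
Notation E3 := wp_root3.

Lemma wp_E1 : W h1 = RtoC E1.
Proof.
  apply C_of_real. apply (wpR_real h1 0); [apply half1_not; trivial|apply rect_lattice_0|].
  left. C_ring.
Qed.

Lemma wp_E2 : W h2 = RtoC E2.
Proof.
  apply C_of_real. apply (wpR_real h2 0); [apply half2_not; trivial|apply rect_lattice_0|].
  right. C_ring.
Qed.

Lemma wp_E3 : W h3 = RtoC E3.
Proof.
  apply C_of_real. apply (wpR_real h3 (0, - b)); [apply half3_not; trivial| |].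
  - apply rect_lattice_iff. exists 0%Z, (-1)%Z. C_ring.
  - left. C_field.
Qed.

Lemma IZR_not_between (m : Z) (x t : R) : 0 < x -> 0 < t < x -> t = IZR m * x -> False.
Proof.
  intros Hx Ht E.
  assert (0 < IZR m) by nra. assert (IZR m < 1) by nra.
  apply lt_IZR in H. apply lt_IZR in H0. lia.
Qed.

Lemma real_ray_facts :
  ~ L (0 + (a / 2)%R * 1)%C /\
  (forall s : R, 0 < s < a / 2 -> ~ L ((0 + s * 1) + (0 + s * 1))%C) /\
  (forall s : R, 0 < s < a / 2 -> Im (W (0 + s * 1)%C) = 0).
Proof.
  assert (H : forall s : R, 0 < s < a / 2 -> ~ L ((0 + s * 1) + (0 + s * 1))%C).
  { intros s Hs HL. apply rect_lattice_iff in HL. destruct HL as [m [n E]].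
    apply (f_equal fst) in E. simpl in E.
    apply (IZR_not_between m a (2 * s)); lra. }
  split; [|split; trivial].
  - replace (0 + (a / 2)%R * 1)%C with h1 by (C_ring).
    now apply half1_not.
  - intros s Hs. apply (wpR_real _ 0).
    + now apply (not_half_lattice a b), H.
    + apply rect_lattice_0.
    + left. C_ring.
Qed.

Lemma imag_ray_facts :
  ~ L (0 + (b / 2)%R * Ci)%C /\
  (forall s : R, 0 < s < b / 2 -> ~ L ((0 + s * Ci) + (0 + s * Ci))%C) /\
  (forall s : R, 0 < s < b / 2 -> Im (W (0 + s * Ci)%C) = 0).
Proof.
  assert (H : forall s : R, 0 < s < b / 2 -> ~ L ((0 + s * Ci) + (0 + s * Ci))%C).
  { intros s Hs HL. apply rect_lattice_iff in HL. destruct HL as [m [n E]].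
    apply (f_equal snd) in E. simpl in E.
    apply (IZR_not_between n b (2 * s)); lra. }
  split; [|split; trivial].
  - replace (0 + (b / 2)%R * Ci)%C with h2 by (C_ring).
    now apply half2_not.
  - intros s Hs. apply (wpR_real _ 0).
    + now apply (not_half_lattice a b), H.
    + apply rect_lattice_0.
    + right. C_ring.
Qed.

(** The real ray ends at [E1] without dropping below [E3]; the imaginary ray, where signs are
    reversed, ends at [- E2], not below [- E3]. Strictness comes from distinctness. *)
Lemma E_order : E2 < E3 /\ E3 < E1.
Proof.
  destruct real_ray_facts as [R1 [R2 R3]]. destruct imag_ray_facts as [I1 [I2 I3]].
  assert (H11 : (1 * 1)%C = RtoC 1) by ring.
  assert (Hii : (Ci * Ci)%C = RtoC (- (1))) by (C_ring).
  assert (A := ray_end_ge a b Ha Hb 1 1 (a / 2) E1 E2 E3 H11 ltac:(ring) Cmod_1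
    ltac:(lra) R1 R2 R3 wp_E1 wp_E2 wp_E3 E3 ltac:(tauto)).
  assert (B := ray_end_ge a b Ha Hb Ci (- (1)) (b / 2) E1 E2 E3 Hii ltac:(ring) Cmod_Ci
    ltac:(lra) I1 I2 I3 wp_E1 wp_E2 wp_E3 E3 ltac:(tauto)).
  unfold ray_value in A, B.
  replace (0 + (a / 2)%R * 1)%C with h1 in A by (C_ring).
  replace (0 + (b / 2)%R * Ci)%C with h2 in B by (C_ring).
  fold E1 in A. fold E2 in B.
  destruct (wp_e_distinct a b Ha Hb) as [D1 [D2 D3]].
  rewrite wp_E1, wp_E2 in *. rewrite wp_E3 in *.
  assert (E1 <> E3) by (intros E; apply D2; now rewrite E).
  assert (E2 <> E3) by (intros E; apply D3; now rewrite E).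
  lra.
Qed.

Lemma E_periods :
  let lam := sqrt (E1 - E2) in let q := sqrt ((E3 - E2) / (E1 - E2)) in
  0 < lam /\ lam * lam = E1 - E2 /\ 0 < q < 1 /\ q ^ 2 = (E3 - E2) / (E1 - E2) /\
  lam * (a / 2) = ellK q /\ lam * (b / 2) = ellK (sqrt (1 - q ^ 2)).
Proof.
  destruct E_order as [O1 O2]. intros lam q.
  destruct real_ray_facts as [R1 [R2 R3]]. destruct imag_ray_facts as [I1 [I2 I3]].
  assert (H11 : (1 * 1)%C = RtoC 1) by ring.
  assert (Hii : (Ci * Ci)%C = RtoC (- (1))) by (C_ring).
  destruct (legendre_lam E1 E2 E3 O1 O2) as [Hl1 Hl2].
  destruct (legendre_modulus E1 E2 E3 O1 O2) as [Hq1 Hq2].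
  fold lam in Hl1, Hl2. fold q in Hq1, Hq2.
  split; trivial. split; trivial.
  split. { split; [|lra]. apply sqrt_lt_R0, Rdiv_lt_0_compat; lra. }
  split; trivial. split.
  - apply (ray_period a b Ha Hb 1 1 (a / 2) E1 E2 E3 H11 ltac:(ring) Cmod_1
      ltac:(lra) R1 R2 R3 wp_E1 wp_E2 wp_E3); trivial.
    + unfold ray_value.
      replace (0 + (a / 2)%R * 1)%C with h1 by (C_ring).
      fold E1. ring.
    + left; ring.
    + intros; ring.
  (* On the imaginary axis the sorted roots are [- E2], [- E3], [- E1]. The squared modulus is then
     (E1 - E3)/(E1 - E2) = 1 - q^2, the complementary one. *)
  - assert (K := ray_period a b Ha Hb Ci (- (1)) (b / 2) E1 E2 E3 Hii ltac:(ring) Cmod_Ci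
      ltac:(lra) I1 I2 I3 wp_E1 wp_E2 wp_E3 (- E2) (- E1) (- E3)).
    replace (- E2 - - E1) with (E1 - E2) in K by ring.
    replace (1 - q ^ 2) with ((- E3 - - E1) / (E1 - E2)).
    2: { rewrite Hq2. field. lra. }
    apply K; try lra.
    + unfold ray_value.
      replace (0 + (b / 2)%R * Ci)%C with h2 by (C_ring).
      fold E2. ring.
    + intros; ring.
Qed.

(** Both half periods, computed with modulus [q] and given with modulus [k], yield the two equations
    of [ellK_ratio_inj] with ratio [lam * m], so [q = k] and [lam = / m]. *)
Lemma E_of_modulus k m : 0 < k < 1 -> 0 < m -> a = 2 * m * ellK k ->
  b = 2 * m * ellK (sqrt (1 - k ^ 2)) ->
  E1 - E2 = / (m * m) /\ E3 - E2 = k ^ 2 / (m * m).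
Proof.
  intros Hk Hm Hak Hbk. destruct E_order as [O1 O2].
  destruct E_periods as [P1 [P2 [P3 [P4 [P5 P6]]]]].
  set (lam := sqrt (E1 - E2)) in *. set (q := sqrt ((E3 - E2) / (E1 - E2))) in *.
  destruct (ellK_ratio_inj k q (lam * m) Hk P3) as [Hq Hlm].
  - rewrite <- P5, Hak. field.
  - rewrite <- P6, Hbk. field.
  - assert (HE : E1 - E2 = / (m * m)).
    { rewrite <- P2. replace lam with (lam * m / m) by (field; lra). rewrite Hlm. field. lra. }
    split; trivial. rewrite Hq in P4.
    replace (E3 - E2) with ((E3 - E2) / (E1 - E2) * (E1 - E2)) by (field; lra).
    rewrite <- P4, HE. field. lra.
Qed.

Lemma quarter_line_not (x y : R) : y = b / 4 \/ y = 3 * (b / 4) -> ~ L ((x, y) + (x, y))%C.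
Proof.
  intros Hy HL. apply rect_lattice_iff in HL. destruct HL as [m [n E]].
  apply (f_equal snd) in E. simpl in E.
  assert (E' : IZR (2 * n) = 1 \/ IZR (2 * n) = 3).
  { rewrite mult_IZR. destruct Hy as [-> | ->]; [left|right];
      (apply Rmult_eq_reg_r with (b / 2); [lra|lra]). }
  destruct E' as [E'|E']; apply eq_IZR in E'; lia.
Qed.

(* On these lines complex conjugation is translation by [h2] modulo the lattice. *)
Lemma quarter_line_conj (x y : R) : y = b / 4 \/ y = 3 * (b / 4) ->
  ((W (x, y) - RtoC E2) * Cconj (W (x, y) - RtoC E2) = RtoC ((E2 - E1) * (E2 - E3)))%C.
Proof.
  intros Hy. assert (HN := quarter_line_not x y Hy).
  destruct (not_half_lattice a b _ HN) as [H0 [_ [H2 _]]].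
  assert (E : W (Cconj (x, y)) = W ((x, y) + h2)%C).
  { assert (Hw : exists w, L w /\ Cconj (x, y) = ((x, y) + h2 + w)%C).
    { destruct Hy as [-> | ->].
      - exists (0, - b). split.
        + apply rect_lattice_iff. exists 0%Z, (-1)%Z. C_ring.
        + C_field.
      - exists (0, - (2 * b)). split.
        + apply rect_lattice_iff. exists 0%Z, (-2)%Z. C_ring.
        + C_field. }
    destruct Hw as [w [Hw ->]]. now apply wpR_period. }
  rewrite Cminus_conj, <- (wpR_conj a b) by trivial. rewrite E.
  replace (Cconj (RtoC E2)) with (RtoC E2) by (C_ring).
  generalize (wp_half_product2 a b Ha Hb (x, y) H0 H2).
  rewrite wp_E1, wp_E2, wp_E3. intros ->. now rewrite RtoC_mult, !RtoC_minus.
Qed.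

Lemma wp_ode_E u : ~ L (u + u)%C ->
  (C_derive W u ^ 2 = 4 * ((W u - E1) * (W u - E2) * (W u - E3)))%C.
Proof. intros Hu. rewrite <- wp_E1, <- wp_E2, <- wp_E3. now apply wp_ode. Qed.

Lemma wp_double_E1 u : ~ L (u + u)%C ->
  let p := (4 * ((W u - E1) * (W u - E2) * (W u - E3)))%C in
  let c := ((E1 - E2) * (E1 - E3))%C in
  p <> 0%C /\
  (W (u + u) - E1 = ((W u - E1) * (W u - E1) - c) * ((W u - E1) * (W u - E1) - c) / p)%C.
Proof.
  intros Hu. destruct (wp_double_e a b Ha Hb u Hu) as [Hp [H _]].
  rewrite wp_E1, wp_E2, wp_E3 in Hp, H. split; assumption.
Qed.

End Values.

(** * The area density *)

Section Monopole.
Variable k : R.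
Hypothesis Hk : 0 < k < 1.

Let c := compl_modulus k.
Let a := omega1 k.
Let b := 2 * sqrt (k * c) * ellK c.
Notation W := (wpR a b).
Notation L := (rect_lattice a b).

Lemma compl_modulus_facts : 0 < c < 1 /\ c ^ 2 = 1 - k ^ 2.
Proof.
  assert (H : c ^ 2 = 1 - k ^ 2) by (apply pow2_sqrt; nra).
  split; trivial. assert (0 < c) by (apply sqrt_lt_R0; nra). nra.
Qed.

Lemma sqrt_kc : 0 < sqrt (k * c) /\ sqrt (k * c) * sqrt (k * c) = k * c.
Proof.
  destruct compl_modulus_facts as [Hc _].
  assert (0 < k * c) by (apply Rmult_lt_0_compat; lra).
  split; [now apply sqrt_lt_R0|apply sqrt_sqrt; lra].
Qed.

Lemma omega1_pos : 0 < a.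
Proof.
  unfold a, omega1. fold c. destruct sqrt_kc as [Hs _].
  assert (0 < ellK k) by (apply ellK_pos; lra).
  repeat apply Rmult_lt_0_compat; lra.
Qed.

Lemma omega2_im_pos : 0 < b.
Proof.
  unfold b. destruct sqrt_kc as [Hs _]. destruct compl_modulus_facts as [Hc _].
  assert (0 < ellK c) by (apply ellK_pos; lra).
  repeat apply Rmult_lt_0_compat; lra.
Qed.

Lemma omega2_eq : omega2 k = (Ci * RtoC b)%C.
Proof. unfold omega2, b. fold c. C_ring. Qed.

Lemma Cmod_omega2 : Cmod (omega2 k) = b.
Proof.
  rewrite omega2_eq, Cmod_mult, Cmod_Ci, Cmod_R, Rabs_right; [ring|].
  generalize omega2_im_pos; lra.
Qed.

Lemma wp_eq u : wp k u = W u.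
Proof. unfold wp, wpR. now rewrite omega2_eq. Qed.

Notation E1 := (wp_root1 a b).
Notation E2 := (wp_root2 a b).
Notation E3 := (wp_root3 a b).

Lemma e1_eq : e1 k = RtoC E1.
Proof.
  unfold e1. rewrite wp_eq, <- (wp_E1 a b omega1_pos omega2_im_pos). f_equal.
  fold a. C_field.
Qed.

Lemma e3_eq : e3 k = RtoC E3.
Proof.
  unfold e3. rewrite wp_eq, <- (wp_E3 a b omega1_pos omega2_im_pos). f_equal.
  unfold omega3. rewrite omega2_eq. fold a. C_field.
Qed.

Lemma E_differences : E1 - E2 = / (k * c) /\ E3 - E2 = k / c /\ E1 - E3 = c / k.
Proof.
  destruct sqrt_kc as [Hs Hs2]. destruct compl_modulus_facts as [Hc Hc2].
  destruct (E_of_modulus a b omega1_pos omega2_im_pos k (sqrt (k * c)) Hk Hs) as [H1 H2];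
    [reflexivity|reflexivity|].
  rewrite Hs2 in H1, H2.
  split; [exact H1|]. split.
  - rewrite H2. field. lra.
  - replace (E1 - E3) with ((E1 - E2) - (E3 - E2)) by ring. rewrite H1, H2.
    replace (k ^ 2) with (1 - c ^ 2) by lra. field. lra.
Qed.

(* With [w = wp u - e2], [|w| = 1/c] on the lines considered, which makes both [|wp'|^2] and
   [wp (2u) - e1] rational functions of [w]. *)
Lemma area_density_formula x y : y = b / 4 \/ y = 3 * (b / 4) ->
  let u := (x, y) : C in
  exists g, (1 - k) / c <= g <= (1 + k) / c /\
    area_density k u = 16 * g ^ 2 / (k * c * (1 + g ^ 2) ^ 2) /\
    RtoC (area_density k u) = (- (4 / (k ^ 2 * (wp k (2 * u) - e1 k))))%C.
Proof.
  intros Hy u. destruct compl_modulus_facts as [Hc Hc2].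
  assert (Ha := omega1_pos). assert (Hb := omega2_im_pos).
  assert (Nk : k <> 0) by lra. assert (Nc : c <> 0) by lra.
  assert (Nkc : k * c <> 0) by now apply Rmult_integral_contrapositive_currified.
  assert (Nkk : k * k <> 0) by now apply Rmult_integral_contrapositive_currified.
  destruct E_differences as [D12 [D32 D13]].
  assert (HN : ~ L (u + u)%C) by now apply quarter_line_not.
  destruct (not_half_lattice a b u HN) as [Hu _].
  pose (w := (W u - RtoC E2)%C).
  assert (Hw3 : (W u - RtoC E3 = w - RtoC (k / c))%C).
  { rewrite <- D32, RtoC_minus. unfold w. ring. }
  assert (Hw1 : (W u - RtoC E1 = w - RtoC (/ (k * c)))%C).
  { rewrite <- D12, RtoC_minus. unfold w. ring. }
  (* The product of the differences 1/(k c) and k/c is 1/c^2, so [w] lies on the circle of radius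
     1/c. *)
  assert (Hww : (w * Cconj w)%C = RtoC (/ c ^ 2)).
  { unfold w. unfold u. rewrite (quarter_line_conj a b Ha Hb x y Hy). f_equal.
    replace ((E2 - E1) * (E2 - E3)) with ((E1 - E2) * (E3 - E2)) by ring.
    rewrite D12, D32. field. lra. }
  assert (Hcm : Cmod w ^ 2 = / c ^ 2).
  { apply RtoC_inj. rewrite <- Hww, <- Cmod2_conj. now rewrite RtoC_pow. }
  assert (Hwm : Cmod w = / c).
  { apply Rsqr_inj; [apply Cmod_ge_0|left; apply Rinv_0_lt_compat; lra|].
    rewrite !Rsqr_pow2, Hcm. field. lra. }
  assert (Hw0 : w <> 0%C).
  { apply Cneq_0_of_Cmod. rewrite Hwm. apply Rinv_0_lt_compat; lra. }
  pose (g := Cmod (w - RtoC (k / c))). exists g.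
  assert (Hkc : Cmod (RtoC (k / c)) = k / c).
  { rewrite Cmod_R, Rabs_right; trivial. apply Rle_ge, Rlt_le, Rdiv_lt_0_compat; lra. }
  assert (Hg : (1 - k) / c <= g <= (1 + k) / c).
  { unfold g. generalize (Cmod_minus_le w (RtoC (k / c)))
      (Cmod_minus_triangle w (RtoC (k / c))). rewrite Hwm, Hkc.
    replace ((1 - k) / c) with (/ c - k / c) by (field; lra).
    replace ((1 + k) / c) with (/ c + k / c) by (field; lra). lra. }
  split; trivial.
  assert (Hconj : Cconj w = (/ (RtoC (c ^ 2) * w))%C).
  { assert (Hc0 : RtoC (c ^ 2) <> 0%C) by (intros E; apply RtoC_inj in E; nra).
    transitivity (w * Cconj w / w)%C; [field; trivial|].
    rewrite Hww, RtoC_inv by nra. field. auto. }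
  assert (Hg2 : RtoC (g ^ 2)
    = ((w - RtoC (k / c)) * (/ (RtoC (c ^ 2) * w) - RtoC (k / c)))%C).
  { unfold g. rewrite Cmod2_conj, Cminus_conj, Hconj.
    f_equal. f_equal. C_ring. }
  (* The points k/c and 1/(k c) have product 1/c^2, so they are inverse in the circle carrying [w];
     the ratio of the distances to them is constant on it (circle of Apollonius), and equals [k]. *)
  assert (Hg1 : Cmod (w - RtoC (/ (k * c))) = g / k).
  { assert (E : Cmod (w - RtoC (/ (k * c))) ^ 2 = (g / k) ^ 2).
    { apply RtoC_inj. unfold Rdiv. rewrite Rpow_mult_distr, RtoC_mult, Hg2.
      rewrite Cmod2_conj, Cminus_conj, Hconj.
      replace (Cconj (RtoC (/ (k * c)))) with (RtoC (/ (k * c)))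
        by (C_ring).
      unfold Rdiv. rewrite !RtoC_pow, !RtoC_mult, !RtoC_inv, !RtoC_mult by assumption.
      assert (Hk0 : RtoC k <> 0%C) by (intros E; apply RtoC_inj in E; lra).
      assert (Hc0 : RtoC c <> 0%C) by (intros E; apply RtoC_inj in E; lra).
      field. auto. }
    rewrite <- !Rsqr_pow2 in E. apply Rsqr_inj in E; trivial; [apply Cmod_ge_0|].
    apply Rmult_le_pos; [apply Cmod_ge_0|left; apply Rinv_0_lt_compat; lra]. }
  assert (HA : area_density k u = 16 * g ^ 2 / (k * c * (1 + g ^ 2) ^ 2)).
  { unfold area_density.
    assert (Hgm : gauss_map k u = (w - RtoC (k / c))%C).
    { unfold gauss_map. rewrite wp_eq, e3_eq. exact Hw3. }
    assert (Hder : C_derive (gauss_map k) u = C_derive W u).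
    { destruct (hol_at_plus_deriv W (fun _ => - e3 k)%C u (wpR_hol a b Ha Hb u Hu)
        (hol_at_const _ _)) as [P1 P2].
      destruct (hol_at_ext_deriv _ (gauss_map k) u 1 Rlt_0_1
        (fun v _ => f_equal (fun z => z + - e3 k)%C (eq_sym (wp_eq v))) P1) as [_ Q2].
      rewrite Q2, P2, (proj2 (hol_at_const_deriv _ _)). ring. }
    rewrite Hder, Hgm. fold g.
    (* The differential equation gives |W'|^2 = 4 (g / k) (1 / c) g, hence the numerator 16 g^2 / (k
       c) of the density. *)
    rewrite <- Cmod_pow, (wp_ode_E a b Ha Hb u HN), Hw1, Hw3. fold w.
    rewrite !Cmod_mult, Hg1, Hwm. fold g.
    replace (Cmod 4) with 4 by (rewrite Cmod_R, Rabs_right; lra).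
    field. assert (0 <= g ^ 2) by apply pow2_ge_0. repeat split; lra. }
  split; [exact HA|].
  rewrite HA, wp_eq, e1_eq.
  replace (2 * u)%C with (u + u)%C by ring.
  destruct (wp_double_E1 a b Ha Hb u HN) as [Hp HE].
  rewrite HE, Hw1, Hw3. rewrite Hw1, Hw3 in Hp. fold w in Hp |- *. clear HE.
  replace ((RtoC E1 - RtoC E2) * (RtoC E1 - RtoC E3))%C with (/ (RtoC k * RtoC k))%C.
  2: { rewrite <- !RtoC_minus, D12, D13, <- !RtoC_mult, <- RtoC_inv by assumption.
       f_equal. field. lra. }
  set (G2 := g ^ 2) in *.
  assert (HG : 0 < 1 + G2) by (unfold G2; generalize (pow2_ge_0 g); lra).
  unfold Rdiv in Hg2.
  assert (Hk0 : RtoC k <> 0%C) by (intros E; apply RtoC_inj in E; lra).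
  assert (Hc0 : RtoC c <> 0%C) by (intros E; apply RtoC_inj in E; lra).
  (* The relation c^2 + k^2 = 1 enters as an explicit vanishing correction, so that [field] can
     treat [K], [Cc] and [w] as independent. *)
  assert (Hrel : (RtoC c * RtoC c + RtoC k * RtoC k - 1 = 0)%C).
  { rewrite <- !RtoC_mult, <- RtoC_plus, <- RtoC_minus. f_equal. lra. }
  rewrite RtoC_pow, RtoC_mult, RtoC_inv in Hg2 by assumption.
  assert (Nden : k * c * (1 + G2) ^ 2 <> 0).
  { apply Rmult_integral_contrapositive_currified; trivial. apply pow_nonzero. lra. }
  unfold Rdiv in Hp |- *. rewrite !RtoC_mult, !RtoC_inv, !RtoC_mult, !RtoC_pow by assumption.
  rewrite !RtoC_mult, !RtoC_inv, !RtoC_mult in Hp by assumption.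
  set (K := RtoC k) in *. set (Cc := RtoC c) in *.
  (* [D] is the common factor: 1 + g^2 = D/(c^3 w), and the quantity squared in the duplication
     formula is -D/(k c^2). Both appear squared in the claim, so [D] cancels. *)
  pose (D := (2 * Cc * w - K * (Cc * Cc * (w * w) + 1))%C).
  assert (R1 : RtoC (1 + G2) = (D / (Cc * Cc * Cc * w))%C).
  { rewrite RtoC_plus, Hg2.
    transitivity (D / (Cc * Cc * Cc * w) + (Cc * Cc + K * K - 1) / (Cc * Cc))%C.
    - unfold D. field. auto.
    - rewrite Hrel. field. auto. }
  assert (HD : D <> 0%C).
  { intros E. rewrite E in R1. replace (0 / (Cc * Cc * Cc * w))%C with (RtoC 0) in R1
      by (field; auto).
    apply RtoC_inj in R1. lra. }
  assert (R2 : ((w - / (K * Cc)) * (w - / (K * Cc)) - / (K * K) = - (D / (K * (Cc * Cc))))%C).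
  { transitivity (- (D / (K * (Cc * Cc))) - (Cc * Cc + K * K - 1) / (K * K * (Cc * Cc)))%C.
    - unfold D. field. auto.
    - rewrite Hrel. field. auto. }
  rewrite R2, R1, Hg2. fold K Cc in Hp. clearbody D.
  apply Cmult_neq0_inv in Hp. destruct Hp as [_ Hp].
  apply Cmult_neq0_inv in Hp. destruct Hp as [Hp N3].
  apply Cmult_neq0_inv in Hp. destruct Hp as [N1 _].
  assert (N1' : (w * (K * Cc) - 1)%C <> 0%C).
  { intros E. apply N1. transitivity ((w * (K * Cc) - 1) / (K * Cc))%C; [field; auto|].
    rewrite E. field. auto. }
  assert (N3' : (w * Cc - K)%C <> 0%C).
  { intros E. apply N3. transitivity ((w * Cc - K) / Cc)%C; [field; auto|].
    rewrite E. field. auto. }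
  field. repeat split; trivial.
Qed.

(** The scaling factor b^2 = 4 k c K(c)^2 cancels the denominator k c and leaves 16 K(c)^2 times
    4t/(1 + t)^2 with t = g^2. As t lies between (1 - k)/(1 + k) and its inverse, the last factor is
    at least 1 - k^2, its value at both ends. *)
Lemma area_density2_lower x y : y = 1 / 4 \/ y = 3 * (1 / 4) ->
  16 * ellK c ^ 2 * (1 - k ^ 2) <= area_density2 k (x, y).
Proof.
  intros Hy. destruct compl_modulus_facts as [Hc Hc2]. assert (Hb := omega2_im_pos).
  destruct sqrt_kc as [Hs Hs2].
  unfold area_density2. rewrite Cmod_omega2.
  replace (RtoC b * (x, y))%C with ((b * x, b * y) : C)
    by (C_ring).
  destruct (area_density_formula (b * x) (b * y)) as [g [Hg [HA _]]].
  { destruct Hy as [-> | ->]; [left|right]; field. }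
  rewrite HA. set (t := g ^ 2).
  assert (Hkc : 0 < k * c) by (apply Rmult_lt_0_compat; lra).
  assert (Hg0 : 0 < (1 - k) / c) by (apply Rdiv_lt_0_compat; lra).
  assert (Ht1 : (1 - k) / (1 + k) <= t).
  { replace ((1 - k) / (1 + k)) with (((1 - k) / c) ^ 2).
    - apply pow_incr. lra.
    - unfold Rdiv. rewrite Rpow_mult_distr, pow_inv, Hc2. field.
      split; [lra|nra]. }
  assert (Ht2 : t <= (1 + k) / (1 - k)).
  { replace ((1 + k) / (1 - k)) with (((1 + k) / c) ^ 2).
    - apply pow_incr. lra.
    - unfold Rdiv. rewrite Rpow_mult_distr, pow_inv, Hc2. field.
      split; [lra|nra]. }
  assert (Ht0 : 0 < t).
  { eapply Rlt_le_trans; [|exact Ht1]. apply Rdiv_lt_0_compat; lra. }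
  assert (T1 : 0 <= (1 + k) * t - (1 - k)).
  { apply (Rmult_le_compat_l (1 + k)) in Ht1; [|lra].
    replace ((1 + k) * ((1 - k) / (1 + k))) with (1 - k) in Ht1 by (field; lra). lra. }
  assert (T2 : 0 <= (1 + k) - (1 - k) * t).
  { apply (Rmult_le_compat_l (1 - k)) in Ht2; [|lra].
    replace ((1 - k) * ((1 + k) / (1 - k))) with (1 + k) in Ht2 by (field; lra). lra. }
  assert (T3 : (1 - k ^ 2) * (1 + t) ^ 2 <= 4 * t).
  (* The product of the two nonnegative quantities is exactly 4t - (1 - k^2)(1 + t)^2. *)
  { generalize (Rmult_le_pos _ _ T1 T2). intros T. nra. }
  replace (b ^ 2 * (16 * t / (k * c * (1 + t) ^ 2)))
    with (16 * ellK c ^ 2 * (4 * t / (1 + t) ^ 2)).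
  2: { unfold b. replace ((2 * sqrt (k * c) * ellK c) ^ 2)
         with (4 * (sqrt (k * c) * sqrt (k * c)) * ellK c ^ 2) by ring.
       rewrite Hs2. field. repeat split; lra. }
  apply Rmult_le_compat_l.
  { apply Rmult_le_pos; [lra|apply pow2_ge_0]. }
  assert (Hp : 0 < (1 + t) ^ 2) by (apply pow_lt; lra).
  apply Rmult_le_reg_r with ((1 + t) ^ 2); trivial.
  replace (4 * t / (1 + t) ^ 2 * (1 + t) ^ 2) with (4 * t) by (field; lra). exact T3.
Qed.

Lemma area_density_on_hseg u : hseg k (1 / 4) u \/ hseg k (3 / 4) u ->
  RtoC (area_density k u) = (- (4 / (k ^ 2 * (wp k (2 * u) - e1 k))))%C.
Proof.
  intros Hu.
  assert (H : exists x y, u = (x, y) /\ (y = b / 4 \/ y = 3 * (b / 4))).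
  { destruct Hu as [[x [_ ->]]|[x [_ ->]]].
    - exists x, (b / 4). split; [|now left].
      rewrite omega2_eq. C_field.
    - exists x, (3 * (b / 4)). split; [|now right].
      rewrite omega2_eq. C_field. }
  destruct H as [x [y [-> Hy]]].
  now destruct (area_density_formula x y Hy) as [g [_ [_ H]]].
Qed.

End Monopole.

Theorem corollary8p5 :
  (forall k : R, 0 < k < 1 ->
   forall u : C, hseg k (1 / 4) u \/ hseg k (3 / 4) u ->
     RtoC (area_density k u) = (- (4 / (k ^ 2 * (wp k (2 * u) - e1 k))))%C)
  /\
  (forall M : R, 0 < M ->
   exists kM : R, 0 < kM /\
     forall k : R, 0 < k < 1 -> k < kM ->
     forall z : C, hseg' k (1 / 4) z \/ hseg' k (3 / 4) z ->
       area_density2 k z > M).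
Proof.
  split; [exact area_density_on_hseg|].
  (* The exponential gives K(k') >= - ln k >= M + 1, and k < 1/2 gives 1 - k^2 >= 3/4. The lower
     bound is then at least 12 (M + 1)^2, which exceeds M. *)
  intros M HM. exists (Rmin (1 / 2) (exp (- (M + 1)))).
  split; [apply Rmin_glb_lt; [lra|apply exp_pos]|].
  intros k Hk HkM z Hz.
  assert (H1 : k < 1 / 2) by split_min.
  assert (H2 : k < exp (- (M + 1))) by split_min.
  assert (HK : M + 1 <= ellK (compl_modulus k)).
  { eapply Rle_trans; [|now apply ellK_compl_lower].
    apply ln_increasing in H2; [|lra]. rewrite ln_exp in H2. lra. }
  assert (Hzy : exists x y, z = (x, y) /\ (y = 1 / 4 \/ y = 3 * (1 / 4))).
  { destruct Hz as [[x [_ ->]]|[x [_ ->]]].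
    - exists x, (1 / 4). split; [|now left]. C_field.
    - exists x, (3 * (1 / 4)). split; [|now right]. C_field. }
  destruct Hzy as [x [y [-> Hy]]].
  generalize (area_density2_lower k Hk x y Hy). intros HL.
  assert (HK2 : (M + 1) ^ 2 <= ellK (compl_modulus k) ^ 2) by (apply pow_incr; lra).
  assert (Hk2 : 3 / 4 <= 1 - k ^ 2) by nra.
  apply Rlt_le_trans with (2 := HL).
  apply Rlt_le_trans with (16 * (M + 1) ^ 2 * (3 / 4)); [nra|].
  apply Rmult_le_compat; nra.
Qed.
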